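(* Let $K\subset\mathbb{R}^n$ be a convex body. Then, for $-1<p<q<\infty$, $$\kappa(p)\,Z_p^\circ K\subseteq\kappa(q)\,Z_q^\circ K\subseteq(DK)^\circ,\qquad\text{where}\quad \kappa(p)=\begin{cases}\dbinom{2n+p}{p}^{-\frac1p},&p\neq0,\\ e^{-H_{2n}},&p=0.\end{cases}$$
   Context: A convex body is a compact convex set with non-empty interior. $H_m=\sum_{j=1}^m\frac1j$, and $\binom{2n+p}{p}=\frac{\Gamma(2n+p+1)}{\Gamma(2n+1)\Gamma(p+1)}$. The radial function of a star-shaped set $M$ (a set containing $0$ and, with each point $x$, the segment $[0,x]$) is $\rho_M(\theta)=\sup\{t>0:t\theta\in M\}$, $\theta\in\mathbb{S}^{n-1}$; a star body is a star-shaped compact set with finite, positive, continuous radial function. $DK=\{x\in\mathbb{R}^n:K\cap(K+x)\neq\emptyset\}$ is the difference body; its polar $(DK)^\circ$ has radial function $(\max_{x\in DK}|\langle x,\cdot\rangle|)^{-1}$. With the covariogram $g_K(x)=\mathrm{Vol}_n(K\cap(K+x))$, for $p>-1$ the polar $p$th mean zonoid $Z_p^\circ K$ is the star body with radial function $$\rho_{Z_p^\circ K}(\theta)=\left(\frac{1}{\mathrm{Vol}_n(K)^2}\int_{\mathbb{R}^n}|\langle\theta,z\rangle|^pg_K(z)dz\right)^{-1/p}\ (p\neq0),$$ $$\rho_{Z_0^\circ K}(\theta)=\exp\left(-\frac{1}{\mathrm{Vol}_n(K)^2}\int_{\mathbb{R}^n}\log|\langle\theta,z\rangle|\,g_K(z)dz\right),\quad\theta\in\mathbb{S}^{n-1}.$$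 *)

(* Defs.v *)
From HB Require Import structures.
From mathcomp Require Import all_boot all_order all_algebra.
From mathcomp Require Import all_classical all_reals all_analysis.

Set Implicit Arguments.
Unset Strict Implicit.
Unset Printing Implicit Defensive.

Import Order.TTheory GRing.Theory Num.Theory.
Import numFieldTopology.Exports numFieldNormedType.Exports.

Local Open Scope classical_set_scope.
Local Open Scope ring_scope.

(* The real numbers are an arbitrary [R : realType]; R^n is ['rV[R]_n]. *)

(** The library has Lebesgue measure on R and binary products only.  Here
    ['rV[R]_n] carries the product (= Borel) sigma-algebra, and
    [lebesgue_rV n] is the n-fold product of [lebesgue_measure]; see
    [lebesgue_rV_prod] for its value on products of measurable sets. *)

Definition measure_rV_display : measure_display -> measure_display.
Proof. exact. Qed.

Section measurable_rV.
Context {R : realType} {n : nat}.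

Definition rV_coord (i : 'I_n) (v : 'rV[R]_n) : measurableTypeR R := v ord0 i.

Let rV_set0 : g_sigma_preimage rV_coord set0.
Proof. exact: sigma_algebra0. Qed.

Let rV_setC A : g_sigma_preimage rV_coord A -> g_sigma_preimage rV_coord (~` A).
Proof. exact: sigma_algebraC. Qed.

Let rV_bigcup (F : (set 'rV[R]_n)^nat) :
  (forall i, g_sigma_preimage rV_coord (F i)) ->
  g_sigma_preimage rV_coord (\bigcup_i (F i)).
Proof. exact: sigma_algebra_bigcup. Qed.

HB.instance Definition _ := @isMeasurable.Build
  (measure_rV_display (R.-ocitv.-measurable).-sigma)
  'rV[R]_n (g_sigma_preimage rV_coord) rV_set0 rV_setC rV_bigcup.

Lemma measurable_rV_coord (i : 'I_n) : measurable_fun setT (rV_coord i).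
Proof.
move=> _ Y mY; rewrite setTI; apply: sub_sigma_algebra => /=.
rewrite -bigcup_seq/=; exists i => /=; first by rewrite mem_index_enum.
by exists Y => //; rewrite setTI.
Qed.

Lemma measurable_fun_rVP d (T : measurableType d) (f : T -> 'rV[R]_n) :
  (forall i, measurable_fun setT (rV_coord i \o f)) -> measurable_fun setT f.
Proof.
move=> mf _ Y mY; rewrite setTI.
have : sigma_algebra setT [set A : set 'rV[R]_n | measurable (f @^-1` A)].
  split => /=.
  - by rewrite preimage_set0; exact: measurable0.
  - by move=> A mA; rewrite setTD preimage_setC; exact: measurableC.
  - by move=> A mA; rewrite preimage_bigcup; exact: bigcupT_measurable.
move=> sA; apply: (mY [set A | measurable (f @^-1` A)]).
split; first exact: sA.
move=> A; rewrite -bigcup_seq/= => -[i _] [B mB <-] /=.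
by rewrite setTI -[_ @^-1` _]setTI; exact: mf.
Qed.

End measurable_rV.

Section lebesgue_rV.
Context {R : realType}.

Definition rV_cons n (x : measurableTypeR R * 'rV[R]_n) : 'rV[R]_n.+1 :=
  \row_i (if unlift ord0 i is Some j then x.2 ord0 j else x.1).

Definition rV_uncons n (v : 'rV[R]_n.+1) : measurableTypeR R * 'rV[R]_n :=
  (v ord0 ord0, \row_i v ord0 (lift ord0 i)).

Lemma rV_cons0 n (x : measurableTypeR R * 'rV[R]_n) :
  rV_cons x ord0 ord0 = x.1.
Proof. by rewrite mxE unlift_none. Qed.

Lemma rV_consS n (x : measurableTypeR R * 'rV[R]_n) (i : 'I_n) :
  rV_cons x ord0 (lift ord0 i) = x.2 ord0 i.
Proof. by rewrite mxE liftK. Qed.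

Lemma rV_consK n : cancel (@rV_cons n) (@rV_uncons n).
Proof.
move=> x; rewrite /rV_uncons rV_cons0 [RHS]surjective_pairing; congr pair.
by apply/rowP => i; rewrite mxE rV_consS.
Qed.

Lemma measurable_rV_cons n : measurable_fun setT (@rV_cons n).
Proof.
apply: measurable_fun_rVP => i; have [j ->|->] := unliftP ord0 i; last first.
  rewrite (_ : _ \o _ = fst) //; apply/funext => x /=.
  by rewrite /rV_coord rV_cons0.
rewrite (_ : _ \o _ = rV_coord j \o snd); last first.
  by apply/funext => x /=; rewrite /rV_coord rV_consS.
by apply: measurableT_comp => //; exact: measurable_rV_coord.
Qed.

Lemma measurable_rV_uncons n : measurable_fun setT (@rV_uncons n).
Proof.
apply/measurable_fun_pairP; split; first exact: (measurable_rV_coord ord0).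
apply: measurable_fun_rVP => i.
rewrite (_ : _ \o _ = rV_coord (lift ord0 i)); first exact: measurable_rV_coord.
by apply/funext => v; rewrite /rV_coord /= mxE.
Qed.

Section lebesgue_rV_step.
Context {n : nat} (mu : {sigma_finite_measure set 'rV[R]_n -> \bar R}).

Definition lebesgue_rV_step : set 'rV[R]_n.+1 -> \bar R :=
  pushforward (@lebesgue_measure R \x mu)%E (@rV_cons n).

Let step0 : lebesgue_rV_step set0 = 0%E.
Proof. by rewrite /lebesgue_rV_step /pushforward preimage_set0 measure0. Qed.

Let step_ge0 A : (0 <= lebesgue_rV_step A)%E.
Proof. by rewrite /lebesgue_rV_step /pushforward; exact: measure_ge0. Qed.

Let step_sigma_additive : semi_sigma_additive lebesgue_rV_step.
Proof.
have mc B : measurable B -> measurable (@rV_cons n @^-1` B).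
  by move=> mB; rewrite -[_ @^-1` _]setTI; exact: measurable_rV_cons.
move=> F mF tF mUF; rewrite /lebesgue_rV_step /pushforward preimage_bigcup.
apply: measure_semi_sigma_additive.
- by move=> k; exact: mc.
- apply/trivIsetP => /= i j _ _ ij; rewrite -preimage_setI.
  by move/trivIsetP : tF => /(_ _ _ _ _ ij) ->//; rewrite preimage_set0.
- by rewrite -preimage_bigcup; exact: mc.
Qed.

HB.instance Definition _ := isMeasure.Build _ _ _ lebesgue_rV_step
  step0 step_ge0 step_sigma_additive.

Let step_sigma_finite : sigma_finite setT lebesgue_rV_step.
Proof.
have /sigma_finiteP[F [TF ndF mF]] := sigma_finiteT (@lebesgue_measure R).
have /sigma_finiteP[G [TG ndG mG]] := sigma_finiteT mu.
exists (fun k => @rV_uncons n @^-1` (F k `*` G k)).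
  rewrite -preimage_bigcup; apply/esym/seteqP; split => // v _.
  have [k _ Fk] : (\bigcup_i F i) (rV_uncons v).1 by rewrite -TF.
  have [l _ Gl] : (\bigcup_i G i) (rV_uncons v).2 by rewrite -TG.
  exists (maxn k l) => //; split.
  - by move: Fk; exact/subsetPset/ndF/leq_maxl.
  - by move: Gl; exact/subsetPset/ndG/leq_maxr.
move=> k; have [mFk Fkoo] := mF k; have [mGk Gkoo] := mG k; split.
  by rewrite -[_ @^-1` _]setTI; apply: measurable_rV_uncons; last exact: measurableX.
rewrite /lebesgue_rV_step /pushforward -comp_preimage.
rewrite (_ : _ \o _ = id); last by apply/funext => x; exact: rV_consK.
by rewrite preimage_id product_measure1E// lte_mul_pinfty// ge0_fin_numE.
Qed.

HB.instance Definition _ := Measure_isSigmaFinite.Build _ _ _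
  lebesgue_rV_step step_sigma_finite.

End lebesgue_rV_step.

Fixpoint lebesgue_rV_rec n : {sigma_finite_measure set 'rV[R]_n -> \bar R} :=
  if n is m.+1 then lebesgue_rV_step (lebesgue_rV_rec m)
  else \d_(0 : 'rV[R]_0).

Definition lebesgue_rV n : set 'rV[R]_n -> \bar R := lebesgue_rV_rec n.

HB.instance Definition _ n := SigmaFiniteMeasure.on (@lebesgue_rV n).

Lemma lebesgue_rV_prod n (A : 'I_n -> set (measurableTypeR R)) :
  (forall i, measurable (A i)) ->
  lebesgue_rV [set v | forall i, A i (v ord0 i)] =
  (\prod_(i < n) lebesgue_measure (A i))%E.
Proof.
elim: n A => [|n IHn] A mA.
  rewrite big_ord0 /lebesgue_rV /= diracE (_ : _ \in _) //.
  by rewrite inE => -[].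
pose A' := fun i : 'I_n => A (lift ord0 i).
have mA' i : measurable (A' i) by exact: mA.
rewrite big_ord_recl -(IHn A') // /lebesgue_rV /= /lebesgue_rV_step /pushforward.
rewrite -product_measure1E //.
  congr (_ _); apply/seteqP; split => [x Ax|x [/= A0 AS] i].
    split; first by have := Ax ord0; rewrite rV_cons0.
    by move=> i; have := Ax (lift ord0 i); rewrite rV_consS.
  have [j ->|->] := unliftP ord0 i; last by rewrite rV_cons0.
  by rewrite rV_consS; exact: AS.
rewrite (_ : (fun _ => _) = \bigcap_i (rV_coord i @^-1` A' i)).
  apply: fin_bigcap_measurable => //.
  by move=> i _; rewrite -[_ @^-1` _]setTI; exact: measurable_rV_coord.
by apply/seteqP; split => [v Av i _|v Av i]; [exact: Av|exact: (Av i)].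
Qed.

End lebesgue_rV.

Section geometry.
Context {R : realType} {n : nat}.
Implicit Types (K M : set 'rV[R]_n) (x y z theta : 'rV[R]_n).

Definition dotv x y : R := \sum_i x ord0 i * y ord0 i.

(* The library norm on ['rV[R]_n] is the sup norm; the sphere is Euclidean. *)
Definition unit_sphere : set 'rV[R]_n := [set theta | dotv theta theta = 1].

Definition convex_body K := [/\ compact K, convex_set K & interior K !=set0].

Definition dilate (c : R) M : set 'rV[R]_n := [set c *: x | x in M].

Definition translate x M : set 'rV[R]_n := [set y + x | y in M].

Definition difference_body K : set 'rV[R]_n :=
  [set x | K `&` translate x K !=set0].

Definition polar M : set 'rV[R]_n := [set y | forall x, M x -> dotv x y <= 1].

Definition star_shaped M :=
  M 0 /\ forall x t, M x -> 0 <= t <= 1 -> M (t *: x).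

Definition ray_set M theta : set R := [set t | 0 < t /\ M (t *: theta)].

Definition radial_function M theta : R := sup (ray_set M theta).

Definition star_body M :=
  [/\ star_shaped M, compact M,
      forall theta, unit_sphere theta ->
        has_sup (ray_set M theta) /\ 0 < radial_function M theta
    & {within unit_sphere, continuous (radial_function M)}].

(* The star body with radial function [rho]: [star_body_ofE] shows that any
   star body with this radial function is this set, and
   [radial_function_star_body_of] that its radial function is [rho]. *)
Definition star_body_of (rho : 'rV[R]_n -> R) : set 'rV[R]_n :=
  [set x | exists theta t,
     [/\ unit_sphere theta, 0 <= t <= rho theta & x = t *: theta]].

Lemma dotvZ (a b : R) x y : dotv (a *: x) (b *: y) = a * b * dotv x y.
Proof.
rewrite /dotv mulr_sumr; apply: eq_bigr => i _.
by rewrite !mxE mulrACA.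
Qed.

Lemma dotv_gt0 x : x != 0 -> 0 < dotv x x.
Proof.
move=> x0; rewrite lt0r; apply/andP; split; last first.
  by apply: sumr_ge0 => i _; rewrite -expr2 sqr_ge0.
apply: contra x0; rewrite psumr_eq0; last by move=> i _; rewrite -expr2 sqr_ge0.
move=> /allP x0; apply/eqP/rowP => i; rewrite mxE; apply/eqP.
have := x0 i; rewrite mem_index_enum /= => /(_ isT).
by rewrite mulf_eq0 orbb.
Qed.

Lemma polar_coordinates x : x != 0 ->
  exists theta t, [/\ unit_sphere theta, 0 < t & x = t *: theta].
Proof.
move=> x0; have r0 : 0 < Num.sqrt (dotv x x) by rewrite sqrtr_gt0 dotv_gt0.
exists ((Num.sqrt (dotv x x))^-1 *: x), (Num.sqrt (dotv x x)); split => //.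
  rewrite /unit_sphere /= dotvZ -invfM -expr2 sqr_sqrtr ?ltW ?dotv_gt0 //.
  by rewrite mulVf// gt_eqF// dotv_gt0.
by rewrite scalerA divff ?scale1r// gt_eqF.
Qed.

Lemma unit_sphere_inj (s t : R) theta eta :
  unit_sphere theta -> unit_sphere eta -> 0 < s -> 0 <= t ->
  s *: theta = t *: eta -> s = t.
Proof.
rewrite /unit_sphere /= => th et s0 t0 e.
have : dotv (s *: theta) (s *: theta) = dotv (t *: eta) (t *: eta) by rewrite e.
by rewrite !dotvZ th et !mulr1 -!expr2 => /eqP; rewrite eqrXn2 // ?(ltW s0) // => /eqP.
Qed.

Lemma radial_function_star_body_of rho theta :
  unit_sphere theta -> 0 < rho theta ->
  radial_function (star_body_of rho) theta = rho theta.
Proof.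
move=> th r0; rewrite /radial_function.
suff -> : ray_set (star_body_of rho) theta = `]0, rho theta]%classic.
  by rewrite sup_itv // bnd_simp.
apply/seteqP; split => t /=; rewrite in_itv /=.
  move=> [t0 [eta [s [et /andP[s0 sr] e]]]]; rewrite t0 /=.
  have ts := unit_sphere_inj th et t0 s0 e.
  suff -> : theta = eta by rewrite ts.
  by move: e; rewrite -ts => /scalerI; apply; rewrite gt_eqF.
by move=> /andP[t0 tr]; split => //; exists theta, t; rewrite ltW.
Qed.

Lemma star_body_ofE M rho : (0 < n)%N -> star_body M ->
  (forall theta, unit_sphere theta -> radial_function M theta = rho theta) ->
  M = star_body_of rho.
Proof.
move=> n0 [[M0 starM] cM posM _] rhoE.
have closedM : closed M by apply: compact_closed => //; exact: norm_hausdorff.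
apply/seteqP; split => x.
  have [-> _|/polar_coordinates[theta [t [th t0 ->]]] Mt] := eqVneq x 0.
    have d0 : delta_mx ord0 (Ordinal n0) != 0 :> 'rV[R]_n.
      apply/eqP => /rowP/(_ (Ordinal n0))/eqP.
      by rewrite !mxE !eqxx oner_eq0.
    have [theta [_ [th _ _]]] := polar_coordinates d0.
    exists theta, 0; rewrite scale0r lexx /= -rhoE //; split => //.
    by apply: ltW; case: (posM _ th).
  exists theta, t; split => //; rewrite (ltW t0) /= -rhoE //.
  by apply: sup_upper_bound => //; case: (posM _ th).
move=> [theta [t [th /andP[t0 tr] ->]]].
have [[ne ub] rho0] := posM _ th.
have Mr : M (radial_function M theta *: theta).
  have clM : closed ((fun s : R => s *: theta) @^-1` M).
    by apply: closed_comp => // s _; exact: scalel_continuous.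
  suff: closure ((fun s : R => s *: theta) @^-1` M) (radial_function M theta).
    by have /closure_id <- := clM.
  by apply: closureS (closure_sup ne ub) => s [].
rewrite (_ : t *: theta = (t / radial_function M theta) *:
    (radial_function M theta *: theta)).
  apply: starM => //; rewrite divr_ge0 ?(ltW rho0) //=.
  by rewrite ler_pdivrMr // mul1r rhoE.
by rewrite scalerA divfK // gt_eqF.
Qed.

End geometry.

Section mean_zonoid.
Context {R : realType}.

Definition volume n (K : set 'rV[R]_n) : R := fine (lebesgue_rV K).

Definition covariogram n (K : set 'rV[R]_n) (x : 'rV[R]_n) : R :=
  volume (K `&` translate x K).

(* [ln 0 = 0] and [0 `^ p = 0] for [p != 0]; these conventions only affect the
   integrands on the null hyperplane orthogonal to [theta]. *)
Definition mean_zonoid_radial n (p : R) (K : set 'rV[R]_n) (theta : 'rV[R]_n)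
    : R :=
  if p == 0 then
    expR (- ((volume K ^+ 2)^-1 *
      \int[@lebesgue_rV R n]_z (ln `|dotv theta z| * covariogram K z)))
  else
    ((volume K ^+ 2)^-1 *
      \int[@lebesgue_rV R n]_z (`|dotv theta z| `^ p * covariogram K z))
    `^ (- p^-1).

Definition polar_mean_zonoid n (p : R) (K : set 'rV[R]_n) : set 'rV[R]_n :=
  star_body_of (mean_zonoid_radial p K).

Definition Gamma (x : R) : R :=
  \int[@lebesgue_measure R]_(t in `]0, +oo[) (t `^ (x - 1) * expR (- t)).

Definition harmonic_number (m : nat) : R := \sum_(1 <= j < m.+1) j%:R^-1.

(* The binomial coefficient "2n+p choose p" for real [p > -1]. *)
Definition binom2n (n : nat) (p : R) : R :=
  Gamma ((2 * n)%:R + p + 1) / (Gamma ((2 * n)%:R + 1) * Gamma (p + 1)).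

Definition kappa (n : nat) (p : R) : R :=
  if p == 0 then expR (- harmonic_number (2 * n))
  else binom2n n p `^ (- p^-1).

End mean_zonoid.

(* Main.v *)
(* Fix a unit vector theta and let X = |<theta, x - y>| for x, y independent and
   uniform in K.  By the Borell-Brascamp-Lieb inequality (one coordinate at a
   time) the tail P(X > s) is the 2n-th power of a concave function of s on
   [0, h], where h is the maximum of <theta, .> on DK.  It is compared with the
   tails (1 - s / H)_+ ^ (2n), whose p-th moments are
   H ^ p / binom(2n + p, p): let H_p be the H for which the p-th moments agree,
   so that kappa(p) times the radial function is 1 / H_p.  Concavity gives
   P(X > s) >= (1 - s / h) ^ (2n), hence h <= H_p.  Concavity also makes the two
   tails cross at most once, at some s0, from above to below; integrating them
   against the derivative of s ^ q / q - s0 ^ (q - p) * s ^ p / p, which changes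
   sign at s0, shows H_q <= H_p for p < q.  Working with (s ^ p - 1) / p, read
   as ln s for p = 0, treats all exponents at once. *)
From HB Require Import structures.
Require Import Defs.
From mathcomp Require Import all_boot all_order all_algebra finmap.
From mathcomp Require Import all_classical all_reals all_analysis.
From mathcomp Require Import measurable_realfun ring lra.

Set Implicit Arguments.
Unset Strict Implicit.
Unset Printing Implicit Defensive.

Import Order.TTheory GRing.Theory Num.Theory.
Import numFieldTopology.Exports numFieldNormedType.Exports.

Local Open Scope classical_set_scope.
Local Open Scope ring_scope.

(** * The Borell-Brascamp-Lieb inequality *)

(** The exponent 2n counts integrations. Half of the tail is the marginal in s of the convex set of
    triples (s, z, w) with [s < dotv theta z] and both [w] and [w - z] in [K], and each of the 2n
    coordinates of z and w that is integrated out raises the exponent by one. The slices met on the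
    way have intervals as level sets, so the geometric input is the inequality for lengths of
    intervals. Concavity of a root is expressed by test numbers whose powers lie below the values,
    which keeps roots of integrals out of the statements. The delicate exponents are -1 < p <= 0,
    where the integrand is singular on the hyperplane orthogonal to theta. The lower bound on the
    tail of X also bounds the mass of small X, and thereby yields integrability. The weight is set
    to 0 where X = 0, so that the values of [ln] and of powers at 0 never enter. The comparison at
    the crossing point s0 is made level by level: the test function is split at s0 into a decreasing
    and an increasing part, whose level sets are sets X <= a or X >= b. *)

Section tangent.
Variable R : realFieldType.
Implicit Types (a b l r y J : R) (k : nat).

(** The power lies above its tangent at [r]: this is y^(k+1) >= r^(k+1) + (k+1) r^k (y - r),
    rearranged. The induction step leaves the square (k+1) r^k (y - r)^2 as remainder. *)
Lemma tangent_exprS k r y : 0 <= r -> 0 <= y ->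
  k.+1%:R * r ^+ k * y <= y ^+ k.+1 + k%:R * r ^+ k.+1.
Proof.
move=> r0 y0; elim: k => [|k IHk]; first by rewrite expr0 mul0r !expr1; lra.
have := mulr_ge0 y0 (eqbRL (subr_ge0 _ _) IHk).
have : 0 <= k.+1%:R * r ^+ k * (y - r) ^+ 2.
  by rewrite mulr_ge0 ?sqr_ge0// mulr_ge0// exprn_ge0.
move=> h1 h2; rewrite -subr_ge0.
have -> : y ^+ k.+2 + k.+1%:R * r ^+ k.+2 - k.+2%:R * r ^+ k.+1 * y =
    k.+1%:R * r ^+ k * (y - r) ^+ 2 +
    y * (y ^+ k.+1 + k%:R * r ^+ k.+1 - k.+1%:R * r ^+ k * y).
  by rewrite !exprS -!natr1; ring.
by rewrite addr_ge0.
Qed.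

(** The tangent inequality at y = x / a, multiplied by a. The hypothesis is J >= x^(k+1) / a^k
    written without division, so that a = 0 is covered. *)
Lemma perspective_tangent k r x a J : 0 <= r -> 0 <= x -> 0 <= a -> 0 <= J ->
  x ^+ k.+1 <= J * a ^+ k -> k.+1%:R * r ^+ k * x <= J + k%:R * r ^+ k.+1 * a.
Proof.
move=> r0 x0 a0 J0; have [->|an0] := eqVneq a 0.
  case: k => [|k]; first by rewrite !expr0 expr1; lra.
  rewrite expr0n /= mulr0 => h.
  have -> : x = 0.
    by apply/eqP; rewrite -[_ == _]andTb -(expf_eq0 x k.+2) eq_le h exprn_ge0.
  by rewrite !mulr0 addr0.
have {an0}a0 : 0 < a by rewrite lt_neqAle eq_sym an0.
move=> h; have y0 : 0 <= x / a by rewrite divr_ge0// ltW.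
have := tangent_exprS k r0 y0; rewrite -(ler_pM2r a0).
have -> : k.+1%:R * r ^+ k * (x / a) * a = k.+1%:R * r ^+ k * x.
  by rewrite -!mulrA mulVf ?mulr1// gt_eqF.
move=> /le_trans; apply; rewrite mulrDl lerD2r.
rewrite exprSr expr_div_n -mulrA divfK ?gt_eqF// mulrAC -exprSr.
by rewrite ler_pdivrMr// exprn_gt0.
Qed.

(** Convexity of the perspective x^(k+1) / a^k, a supremum over r of the linear functions of
    [perspective_tangent]. In the application a^k is the supremum of a function and J its integral
    divided by that supremum. *)
Lemma perspective_convex k l x y a b J K : 0 < l < 1 ->
  0 <= x -> 0 <= y -> 0 <= a -> 0 <= b -> 0 <= J -> 0 <= K ->
  x ^+ k.+1 <= J * a ^+ k -> y ^+ k.+1 <= K * b ^+ k ->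
  ((1 - l) * x + l * y) ^+ k.+1 <=
    ((1 - l) * a + l * b) ^+ k * ((1 - l) * J + l * K).
Proof.
move=> /andP[l0 l1] x0 y0 a0 b0 J0 K0 hx hy.
have l1' : 0 < 1 - l by rewrite subr_gt0.
set X := (1 - l) * x + l * y; set U := (1 - l) * a + l * b.
set W := (1 - l) * J + l * K.
have X0 : 0 <= X by rewrite addr_ge0// mulr_ge0// ltW.
have U0 : 0 <= U by rewrite addr_ge0// mulr_ge0// ltW.
have T r : 0 <= r -> k.+1%:R * r ^+ k * X <= W + k%:R * r ^+ k.+1 * U.
  move=> r0; have h1 := perspective_tangent r0 x0 a0 J0 hx.
  have h2 := perspective_tangent r0 y0 b0 K0 hy.
  have := lerD (ler_wpM2l (ltW l1') h1) (ler_wpM2l (ltW l0) h2).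
  rewrite -subr_ge0 => h; rewrite -subr_ge0 /X /U /W.
  by apply: le_trans h _; rewrite le_eqVlt; apply/orP; left; apply/eqP; ring.
have [U00|Un0] := eqVneq U 0.
  have W0 : 0 <= W by rewrite addr_ge0// mulr_ge0// ltW.
  move: U00 => /eqP; rewrite paddr_eq0 ?mulr_ge0// ?(ltW l0) ?(ltW l1')//.
  rewrite !mulf_eq0 (gt_eqF l0) (gt_eqF l1')/= => /andP[/eqP az /eqP bz].
  case: k hx hy T => [|k] hx hy T.
    by have := T 0 (lexx _); rewrite !expr0 expr1; lra.
  move: hx hy; rewrite az bz !expr0n/= !mulr0 => hx hy.
  have xz : x = 0.
    by apply/eqP; rewrite -[_ == _]andTb -(expf_eq0 x k.+2) eq_le hx exprn_ge0.
  have yz : y = 0.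
    by apply/eqP; rewrite -[_ == _]andTb -(expf_eq0 y k.+2) eq_le hy exprn_ge0.
  by rewrite /X xz yz !mulr0 addr0 expr0n/= mulr_ge0// exprn_ge0.
have {Un0}U0 : 0 < U by rewrite lt_neqAle eq_sym Un0.
(* The bounds [T] are sharpest for the tangent taken at the quotient X / U itself. *)
have r0 : 0 <= X / U by rewrite divr_ge0// ltW.
have := T _ r0; set r := X / U.
have -> : X = r * U by rewrite /r divfK// gt_eqF.
move=> h; rewrite exprMn [U ^+ k.+1]exprSr mulrA [leRHS]mulrC.
rewrite -mulrA [U ^+ k * U]mulrC mulrA ler_pM2r ?exprn_gt0//.
rewrite -subr_ge0 in h; rewrite -subr_ge0.
apply: le_trans h _; rewrite le_eqVlt; apply/orP; left; apply/eqP.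
by rewrite exprS -natr1; ring.
Qed.

End tangent.

(** * Layer-cake formula with a weight *)

Section layer_cake.
Context d (T : measurableType d) (R : realType).
Variable mu : {sigma_finite_measure set T -> \bar R}.
Local Open Scope ereal_scope.
Variables (b : bool) (V : T -> R) (D : T -> \bar R).
Hypotheses (mV : measurable_fun setT V) (mD : measurable_fun setT D).
Hypothesis D0 : forall x, 0 <= D x.

Let A := [set p : T * measurableTypeR R | (p.2 < V p.1 ?<= if b)%R].

Let mA : measurable A.
Proof.
rewrite (_ : A = (fun p : T * measurableTypeR R => (p.2 < V p.1 ?<= if b)%R)
    @^-1` [set true]); last by apply/seteqP; split.
have mV1 : measurable_fun setT (fun p : T * measurableTypeR R => V p.1).
  exact: measurableT_comp.
rewrite -[X in measurable X]setTI; case: b => /=.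
  by apply: measurable_fun_ler.
by apply: measurable_fun_ltr.
Qed.

Let F := fun p : T * measurableTypeR R => (\1_A p)%:E * D p.1.

Let mF : measurable_fun setT F.
Proof.
apply: emeasurable_funM; last exact: measurableT_comp.
by apply/measurable_EFinP; exact: measurable_indic.
Qed.

Let F0 p : 0 <= F p. Proof. by rewrite mule_ge0// lee_fin. Qed.

Let FE c : \int[mu]_(x in [set x | (c < V x ?<= if b)%R]) D x =
  \int[mu]_x F (x, c).
Proof.
rewrite integral_mkcond; apply: eq_integral => x _; rewrite patchE /F /=.
rewrite indicE; case: ifPn => [|]; rewrite ?inE ?notin_setE /= => h.
  by rewrite mem_set ?mul1e.
by rewrite memNset ?mul0e.
Qed.

Lemma measurable_fun_level : measurable_fun setT (fun c : R =>
  \int[mu]_(x in [set x | (c < V x ?<= if b)%R]) D x).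
Proof.
rewrite (funext FE).
exact: (@measurable_fun_fubini_tonelli_G _ _ _ _ _ mu F).
Qed.

(** Tonelli's theorem on the region between 0 and the graph of [V]. The flag [b] makes the level
    sets large or strict: the one-dimensional step below uses strict levels for the two given
    functions and large levels for the third. *)
Lemma layer_cake : (forall x, 0 <= V x)%R ->
  \int[mu]_x ((V x)%:E * D x) =
  \int[lebesgue_measure]_(c in `]0%R, +oo[)
    \int[mu]_(x in [set x | (c < V x ?<= if b)%R]) D x.
Proof.
move=> V0; rewrite [RHS]integral_mkcond.
pose G p := (\1_(`]0%R, +oo[%classic : set R) p.2)%:E * F p.
have mG : measurable_fun setT G.
  apply: emeasurable_funM => //; apply/measurable_EFinP.
  by apply: measurableT_comp; [exact: measurable_indic|exact: measurable_snd].
have G0 p : 0 <= G p by rewrite mule_ge0// lee_fin.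
transitivity (\int[mu]_x \int[lebesgue_measure]_c G (x, c)); last first.
  rewrite fubini_tonelli//=; apply: eq_integral => c _; rewrite patchE FE /G /=.
  rewrite ge0_integralZl//; last exact: (measurableT_comp mF).
  by rewrite indicE; case: ifP => _; rewrite ?mul1e ?mul0e.
apply: eq_integral => x _.
pose I := [set` Interval (BRight 0%R) (BSide (~~ b) (V x))] : set R.
transitivity (\int[lebesgue_measure]_c ((\1_I c)%:E * D x)).
  rewrite ge0_integralZr//; last first.
      by apply/measurable_EFinP; apply: measurable_indic; exact: measurable_itv.
  congr (_ * _); rewrite integral_indic//= ?setIT; last exact: measurable_itv.
    rewrite lebesgue_measure_itv/= lte_fin.
  case: ltP => [_|V0']; first by rewrite oppr0 adde0.
  by congr EFin; apply/eqP; rewrite eq_le V0 V0'.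
apply: eq_integral => c _; rewrite /G /F /= muleA -EFinM !indicE.
suff -> : (c \in I) = (c \in `]0%R, +oo[%classic) && ((x, c) \in A).
  by case: (c \in _) => /=; rewrite ?mul1r ?mul0r.
apply/idP/andP; rewrite !inE /A/= /I/= !in_itv/= andbT; last first.
  by case: b => -[-> ->].
by case: b => /= /andP[].
Qed.

End layer_cake.

(** * Brunn-Minkowski inequality for intervals *)

Section interval_brunn_minkowski.
Variable R : realType.
Implicit Types (S A B C : set R) (l : R).
Notation mu := (@lebesgue_measure R).

Definition cvx_set S := forall x y l, S x -> S y -> 0 < l < 1 ->
  S ((1 - l) * x + l * y).

Lemma cvx_set_interval S : cvx_set S -> is_interval S.
Proof.
move=> cS x y Sx Sy z /andP[]; rewrite le_eqVlt => /predU1P[<-//|xz].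
rewrite le_eqVlt => /predU1P[->//|zy].
have xy : x < y by exact: lt_trans zy.
have -> : z = (1 - (z - x) / (y - x)) * x + (z - x) / (y - x) * y.
  by field; rewrite subr_eq0 gt_eqF.
apply: cS => //; rewrite divr_gt0 ?subr_gt0//= ltr_pdivrMr ?subr_gt0// mul1r.
by rewrite ltrD2r.
Qed.

Lemma measurable_cvx_set S : cvx_set S -> measurable (S : set (measurableTypeR R)).
Proof. by move/cvx_set_interval; exact: is_interval_measurable. Qed.

Lemma cvx_set_measure_le S : cvx_set S -> has_sup S -> has_inf S ->
  (mu S <= (sup S - inf S)%:E)%E.
Proof.
move=> cS hs hi; have Ssub : S `<=` `[inf S, sup S].
  by move=> x Sx; rewrite /= in_itv/= inf_lbound ?sup_ubound//; [case: hs|case: hi].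
apply: (@le_trans _ _ (mu `[inf S, sup S])).
  by apply: le_measure => //; rewrite inE; [exact: measurable_cvx_set|exact: measurable_itv].
rewrite lebesgue_measure_itv/= lte_fin; case: ifP => // _.
by rewrite lee_fin subr_ge0; case: hs => -[x Sx] hu; apply: (@le_trans _ _ x);
  [apply: inf_lbound => //; case: hi|apply: sup_ubound].
Qed.

(** The measures of A and B are at most the lengths of their hulls, while C contains the whole open
    interval between the combination u of the infima and the combination v of the suprema. *)
Lemma brunn_minkowski_interval A B C l : 0 < l < 1 ->
  cvx_set A -> cvx_set B -> has_sup A -> has_inf A -> has_sup B -> has_inf B ->
  measurable (C : set (measurableTypeR R)) ->
  (forall x y, A x -> B y -> C ((1 - l) * x + l * y)) ->
  ((1 - l)%:E * mu A + l%:E * mu B <= mu C)%E.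
Proof.
move=> /andP[l0 l1] cA cB sA iA sB iB mC ABC.
have l1' : 0 < 1 - l by rewrite subr_gt0.
apply: (@le_trans _ _
  ((1 - l)%:E * (sup A - inf A)%:E + l%:E * (sup B - inf B)%:E)%E).
  by apply: leeD; (apply: lee_wpmul2l; last exact: cvx_set_measure_le);
    rewrite lee_fin ltW.
rewrite -!EFinM -EFinD.
set u := (1 - l) * inf A + l * inf B; set v := (1 - l) * sup A + l * sup B.
rewrite [X in X%:E](_ : _ = v - u); last by rewrite /u /v; ring.
have [vu|uv] := leP v u.
  by apply: le_trans (measure_ge0 mu C); rewrite lee_fin subr_le0.
have -> : (v - u)%:E = mu `]u, v[ by rewrite lebesgue_measure_itv/= lte_fin uv.
apply: le_measure; rewrite ?inE//.
move=> z; rewrite /= in_itv/= => /andP[uz zv].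
have e1 : 0 < z - u by rewrite subr_gt0.
have e2 : 0 < v - z by rewrite subr_gt0.
(* Points near the two infima combine to some p < z, points near the two suprema to some q > z.
   Writing z between p and q and regrouping exhibits it as a combination of a point of A and a point
   of B. *)
have [a1 A1 a1z] := inf_adherent e1 iA; have [b1 B1 b1z] := inf_adherent e1 iB.
have [a2 A2 a2z] := sup_adherent e2 sA; have [b2 B2 b2z] := sup_adherent e2 sB.
set p := (1 - l) * a1 + l * b1; set q := (1 - l) * a2 + l * b2.
have pz : p < z by rewrite /p /u in uz a1z b1z *; nra.
have zq : z < q by rewrite /q /v in zv a2z b2z *; nra.
have pq : p < q by exact: lt_trans zq.
pose s := (z - p) / (q - p).
have s01 : 0 < s < 1.
  by rewrite /s divr_gt0 ?subr_gt0//= ltr_pdivrMr ?subr_gt0// mul1r ltrD2r.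
rewrite (_ : z = (1 - l) * ((1 - s) * a1 + s * a2) + l * ((1 - s) * b1 + s * b2)).
  by apply: ABC; [exact: cA|exact: cB].
have : s * (q - p) = z - p by rewrite /s divfK// subr_eq0 gt_eqF.
by rewrite /p /q => h; rewrite -[LHS](subrK p) -h /p; ring.
Qed.

End interval_brunn_minkowski.

(** * The inequality for functions of one variable *)

Section brascamp_lieb_1d.
Variable R : realType.
Notation mu := (@lebesgue_measure R).

Lemma level_integral (f : R -> R) (a : R) : 0 < a -> (forall x, 0 <= f x <= a) ->
  measurable_fun setT f ->
  (\int[mu]_(t in `]0%R, 1%R[) mu [set x | (a * t < f x)%R] =
   (a^-1)%:E * \int[mu]_x (f x)%:E)%E.
Proof.
move=> a0 fa mf.
pose V x := a^-1 * f x.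
have mV : measurable_fun setT V by apply: measurable_funM => //; exact: measurable_cst.
have V0 x : 0 <= V x by rewrite mulr_ge0 ?invr_ge0 ?(ltW a0)//; case/andP: (fa x).
have := layer_cake mu false mV (measurable_cst (1%E : \bar R)) (fun=> lee01) V0.
under eq_integral do rewrite mule1 EFinM.
rewrite ge0_integralZl//; last 3 first.
- exact/measurable_EFinP.
- by move=> x _; rewrite lee_fin; case/andP: (fa x).
- by rewrite lee_fin invr_ge0 ltW.
move=> ->; rewrite [LHS]integral_mkcond [RHS]integral_mkcond.
apply: eq_integral => t _; rewrite !patchE.
have VE : [set x | t < V x] = [set x | a * t < f x].
  by apply/seteqP; split=> x /=; rewrite /V ltr_pdivlMl.
case: ifPn => [|]; rewrite ?inE ?notin_setE /= in_itv/= => ht.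
  rewrite mem_set; last by rewrite /= in_itv/= andbT; case/andP: ht.
  rewrite VE integral_cst ?mul1e// -VE.
  rewrite -[X in measurable X]setTI.
  exact: measurable_fun_ltr.
case: ifPn => //; rewrite inE /= in_itv/= andbT => t0.
move/negP: ht; rewrite t0/= -leNgt => t1.
rewrite (_ : [set x | _] = set0) ?integral_set0//.
apply/seteqP; split=> x //= => tV; have /andP[_] := fa x.
rewrite leNgt => /negP; apply; move: tV; rewrite /V ltr_pdivlMl// => tV.
by apply: le_lt_trans tV; rewrite ler_peMr// ltW.
Qed.

(** An inequality, unlike [level_integral], because [f] may exceed [c] and the levels with t >= 1
    are dropped. *)
Lemma level_integral_le (f : R -> R) (c : R) : 0 < c -> (forall x, 0 <= f x) ->
  measurable_fun setT f ->
  (\int[mu]_(t in `]0%R, 1%R[) mu [set x | (c * t <= f x)%R] <=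
   (c^-1)%:E * \int[mu]_x (f x)%:E)%E.
Proof.
move=> c0 f0 mf.
pose V x := c^-1 * f x.
have mV : measurable_fun setT V by apply: measurable_funM => //; exact: measurable_cst.
have V0 x : 0 <= V x by rewrite mulr_ge0 ?invr_ge0 ?(ltW c0).
have := layer_cake mu true mV (measurable_cst (1%E : \bar R)) (fun=> lee01) V0.
under eq_integral do rewrite mule1 EFinM.
rewrite ge0_integralZl//; last 3 first.
- exact/measurable_EFinP.
- by move=> x _; rewrite lee_fin.
- by rewrite lee_fin invr_ge0 ltW.
move=> ->.
have VE t : (\int[mu]_(x in [set x | (t < V x ?<= if true)%R]) 1 =
    mu [set x | (c * t <= f x)%R])%E.
  rewrite (_ : [set x | _] = [set x | c * t <= f x]).
    rewrite integral_cst ?mul1e// -[X in measurable X]setTI.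
    by apply: measurable_fun_ler => //; exact: measurable_cst.
  by apply/seteqP; split=> x /=; rewrite /V ler_pdivlMl.
under [leRHS]eq_integral do rewrite VE.
apply: ge0_subset_integral => //; try exact: measurable_itv.
- apply: measurable_funTS.
  rewrite -(funext VE); apply: measurable_fun_level => //; exact: measurable_cst.
- by move=> t; rewrite /= !in_itv/= andbT => /andP[].
Qed.

Lemma has_sup_itv_sub (S : set R) r : S !=set0 -> (forall x, S x -> `|x| <= r) ->
  has_sup S /\ has_inf S.
Proof.
move=> S0 Sr; split; split=> //; [exists r|exists (- r)] => x /Sr;
  by rewrite ler_norml => /andP[].
Qed.

(** Normal form of a slice f: a^k is its supremum, J its integral divided by a^k, and G t the
    measure of the level set at the fraction t of the supremum. If f vanishes identically, then J =
    0 and a single point of A serves as level set. For k = 0 the supremum is 1 = a^0 because f = 1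
    on A. *)
Lemma level_profile k (A : set R) (f : R -> R) (M r : R) : A !=set0 ->
  (forall x, A x -> `|x| <= r) ->
  (forall x, 0 <= f x <= M) -> (forall x, ~ A x -> f x = 0) ->
  measurable_fun setT f ->
  (forall c, cvx_set [set x | A x /\ c < f x]) ->
  (k = 0%N -> forall x, A x -> f x = 1) ->
  exists a J (G : R -> \bar R),
    [/\ 0 <= a /\ 0 <= J,
        measurable_fun setT G /\ (forall t, 0 <= G t)%E,
        (\int[mu]_(t in `]0%R, 1%R[) G t = J%:E)%E,
        forall x, 0 <= x -> ((x ^+ k.+1)%:E <= \int[mu]_t (f t)%:E)%E ->
          x ^+ k.+1 <= J * a ^+ k &
        forall t, 0 < t < 1 -> exists S : set R, [/\ cvx_set S, has_sup S, has_inf S,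
          (G t <= mu S)%E & forall x, S x -> A x /\ a ^+ k * t <= f x]].
Proof.
move=> [x0 Ax0] Ar fM fA mf fcvx f1.
have hsup : has_sup [set f x | x in A].
  by split; [exists (f x0), x0|exists M => _ [x Ax <-]; case/andP: (fM x)].
pose b := sup [set f x | x in A].
have fb x : A x -> f x <= b by move=> Ax; apply: sup_ubound; [case: hsup|exists x].
have b0 : 0 <= b by apply: le_trans (fb _ Ax0); case/andP: (fM x0).
have fb' x : 0 <= f x <= b.
  case/andP: (fM x) => -> _ /=; have [/fb//|/fA ->//] := pselect (A x).
have [a a0 ab] : exists2 a, 0 <= a & a ^+ k = b.
  case: k f1 => [|k] f1; last first.
    exists (b `^ (k.+1%:R^-1)); first exact: powR_ge0.
    by rewrite -powR_mulrn ?powR_ge0// -powRrM mulVf ?powRr1// pnatr_eq0.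
  exists 1; rewrite ?expr0//; apply/eqP; rewrite eq_le -{1}(f1 erefl _ Ax0) fb//=.
  by apply: ge_sup; [exists (f x0), x0|move=> _ [x Ax <-]; rewrite f1].
have fint : (\int[mu]_t (f t)%:E < +oo)%E.
  apply: (@le_lt_trans _ _ (\int[mu]_(t in `[(- r)%R, r]) (cst M%:E) t)%E).
    rewrite [leRHS]integral_mkcond; apply: ge0_le_integral => //.
    - by move=> x _; rewrite lee_fin; case/andP: (fM x).
    - exact/measurable_EFinP.
    - by apply/measurable_restrict => //; exact: measurable_cst.
    - move=> x _; rewrite patchE; case: ifPn => [_|].
        by rewrite lee_fin; case/andP: (fM x).
      rewrite notin_setE /= in_itv/= => h; rewrite fA// => /Ar.
      by rewrite ler_norml.
  rewrite integral_cst//= lebesgue_measure_itv/= lte_fin.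
  by case: ifP => _; rewrite ?mule0 ?ltry// -EFinB -EFinM ltry.
have fint0 : (0 <= \int[mu]_t (f t)%:E)%E.
  by apply: integral_ge0 => x _; rewrite lee_fin; case/andP: (fM x).
have [b00|bn0] := eqVneq b 0.
  exists a, 0, (cst 0%E); split=> //.
  - by rewrite integral0_eq.
  - move=> x x0'; rewrite integral0_eq ?lee_fin ?mul0r// => t _.
    by have := fb' t; rewrite b00 -eq_le => /eqP <-.
  - move=> t _; exists [set x0].
    have [? ?] : has_sup [set x0] /\ has_inf [set x0].
      by apply: (@has_sup_itv_sub _ `|x0|); [exists x0|move=> _ ->].
    split=> //.
    + by move=> _ _ l -> -> _ /=; ring.
    + exact: measure_ge0.
    + by move=> _ ->; split=> //; rewrite ab b00 mul0r; case/andP: (fb' x0).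
have {bn0}bp : 0 < b by rewrite lt_neqAle eq_sym bn0.
exists a, (b^-1 * fine (\int[mu]_t (f t)%:E)), (fun t => mu [set x | b * t < f x]).
have mlev c : measurable [set x : measurableTypeR R | c < f x].
  by rewrite -[X in measurable X]setTI; exact: measurable_fun_ltr.
split.
- by split=> //; rewrite mulr_ge0 ?invr_ge0 ?fine_ge0.
- split=> [|t]; last exact: measure_ge0.
  have VE t : (\int[mu]_(x in [set x | (t < b^-1 * f x ?<= if false)%R]) 1 =
      mu [set x | (b * t < f x)%R])%E.
    rewrite (_ : [set x | _] = [set x | b * t < f x]).
      by rewrite integral_cst ?mul1e.
    by apply/seteqP; split=> x /=; rewrite ltr_pdivlMl.
  rewrite -(funext VE); apply: measurable_fun_level => //.
  by apply: measurable_funM => //; exact: measurable_cst.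
- by rewrite level_integral// EFinM fineK// ge0_fin_numE.
- move=> x x0' hx; rewrite ab mulrAC mulVf ?mul1r ?gt_eqF//.
  by rewrite -lee_fin fineK// ge0_fin_numE.
- move=> t /andP[t0 t1].
  have bt0 : 0 <= b * t by rewrite mulr_ge0// ltW.
  have levA x : b * t < f x -> A x.
    by move=> h; apply: contrapT => /fA fx0; move: h; rewrite fx0 ltNge bt0.
  exists [set x | A x /\ b * t < f x].
  have SE : [set x | A x /\ b * t < f x] = [set x | b * t < f x].
    by apply/seteqP; split=> x /= => [[]//|h]; split=> //; exact: levA.
  have [? ?] : has_sup [set x | A x /\ b * t < f x] /\
      has_inf [set x | A x /\ b * t < f x].
    apply: (@has_sup_itv_sub _ r); last by move=> x [/Ar].
    (* As t < 1, the level b t is strictly below the supremum, so the level set is nonempty. *)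
    have e0 : 0 < b * (1 - t) by rewrite mulr_gt0// subr_gt0.
    have [_ [x Ax <-] h] := sup_adherent e0 hsup.
    exists x; split=> //; apply: le_lt_trans h; rewrite -/b.
    by rewrite le_eqVlt; apply/orP; left; apply/eqP; ring.
  split=> //; first by rewrite SE.
  by move=> x [Ax h]; split=> //; rewrite ab ltW.
Qed.

(** Levels at the same fraction t of the suprema a^k and b^k combine into the level U^k t of f,
    where U = (1-l) a + l b. Integrating the interval inequality over t in (0, 1) bounds the
    integral of f below by U^k ((1-l) J + l K), and [perspective_convex] turns this into a statement
    about (k+1)-st powers. Comparing relative instead of equal levels is what gains one in the
    exponent. *)
Lemma brascamp_lieb_1d k l (A0 A1 : set R) (f0 f1 f : R -> R) (M r : R) :
  0 < l < 1 -> A0 !=set0 -> A1 !=set0 ->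
  (forall x, A0 x -> `|x| <= r) -> (forall x, A1 x -> `|x| <= r) ->
  (forall x, 0 <= f0 x <= M) -> (forall x, 0 <= f1 x <= M) ->
  (forall x, ~ A0 x -> f0 x = 0) -> (forall x, ~ A1 x -> f1 x = 0) ->
  measurable_fun setT f0 -> measurable_fun setT f1 ->
  (forall c, cvx_set [set x | A0 x /\ c < f0 x]) ->
  (forall c, cvx_set [set x | A1 x /\ c < f1 x]) ->
  (k = 0%N -> forall x, A0 x -> f0 x = 1) ->
  (k = 0%N -> forall x, A1 x -> f1 x = 1) ->
  (forall x, 0 <= f x) -> measurable_fun setT f ->
  (forall x y a b, A0 x -> A1 y -> 0 <= a -> 0 <= b ->
     a ^+ k <= f0 x -> b ^+ k <= f1 y ->
     ((1 - l) * a + l * b) ^+ k <= f ((1 - l) * x + l * y)) ->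
  forall x y, 0 <= x -> 0 <= y ->
    ((x ^+ k.+1)%:E <= \int[mu]_t (f0 t)%:E)%E ->
    ((y ^+ k.+1)%:E <= \int[mu]_t (f1 t)%:E)%E ->
    ((((1 - l) * x + l * y) ^+ k.+1)%:E <= \int[mu]_t (f t)%:E)%E.
Proof.
move=> l01 A00 A10 A0r A1r f0M f1M f0A f1A mf0 mf1 c0 c1 k0 k1 fge0 mf H x y x0 y0.
have [a [J [G [[a0 J0] [mG G0] GJ Ja HG]]]] := level_profile A00 A0r f0M f0A mf0 c0 k0.
have [b [K [F [[b0 K0] [mF F0] FK Kb HF]]]] := level_profile A10 A1r f1M f1A mf1 c1 k1.
move=> /(Ja _ x0) hx /(Kb _ y0) hy.
have := perspective_convex l01 x0 y0 a0 b0 J0 K0 hx hy.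
set U := (1 - l) * a + l * b; set W := (1 - l) * J + l * K => h.
have f00 : (0 <= \int[mu]_t (f t)%:E)%E by apply: integral_ge0 => t _; rewrite lee_fin.
have /andP[l0 l1] := l01; have l1' : 0 < 1 - l by rewrite subr_gt0.
have U0 : 0 <= U by rewrite addr_ge0// mulr_ge0// ltW.
have [Uk0|Ukn0] := eqVneq (U ^+ k) 0.
  by apply: le_trans f00; rewrite lee_fin (le_trans h)// Uk0 mul0r.
have {Ukn0}Uk : 0 < U ^+ k by rewrite lt_neqAle eq_sym Ukn0 exprn_ge0.
have key t : 0 < t < 1 ->
    ((1 - l)%:E * G t + l%:E * F t <= mu [set z | (U ^+ k * t <= f z)%R])%E.
  move=> t01; have /andP[t0 t1] := t01.
  have [S [cS sS iS GS HS]] := HG _ t01; have [S' [cS' sS' iS' FS' HS']] := HF _ t01.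
  apply: (@le_trans _ _ ((1 - l)%:E * mu S + l%:E * mu S')%E).
    by apply: leeD; (apply: lee_wpmul2l; last by []); rewrite lee_fin ltW.
  apply: brunn_minkowski_interval => //.
    by rewrite -[X in measurable X]setTI; apply: measurable_fun_ler => //; exact: measurable_cst.
  move=> u v /HS[Au hu] /HS'[Av hv] /=.
  case: k k0 k1 H hu hv {Uk Ja Kb HG HF HS HS' hx hy h} => [|k] k0 k1 H hu hv.
    have := H u v 1 1 Au Av ler01 ler01; rewrite !expr0 k0// k1// => /(_ (lexx _) (lexx _)).
    by apply: le_trans; rewrite mul1r ltW.
  (* The root of t distributes the factor t over both test numbers: a^(k+1) t = (a s)^(k+1), and
     likewise for b. *)
  pose s := t `^ (k.+1%:R^-1).
  have s0 : 0 <= s by exact: powR_ge0.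
  have st : s ^+ k.+1 = t.
    by rewrite -powR_mulrn// -powRrM mulVf ?powRr1// ?pnatr_eq0// ltW.
  have -> : U ^+ k.+1 * t = ((1 - l) * (a * s) + l * (b * s)) ^+ k.+1.
    by rewrite -st -exprMn; congr (_ ^+ _); rewrite /U; ring.
  by apply: H => //; rewrite ?mulr_ge0// exprMn st.
have := level_integral_le Uk fge0 mf.
have : ((W)%:E <= \int[mu]_(t in `]0%R, 1%R[) mu [set z | (U ^+ k * t <= f z)%R])%E.
  apply: (@le_trans _ _ (\int[mu]_(t in `]0%R, 1%R[) ((1 - l)%:E * G t + l%:E * F t))%E).
    rewrite ge0_integralD//; last 4 first.
    - by move=> t _; rewrite mule_ge0// lee_fin ltW.
    - by apply: emeasurable_funM; [exact: measurable_cst|exact: measurable_funTS].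
    - by move=> t _; rewrite mule_ge0// lee_fin ltW.
    - by apply: emeasurable_funM; [exact: measurable_cst|exact: measurable_funTS].
    rewrite !ge0_integralZl//; last 4 first.
    - exact: measurable_funTS.
    - by rewrite lee_fin ltW.
    - exact: measurable_funTS.
    - by rewrite lee_fin ltW.
    by rewrite GJ FK.
  apply: ge0_le_integral => //.
  - by move=> t _; rewrite adde_ge0// mule_ge0// lee_fin ltW.
  - by apply: emeasurable_funD; apply: emeasurable_funM;
      by [exact: measurable_cst|exact: measurable_funTS].
  - apply: measurable_funTS.
    have VE t : (\int[mu]_(x in [set x | (t < (U ^+ k)^-1 * f x ?<= if true)%R]) 1 =
        mu [set x | (U ^+ k * t <= f x)%R])%E.
      rewrite (_ : [set x | _] = [set x | U ^+ k * t <= f x]).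
        rewrite integral_cst ?mul1e// -[X in measurable X]setTI.
        by apply: measurable_fun_ler => //; exact: measurable_cst.
      by apply/seteqP; split=> z /=; rewrite ler_pdivlMl.
    rewrite -(funext VE); apply: measurable_fun_level => //.
    by apply: measurable_funM => //; exact: measurable_cst.
move=> /le_trans /[apply]; rewrite -(@lee_pmul2l _ (U ^+ k)%:E)//.
rewrite muleA -[X in (_ <= X * _)%E]EFinM mulfV ?gt_eqF// mul1e -EFinM => hW.
by apply: le_trans hW; rewrite lee_fin.
Qed.

End brascamp_lieb_1d.

Section integral_lebesgue_rV.
Context {R : realType}.
Local Open Scope ereal_scope.

Lemma integral_rVS n (f : 'rV[R]_n.+1 -> \bar R) :
  measurable_fun setT f -> (forall v, 0 <= f v) ->
  \int[@lebesgue_rV R _]_v f v =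
  \int[lebesgue_measure]_t \int[@lebesgue_rV R _]_v f (rV_cons (t, v)).
Proof.
move=> mf f0.
have mc : measurable_fun setT (f \o @rV_cons R n).
  by apply: measurableT_comp => //; exact: measurable_rV_cons.
transitivity (\int[pushforward (@lebesgue_measure R \x @lebesgue_rV R n)
   (@rV_cons R n)]_v f v); first by [].
rewrite ge0_integral_pushforward//; last exact: measurable_rV_cons.
by rewrite preimage_setT fubini_tonelli1//= => p; exact: f0.
Qed.

Lemma integral_rV0 (f : 'rV[R]_0 -> \bar R) :
  measurable_fun setT f -> \int[@lebesgue_rV R _]_v f v = f 0%R.
Proof. by move=> mf; rewrite /lebesgue_rV/= integral_dirac// diracT mul1e. Qed.

Lemma measurable_fun_integral_rV n (f : measurableTypeR R * 'rV[R]_n -> \bar R) :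
  measurable_fun setT f -> (forall v, 0 <= f v) ->
  measurable_fun setT (fun t : R => \int[@lebesgue_rV R _]_v f (t, v)).
Proof.
move=> mf f0.
exact: (@measurable_fun_fubini_tonelli_F _ _ _ _ _ (@lebesgue_rV R n)).
Qed.

End integral_lebesgue_rV.

(** * Functions with a concave root and their marginals *)

Section root_concave.
Context {R : realType}.
Notation mu := (@lebesgue_measure R).

(* [f ^ (1 / k)] is concave on [A] and [f] vanishes outside; for [k = 0] this
   is read as [f] being the indicator function of the convex set [A]. *)
Record root_concave (U : lmodType R) (k : nat) (A : set U) (f : U -> \bar R)
    : Prop := RootConcave {
  rc_convex : forall x y l, A x -> A y -> 0 < l < 1 ->
    A ((1 - l) *: x + l *: y) ;
  rc_ge0 : forall x, (0 <= f x)%E ;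
  rc_out : forall x, ~ A x -> f x = 0%E ;
  rc_bounded : exists M : R, forall x, (f x <= M%:E)%E ;
  rc_indic : k = 0%N -> forall x, A x -> f x = 1%E ;
  rc_root : forall x y l a b, A x -> A y -> 0 < l < 1 -> 0 <= a -> 0 <= b ->
    ((a ^+ k)%:E <= f x)%E -> ((b ^+ k)%:E <= f y)%E ->
    ((((1 - l) * a + l * b) ^+ k)%:E <= f ((1 - l) *: x + l *: y)%R)%E }.

(** Testing [rc_root] with one and the same number, the root of the smaller value, gives
    quasi-concavity; for k = 0 the function is constant on A. This makes the level sets of slices
    intervals. *)
Lemma root_concave_quasi (U : lmodType R) k (A : set U) f x y l c :
  root_concave k A f -> A x -> A y -> 0 < l < 1 ->
  (c%:E < f x)%E -> (c%:E < f y)%E -> (c%:E < f ((1 - l) *: x + l *: y)%R)%E.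
Proof.
move=> [cA f0 fA [M fM] f1 fr] Ax Ay l01 cx cy.
have := cA _ _ _ Ax Ay l01; set z := _ + _ => Az.
case: k f1 fr => [|k] f1 fr; first by rewrite f1// -(f1 erefl x Ax).
have [c0|c0] := ltP c 0; first by apply: lt_le_trans (f0 _); rewrite lte_fin.
have ffin w : f w \is a fin_num.
  by rewrite fin_numElt (lt_le_trans _ (f0 _)) ?ltNyr//= (le_lt_trans (fM _)) ?ltry.
pose m := Num.min (fine (f x)) (fine (f y)).
have m0 : 0 <= m by rewrite le_min !fine_ge0.
have cm : c < m by rewrite lt_min -!lte_fin !fineK// cx.
pose a := m `^ (k.+1%:R^-1).
have a0 : 0 <= a by exact: powR_ge0.
have am : a ^+ k.+1 = m by rewrite -powR_mulrn// -powRrM mulVf ?powRr1// pnatr_eq0.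
have := fr x y l a a Ax Ay l01 a0 a0.
rewrite am -[f x]fineK// -[f y]fineK// !lee_fin !ge_min !lexx orbT.
move=> /(_ isT isT); apply: lt_le_trans.
by rewrite -mulrDl subrK mul1r am lte_fin.
Qed.

(** [brascamp_lieb_1d] applied to the slices over x, over y and over their combination. The uniform
    bound on t keeps the marginal bounded, so that the step can be iterated. *)
Lemma root_concave_marginal (U : lmodType R) k (A : set (U * R^o)) f :
  root_concave k A f -> (forall u, measurable_fun setT (fun t : R => f (u, t))) ->
  (exists r : R, forall u (t : R), A (u, t) -> `|t| <= r) ->
  root_concave k.+1 [set u | exists t, A (u, t)]
    (fun u => \int[mu]_t f (u, t))%E.
Proof.
move=> rc mf [r Ar]; have [cA f0 fA [M fM] f1 fr] := rc.
have ffin w : f w \is a fin_num.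
  by rewrite fin_numElt (lt_le_trans _ (f0 _)) ?ltNyr//= (le_lt_trans (fM _)) ?ltry.
pose g u (t : R) := fine (f (u, t)).
have gE u t : (g u t)%:E = f (u, t) by rewrite /g fineK.
have mg u : measurable_fun setT (g u).
  apply/measurable_EFinP; rewrite (_ : _ \o _ = (fun t => f (u, t)))//.
  by apply/funext => t /=; rewrite gE.
have gM u t : 0 <= g u t <= M by rewrite -!lee_fin gE f0 fM.
have slice_cvx u c : cvx_set [set t | A (u, t) /\ c < g u t].
  move=> s t m /= [As cs] [At ct] m01.
  have uE : (1 - m) *: u + m *: u = u by rewrite -scalerDl subrK scale1r.
  have pE : (1 - m) *: ((u, s) : U * R^o) + m *: ((u, t) : U * R^o) =
      (u, (1 - m) * s + m * t).
    by transitivity ((1 - m) *: u + m *: u, (1 - m) * s + m * t); last rewrite uE.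
  split; first by have := cA (u, s) (u, t) m As At m01; rewrite pE.
  have := @root_concave_quasi _ k A f (u, s) (u, t) m c rc As At m01.
  by rewrite pE -!gE !lte_fin => /(_ cs ct).
have M0 : 0 <= M by rewrite -lee_fin (le_trans (f0 0)).
split.
- by move=> x y l [s As] [t At] l01; exists ((1 - l) * s + l * t); exact: (cA (x, s) (y, t)).
- by move=> u; apply: integral_ge0.
- move=> u /forallNP Au; apply: integral0_eq => t _; exact: fA.
(* If A is empty, [r] may be negative; hence its absolute value. *)
- exists (M * (`|r| + `|r|)) => u /=.
  have h : (\int[mu]_t f (u, t) <= \int[mu]_(t in `[(- `|r|)%R, `|r|%R]) (cst M%:E) t)%E.
    rewrite [leRHS]integral_mkcond; apply: ge0_le_integral => //.
    - exact: mf.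
    - by apply/measurable_restrict => //; exact: measurable_cst.
    - move=> t _; rewrite patchE; case: ifPn => [//|].
      rewrite notin_setE /= in_itv/= => h; rewrite fA// => /Ar.
      by move=> /le_trans/(_ (ler_norm r)); rewrite ler_norml.
  apply: le_trans h _. rewrite integral_cst//= lebesgue_measure_itv/= lte_fin.
  case: ifP => _; first by rewrite -EFinB -EFinM opprK.
  by rewrite mule0 lee_fin mulr_ge0// addr_ge0.
- by [].
- move=> x y l a b [s As] [t At] l01 a0 b0.
  have IE u : (\int[mu]_t f (u, t) = \int[mu]_t (g u t)%:E)%E.
    by apply: eq_integral => v _; rewrite gE.
  rewrite !IE.
  apply: (@brascamp_lieb_1d R k l [set t | A (x, t)] [set t | A (y, t)]
    (g x) (g y) (g ((1 - l) *: x + l *: y)) M r l01 _ _ (Ar x) (Ar y) (gM x) (gM y)) => //.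
  - by exists s.
  - by exists t.
  - by move=> u /= ?; rewrite /g fA.
  - by move=> u /= ?; rewrite /g fA.
  - exact: slice_cvx.
  - exact: slice_cvx.
  - by move=> k0 u Au; rewrite /g f1.
  - by move=> k0 u Au; rewrite /g f1.
  - by move=> u; case/andP: (gM ((1 - l) *: x + l *: y) u).
  - move=> u v p q Au Av p0 q0; rewrite -!lee_fin !gE => hp hq.
    exact: (fr (x, u) (y, v)).
Qed.

Lemma root_concave_comp (U W : lmodType R) k (A : set U) f (phi : W -> U) :
  (forall x y l, phi ((1 - l) *: x + l *: y) = (1 - l) *: phi x + l *: phi y) ->
  root_concave k A f -> root_concave k (phi @^-1` A) (f \o phi).
Proof.
move=> phiE [cA f0 fA [M fM] f1 fr]; split => /=.
- by move=> x y l Ax Ay l01; rewrite /preimage/= phiE; exact: cA.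
- by move=> x; exact: f0.
- by move=> x /fA.
- by exists M => x; exact: fM.
- by move=> k0 x; exact: f1.
- by move=> x y l a b Ax Ay l01 a0 b0 ha hb; rewrite phiE; exact: fr.
Qed.

Lemma rV_cons_conv n (s t l : R) (v w : 'rV[R]_n) :
  rV_cons ((1 - l) * s + l * t, (1 - l) *: v + l *: w) =
  (1 - l) *: rV_cons (s, v) + l *: rV_cons (t, w).
Proof.
by apply/rowP => i; rewrite !mxE; case: unliftP => [j|] _ //=; rewrite !mxE.
Qed.

(** Induction on n with the parameter space [U] general: the first coordinate joins the parameters,
    the induction hypothesis integrates out the others, and [root_concave_marginal] removes the
    first one at the end. *)
Lemma root_concave_marginal_rV n (U : lmodType R) k (A : set (U * 'rV[R]_n)) f :
  root_concave k A f -> (forall u, measurable_fun setT (fun v => f (u, v))) ->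
  (exists r : R, forall u v, A (u, v) -> forall i, `|v ord0 i| <= r) ->
  root_concave (k + n) [set u | exists v, A (u, v)]
    (fun u => \int[@lebesgue_rV R _]_v f (u, v))%E.
Proof.
elim: n U k A f => [|n IHn] U k A f rc mf [r Ar].
  rewrite addn0 (_ : [set u | _] = (fun u => (u, 0)) @^-1` A); last first.
    apply/seteqP; split=> u /=; last by exists 0.
    by move=> [v]; rewrite (_ : v = 0)//; apply/rowP => -[].
  rewrite (_ : (fun u => _) = f \o (fun u => (u, 0))).
    apply: root_concave_comp => // x y l.
    transitivity ((1 - l) *: x + l *: y, (1 - l) *: (0 : 'rV[R]_0) + l *: 0) => //.
    by rewrite !scaler0 addr0.
  by apply/funext => u /=; rewrite integral_rV0.
pose phi (w : (U * R^o) * 'rV[R]_n) : U * 'rV[R]_n.+1 :=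
  (w.1.1, rV_cons (w.1.2, w.2)).
have rc1 : root_concave k (phi @^-1` A) (f \o phi).
  apply: root_concave_comp => // -[[u s] v] [[u' s'] v'] l; rewrite /phi /=.
  by congr pair; exact: rV_cons_conv.
have mphi u : measurable_fun setT (fun p => f (u, rV_cons p)).
  by apply: (measurableT_comp (mf u)); exact: measurable_rV_cons.
have rc2 : root_concave (k + n) [set w | exists v, (phi @^-1` A) (w, v)]
    (fun w => \int[@lebesgue_rV R _]_v (f \o phi) (w, v))%E.
  apply: IHn => // [[u t]|].
    apply: (measurableT_comp (mphi u)); exact: pair1_measurable.
  by exists r => -[u t] v /Ar h i; have := h (lift ord0 i); rewrite rV_consS.
have := root_concave_marginal rc2.
rewrite addnS (_ : [set u | exists v, A (u, v)] =
    [set u | exists t, [set w | exists v, (phi @^-1` A) (w, v)] (u, t)]); last first.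
  apply/seteqP; split=> u /=.
    move=> [v Av]; exists (rV_uncons v).1, (rV_uncons v).2.
    rewrite /preimage /phi/= (_ : rV_cons _ = v)//.
    apply/rowP => i; rewrite !mxE; case: unliftP => [j ->|->]//=.
    by rewrite mxE.
  by move=> [t [v Av]]; exists (rV_cons (t, v)).
rewrite (_ : (fun u => \int[@lebesgue_rV R n.+1]_v f (u, v))%E = fun u => (\int[mu]_t
    (fun w => \int[@lebesgue_rV R _]_v (f \o phi) (w, v)) (u, t))%E); last first.
  apply/funext => u; rewrite integral_rVS//.
  by move=> v; exact: (rc_ge0 rc).
apply.
- move=> u; apply: (@measurable_fun_integral_rV R n (fun p => f (u, rV_cons p))) => //.
  by move=> p; exact: (rc_ge0 rc).
- exists r => u t [v /Ar /(_ ord0)]; by rewrite rV_cons0.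
Qed.

End root_concave.

(** * Lebesgue measure on row vectors *)

Section measurable_sets_rV.
Context {R : realType} {n : nat}.
Implicit Types (K : set 'rV[R]_n).

Lemma measurable_box (A : 'I_n -> set (measurableTypeR R)) :
  (forall i, measurable (A i)) ->
  measurable [set v : 'rV[R]_n | forall i, A i (v ord0 i)].
Proof.
move=> mA; rewrite (_ : [set v | _] = \bigcap_i (rV_coord i @^-1` A i)).
  apply: fin_bigcap_measurable => //.
  by move=> i _; rewrite -[_ @^-1` _]setTI; exact: measurable_rV_coord.
by apply/seteqP; split => [v Av i _|v Av i]; [exact: Av|exact: (Av i)].
Qed.

Lemma ball_rVE (c : 'rV[R]_n) e : 0 < e ->
  ball c e = [set v | forall i, ball (c ord0 i) e (v ord0 i)].
Proof.
move=> e0; rewrite /ball/= /mx_ball; apply/seteqP; split=> v /= h.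
  by move=> i; exact: h.2.
by split=> // i j; rewrite (ord1 i); exact: h.
Qed.

Lemma measurable_ball_rV (c : 'rV[R]_n) e : 0 < e -> measurable (ball c e).
Proof.
move=> e0; rewrite ball_rVE//; apply: (@measurable_box (fun i => ball (c ord0 i) e)) => i.
exact: measurable_ball.
Qed.

(** The sigma-algebra is generated by the coordinates, which makes balls of the sup norm measurable
    as boxes. A compact set is a countable intersection of finite unions of such balls of radius 1 /
    (k+1), centred in the set. *)
Lemma compact_measurable_rV K : compact K -> measurable K.
Proof.
move=> cK; have clK : closed K.
  by apply: compact_closed => //; exact: norm_hausdorff.
have cov k : exists D : {fset 'rV[R]_n}, {subset D <= K} /\
    K `<=` \bigcup_(c in [set` D]) ball c (k.+1%:R^-1).
  move: cK; rewrite compact_cover => /(_ _ K (fun c => ball c (k.+1%:R^-1))).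
  case=> [c Kc|v Kv|D DK KD].
  - by apply: ball_open; rewrite invr_gt0.
  - by exists v => //; apply: ballxx; rewrite invr_gt0.
  - by exists D.
have /choice[D DP] := cov.
rewrite (_ : K = \bigcap_k \bigcup_(c in [set` D k]) ball c (k.+1%:R^-1)).
  apply: bigcapT_measurable => k; apply: fin_bigcup_measurable => // c _.
  by apply: measurable_ball_rV; rewrite invr_gt0.
apply/seteqP; split=> [v Kv k _|v Dv]; first exact: (DP k).2.
rewrite (closure_id K).1// => B /nbhs_ballP[e /= e0 eB].
have [k ke] : exists k, (k.+1%:R^-1 : R) < e.
  near \oo => k; exists k; near: k; exact: (near_infty_natSinv_lt (PosNum e0)).
have [c Dc vc] := Dv k I.
exists c; split; first by have /set_mem := (DP k).1 c Dc.
by apply: eB; apply: ball_sym; apply: le_ball vc; exact: ltW.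
Unshelve. all: by end_near. Qed.

End measurable_sets_rV.

Section invariance.
Context {R : realType}.
Notation mu := (@lebesgue_measure R).
Local Open Scope ereal_scope.

(** Invariance is stated for integrals rather than for sets, the form in which it is applied to one
    coordinate inside an iterated integral. *)
Definition mpreserving (phi : R -> R) :=
  measurable_fun setT phi /\ forall f : R -> \bar R, measurable_fun setT f ->
    (forall t, 0 <= f t) -> \int[mu]_t f (phi t) = \int[mu]_t f t.

Lemma mpreserving_shift (a : R) : mpreserving (fun t => t + a)%R.
Proof.
have mphi : measurable_fun setT ((fun t => t + a)%R : measurableTypeR R -> measurableTypeR R).
  by apply: measurable_funD => //; exact: measurable_cst.
split=> // f mf f0.
pose shift : {mfun measurableTypeR R >-> measurableTypeR R} :=
  HB.pack (fun t => t + a)%R (isMeasurableFun.Build _ _ _ _ _ mphi).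
transitivity (\int[pushforward mu shift]_t f t).
  by rewrite ge0_integral_pushforward//=.
apply: eq_measure_integral => A mA _; apply/esym.
apply: (lebesgue_measure_unique (mu := pushforward mu shift)) => //.
move=> _ [[u v]] _ <-; transitivity (mu `](u - a)%R, (v - a)%R]).
  rewrite !lebesgue_measure_itv/= !lte_fin ltrD2r; case: ifP => // _.
  by rewrite -!EFinB; congr EFin; ring.
rewrite /pushforward; congr (mu _).
by apply/seteqP; split=> t /=; rewrite !in_itv/= ltrBlDr lerBrDr.
Qed.

Lemma mpreserving_opp : mpreserving -%R.
Proof.
have mphi : measurable_fun setT (-%R : measurableTypeR R -> measurableTypeR R).
  exact: oppr_measurable.
split=> // f mf f0.
transitivity (\int[pushforward mu (-%R : _ -> measurableTypeR R)]_t f t).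
  by rewrite ge0_integral_pushforward//=.
by apply: eq_measure_integral => A mA _; exact: lebesgue_measureN.
Qed.

Lemma mpreserving_comp phi psi : mpreserving phi -> mpreserving psi ->
  mpreserving (phi \o psi).
Proof.
move=> [mphi iphi] [mpsi ipsi]; split; first exact: measurableT_comp.
move=> f mf f0; rewrite -[RHS]iphi// -[RHS]ipsi//.
exact: measurableT_comp.
Qed.

Lemma integral_rV_mpreserving n (phi : 'I_n -> R -> R) (f : 'rV[R]_n -> \bar R) :
  (forall i, mpreserving (phi i)) -> measurable_fun setT f -> (forall v, 0 <= f v) ->
  \int[@lebesgue_rV R n]_v f (\row_i phi i (v ord0 i))%R = \int[@lebesgue_rV R n]_v f v.
Proof.
have mrow m (psi : 'I_m -> R -> R) : (forall i, mpreserving (psi i)) ->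
    measurable_fun setT (fun v : 'rV[R]_m => \row_i psi i (v ord0 i))%R.
  move=> hpsi; apply: measurable_fun_rVP => i.
  rewrite (_ : _ \o _ = psi i \o rV_coord i).
    by apply: measurableT_comp; [exact: (hpsi i).1|exact: measurable_rV_coord].
  by apply/funext => v /=; rewrite /rV_coord mxE.
elim: n phi f => [|n IHn] phi f hphi mf f0.
  by apply: eq_integral => v _; congr f; apply/rowP => -[].
have mfphi : measurable_fun setT (fun v : 'rV[R]_n.+1 => f (\row_i phi i (v ord0 i))%R).
  exact: (measurableT_comp mf (mrow _ _ hphi)).
rewrite [LHS]integral_rVS// [RHS]integral_rVS//.
pose F t := \int[@lebesgue_rV R n]_v f (rV_cons (t, v)).
have mfc : measurable_fun setT (fun p => f (rV_cons p)).
  by apply: measurableT_comp => //; exact: measurable_rV_cons.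
rewrite -[RHS](hphi ord0).2//; last first.
- by move=> t; apply: integral_ge0.
- exact: (@measurable_fun_integral_rV R n (fun p => f (rV_cons p))).
apply: eq_integral => t _.
rewrite -[RHS](IHn (fun i => phi (lift ord0 i)))//; last first.
  by apply: (measurableT_comp mfc); exact: pair1_measurable.
apply: eq_integral => v _; congr f; apply/rowP => i; rewrite !mxE.
by case: unliftP => [j ->|->]; rewrite ?rV_consS ?rV_cons0//= !mxE ?liftK ?unlift_none.
Qed.

Lemma integral_rV_reflect n (a : 'rV[R]_n) (f : 'rV[R]_n -> \bar R) :
  measurable_fun setT f -> (forall v, 0 <= f v) ->
  \int[@lebesgue_rV R n]_v f (a - v)%R = \int[@lebesgue_rV R n]_v f v.
Proof.
move=> mf f0.
rewrite -[RHS](@integral_rV_mpreserving _ (fun i t => - t + a ord0 i)%R)//.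
  by apply: eq_integral => v _; congr f; apply/rowP => i; rewrite !mxE addrC.
move=> i; exact: (mpreserving_comp (mpreserving_shift (a ord0 i)) mpreserving_opp).
Qed.

Lemma integral_rV_shift n (a : 'rV[R]_n) (f : 'rV[R]_n -> \bar R) :
  measurable_fun setT f -> (forall v, 0 <= f v) ->
  \int[@lebesgue_rV R n]_v f (v + a)%R = \int[@lebesgue_rV R n]_v f v.
Proof.
move=> mf f0.
rewrite -[RHS](@integral_rV_mpreserving _ (fun i t => t + a ord0 i)%R)//.
  by apply: eq_integral => v _; congr f; apply/rowP => i; rewrite !mxE.
move=> i; exact: mpreserving_shift.
Qed.

End invariance.

Section dotv_theory.
Context {R : realType} {n : nat}.
Implicit Types (x y z theta : 'rV[R]_n).

Lemma dotvDr theta x y : dotv theta (x + y) = dotv theta x + dotv theta y.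
Proof.
by rewrite /dotv -big_split/=; apply: eq_bigr => i _; rewrite mxE mulrDr.
Qed.

Lemma dotvZr theta (a : R) x : dotv theta (a *: x) = a * dotv theta x.
Proof. by rewrite -[X in dotv X _]scale1r dotvZ mul1r. Qed.

Lemma dotvNr theta x : dotv theta (- x) = - dotv theta x.
Proof. by rewrite -scaleN1r dotvZr mulN1r. Qed.

Lemma dotvC x y : dotv x y = dotv y x.
Proof. by apply: eq_bigr => i _; rewrite mulrC. Qed.

Lemma measurable_dotv theta : measurable_fun setT (dotv theta).
Proof.
apply: measurable_sum => i; apply: measurable_funM; first exact: measurable_cst.
exact: measurable_rV_coord.
Qed.

Lemma rV_coord_le_norm x i : `|x ord0 i| <= `|x|.
Proof.
rewrite [leRHS]mx_normrE.
exact: (le_bigmax _ (fun ij : 'I_1 * 'I_n => `|x ij.1 ij.2|) (ord0, i)).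
Qed.

Lemma compact_coord_bounded (K : set 'rV[R]_n) : compact K ->
  exists2 r : R, 0 < r & forall x, K x -> forall i, `|x ord0 i| <= r.
Proof.
move=> /compact_bounded[M [Mreal HM]].
exists (Num.max M 0 + 1); first by rewrite ltr_pwDr// le_max lexx orbT.
move=> x Kx i; apply: le_trans (rV_coord_le_norm x i) _.
by apply: HM => //; rewrite ltr_pwDr// le_max lexx.
Qed.

End dotv_theory.

Section null_hyperplane.
Context {R : realType}.
Local Open Scope ereal_scope.

Lemma measurable_hyperplane n (theta : 'rV[R]_n) c :
  measurable [set v | dotv theta v = c].
Proof.
rewrite -[X in measurable X]setTI.
exact: (measurable_dotv theta measurableT (measurable_set1 c)).
Qed.

(** Slicing along the first coordinate: if the rest of [theta] is nonzero, every slice is a null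
    hyperplane one dimension below. *)
Lemma hyperplane_null n (theta : 'rV[R]_n) c : theta != 0%R ->
  lebesgue_rV [set v | dotv theta v = c] = 0.
Proof.
elim: n theta c => [|n IHn] theta c t0.
  by case/eqP: t0; apply/rowP => -[].
pose H := [set v | dotv theta v = c].
have mH : measurable H by exact: measurable_hyperplane.
transitivity (\int[@lebesgue_rV R _]_v (\1_H v)%:E).
  by rewrite integral_indic// setIT.
rewrite integral_rVS//; last by apply/measurable_EFinP; exact: measurable_indic.
pose theta' := (\row_i theta ord0 (lift ord0 i))%R : 'rV[R]_n.
have E t v : H (rV_cons (t, v)) <-> dotv theta' v = (c - theta ord0 ord0 * t)%R.
  rewrite /H/= /dotv big_ord_recl rV_cons0.
  under eq_bigr do rewrite rV_consS.
  under [X in _ <-> X = _]eq_bigr do rewrite mxE.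
  by rewrite /=; split => [<-|->]; ring.
have [t'0|t'0] := eqVneq theta' 0%R; last first.
  apply: integral0_eq => t _.
  rewrite -(IHn theta' (c - theta ord0 ord0 * t)%R)//.
  pose H' := [set v | dotv theta' v = (c - theta ord0 ord0 * t)%R].
  transitivity (\int[@lebesgue_rV R _]_v (\1_H' v)%:E).
    apply: eq_integral => v _; rewrite !indicE.
    suff -> : (rV_cons (t, v) \in H) = (v \in H') by [].
    by apply/idP/idP => /set_mem h; apply/mem_set; move: h => /E.
  rewrite integral_indic ?setIT//; exact: measurable_hyperplane.
have th0 : theta ord0 ord0 != 0%R.
  apply: contra_neq t0 => th0; apply/rowP => i; rewrite mxE.
  have [j ->|->//] := unliftP ord0 i.
  by have /rowP/(_ j) := t'0; rewrite !mxE.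
(* Otherwise the hyperplane lies over the single value [t1] of the first coordinate. The slice there
   may have infinite measure, but one point does not count in the outer integral. *)
pose t1 := (c / theta ord0 ord0)%R.
rewrite -(integral_set1 (fun t : R => \int[@lebesgue_rV R _]_v (\1_H (rV_cons (t, v)))%:E) t1).
rewrite [RHS]integral_mkcond; apply: eq_integral => t _; rewrite patchE.
case: ifPn => //; rewrite notin_setE /= => tt1; apply: integral0_eq => v _.
rewrite indicE memNset// => /E; rewrite t'0 => h; apply: tt1.
have : dotv 0%R v = 0%R :> R by rewrite /dotv big1// => i _; rewrite mxE mul0r.
by rewrite h /t1 => /eqP; rewrite subr_eq0 => /eqP ->; rewrite mulrC mulKf.
Qed.

End null_hyperplane.

(** * The covariogram *)

Section convex_body_volume.
Context {R : realType} {n : nat}.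
Variable K : set 'rV[R]_n.
Hypothesis cbK : convex_body K.

Let mK : measurable K.
Proof. by case: cbK => + _ _; exact: compact_measurable_rV. Qed.

Lemma lebesgue_rV_box_ball (c : 'rV[R]_n) (e : R) : 0 < e ->
  lebesgue_rV (ball c e) = ((e *+ 2) ^+ n)%:E.
Proof.
move=> e0; rewrite ball_rVE// (lebesgue_rV_prod (A := fun i => ball (c ord0 i) e)).
  under eq_bigr do rewrite lebesgue_measure_ball ?ltW//.
  by rewrite prodEFin prodr_const card_ord.
by move=> i; exact: measurable_ball.
Qed.

Lemma convex_body_measure_gt0 : (0 < lebesgue_rV K)%E.
Proof.
case: cbK => _ _ [x /nbhs_ballP[e /= e0 xeK]].
apply: (@lt_le_trans _ _ (lebesgue_rV (ball x e))).
  by rewrite lebesgue_rV_box_ball// lte_fin exprn_gt0// mulrn_wgt0.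
by apply: le_measure => //; rewrite inE//; exact: measurable_ball_rV.
Qed.

Lemma convex_body_measure_lty : (lebesgue_rV K < +oo)%E.
Proof.
case: cbK => /compact_coord_bounded[r r0 Kr] _ _.
apply: (@le_lt_trans _ _ (lebesgue_rV (ball (0 : 'rV[R]_n) (r + 1)))).
  apply: le_measure => //; rewrite ?inE//; first exact: measurable_ball_rV (addr_gt0 r0 ltr01).
  move=> v Kv; rewrite ball_rVE ?addr_gt0// => i.
  by rewrite /ball/= mxE sub0r normrN (le_lt_trans (Kr _ Kv i))// ltrDl.
by rewrite lebesgue_rV_box_ball ?addr_gt0// ltry.
Qed.

Lemma volumeE : (volume K)%:E = lebesgue_rV K.
Proof.
rewrite /volume fineK// ge0_fin_numE; first exact: convex_body_measure_lty.
exact: measure_ge0.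
Qed.

Lemma volume_gt0 : 0 < volume K.
Proof. by rewrite -lte_fin volumeE convex_body_measure_gt0. Qed.

End convex_body_volume.

Section covariogram.
Context {R : realType} {n : nat}.
Variable K : set 'rV[R]_n.
Hypothesis cbK : convex_body K.
Local Open Scope ereal_scope.
Notation lam := (@lebesgue_rV R n).

Let mK : measurable K.
Proof. by case: cbK => + _ _; exact: compact_measurable_rV. Qed.

Let CK : set ('rV[R]_n * 'rV[R]_n) := [set p | K p.2 /\ K (p.2 - p.1)%R].

Lemma measurable_rV_lin (s : R) : measurable_fun setT
  (fun p : 'rV[R]_n * 'rV[R]_n => p.2 + s *: p.1)%R.
Proof.
apply: measurable_fun_rVP => i.
rewrite (_ : _ \o _ = fun p => (rV_coord i p.2 + s * rV_coord i p.1)%R); last first.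
  by apply/funext => p /=; rewrite /rV_coord !mxE.
apply: measurable_funD.
  by apply: (measurableT_comp (measurable_rV_coord i)); exact: measurable_snd.
apply: measurable_funM; first exact: measurable_cst.
by apply: (measurableT_comp (measurable_rV_coord i)); exact: measurable_fst.
Qed.

Let mCK : measurable CK.
Proof.
rewrite (_ : CK = (snd @^-1` K) `&` ((fun p => p.2 + (-1) *: p.1)%R @^-1` K)).
  apply: measurableI; rewrite -[X in measurable X]setTI.
    exact: measurable_snd.
  exact: (measurable_rV_lin (-1)).
by apply/seteqP; split=> p /=; rewrite /CK/= /preimage/= scaleN1r.
Qed.

Let mind : measurable_fun setT (fun p => (\1_CK p)%:E : \bar R).
Proof. by apply/measurable_EFinP; exact: measurable_indic. Qed.

(** The covariogram as a marginal of an indicator in two variables. This yields measurability and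
    total mass by Tonelli's theorem, and later links it to a convex set of triples. *)
Lemma covariogramE z :
  (covariogram K z)%:E = \int[lam]_w (\1_CK (z, w))%:E.
Proof.
have mS : measurable (K `&` translate z K).
  rewrite (_ : _ `&` _ = (pair z) @^-1` CK); last first.
    apply/seteqP; split=> w /=.
      by move=> [Kw [y Ky yw]]; split=> //=; rewrite -yw addrK.
    by move=> [/= Kw Kwz]; split=> //; exists (w - z)%R; rewrite ?subrK.
  rewrite -[X in measurable X]setTI; exact: pair1_measurable.
rewrite /covariogram /volume fineK; last first.
  rewrite ge0_fin_numE ?measure_ge0//.
  apply: le_lt_trans (convex_body_measure_lty cbK).
  by apply: le_measure => //; rewrite inE.
rewrite -[LHS](_ : \int[lam]_w (\1_(K `&` translate z K) w)%:E = _); last first.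
  by rewrite integral_indic// setIT.
apply: eq_integral => w _; rewrite !indicE.
suff -> : (w \in K `&` translate z K) = ((z, w) \in CK) by [].
apply/idP/idP => /set_mem h; apply/mem_set; move: h.
  by move=> [Kw [y Ky yw]]; split=> //=; rewrite -yw addrK.
by move=> [/= Kw Kwz]; split=> //; exists (w - z)%R; rewrite ?subrK.
Qed.

Lemma covariogram_ge0 z : (0 <= covariogram K z)%R.
Proof. by rewrite /covariogram /volume fine_ge0// measure_ge0. Qed.

Lemma measurable_covariogram : measurable_fun setT (covariogram K).
Proof.
apply/measurable_EFinP; rewrite (_ : _ \o _ = fun z => \int[lam]_w (\1_CK (z, w))%:E).
  exact: (@measurable_fun_fubini_tonelli_F _ _ _ _ _ lam (fun p => (\1_CK p)%:E)).
by apply/funext => z /=; rewrite covariogramE.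
Qed.

(** In the other order of integration, for fixed w in K the variable z runs over w - K, a set of the
    same volume as K. Hence [covariogram K] divided by this total mass is the density of x - y for
    x, y independent and uniform in K. *)
Lemma integral_covariogram : \int[lam]_z (covariogram K z)%:E = (volume K ^+ 2)%:E.
Proof.
under eq_integral do rewrite covariogramE.
rewrite (fubini_tonelli (m1 := lam) (m2 := lam) (fun p => (\1_CK p)%:E))//=.
have mi : measurable_fun setT (fun v : 'rV[R]_n => (\1_K v)%:E : \bar R).
  by apply/measurable_EFinP; exact: measurable_indic.
transitivity (\int[lam]_w ((\1_K w)%:E * (volume K)%:E)).
  apply: eq_integral => w _.
  transitivity (\int[lam]_z ((\1_K w)%:E * (\1_K (w - z)%R)%:E)).
    apply: eq_integral => z _; rewrite -EFinM !indicE.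
    have -> : ((z, w) \in CK) = (w \in K) && (w - z \in K)%R.
      by apply/idP/andP => [/set_mem[/= ? ?]|[/set_mem ? /set_mem ?]];
        [split; exact/mem_set|exact/mem_set].
    by case: (w \in K) => /=; rewrite ?mul0r ?mul1r.
  rewrite (@integral_rV_reflect R n w (fun v => (\1_K w)%:E * (\1_K v)%:E))//; last first.
    by apply: emeasurable_funM => //; exact: measurable_cst.
  rewrite ge0_integralZl//.
  by rewrite integral_indic// setIT (volumeE cbK).
rewrite ge0_integralZr//; last by rewrite lee_fin ltW//; exact: (volume_gt0 cbK).
by rewrite integral_indic//= setIT -(volumeE cbK) -EFinM expr2.
Qed.

Lemma covariogramN z : covariogram K (- z)%R = covariogram K z.
Proof.
apply: EFin_inj; rewrite !covariogramE.
rewrite -[RHS](@integral_rV_shift R n z (fun w => (\1_CK (z, w))%:E))//; last first.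
  by apply: (measurableT_comp mind); exact: pair1_measurable.
apply: eq_integral => w _; rewrite !indicE.
suff -> : ((- z, w)%R \in CK) = ((z, w + z)%R \in CK) by [].
apply/idP/idP => /set_mem[/= h1 h2]; apply/mem_set; split=> //=.
- by move: h2; rewrite opprK.
- by rewrite addrK.
- by move: h2; rewrite addrK.
- by rewrite opprK.
Qed.

Lemma covariogram_out z : ~ difference_body K z -> covariogram K z = 0%R.
Proof.
move=> h; rewrite /covariogram (_ : _ `&` _ = set0).
  by rewrite /volume measure0.
by apply/eqP; apply: contrapT => /negP/set0P.
Qed.

(** Evenness of the covariogram. It trades the two-sided condition, which is not convex in (s, z),
    for the convex condition [s < dotv theta z]. *)
Lemma integral_covariogram_half (theta : 'rV[R]_n) s : (0 <= s)%R ->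
  \int[lam]_(z in [set z | (s < `|dotv theta z|)%R]) (covariogram K z)%:E =
  2%:E * \int[lam]_(z in [set z | (s < dotv theta z)%R]) (covariogram K z)%:E.
Proof.
have mgt b : measurable [set z : 'rV[R]_n | (s < b * dotv theta z)%R].
  rewrite -[X in measurable X]setTI; apply: measurable_fun_ltr => //.
  by apply: measurable_funM; [exact: measurable_cst|exact: measurable_dotv].
have mc : measurable_fun setT (fun z => (covariogram K z)%:E : \bar R).
  by apply/measurable_EFinP; exact: measurable_covariogram.
move=> s0.
have := mgt 1%R; rewrite (_ : [set z | _] = [set z | (s < dotv theta z)%R]); last first.
  by apply/seteqP; split=> z /=; rewrite mul1r.
have := mgt (-1)%R; rewrite (_ : [set z | _] = [set z | (s < - dotv theta z)%R]); last first.
  by apply/seteqP; split=> z /=; rewrite mulN1r.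
move=> mm mp.
rewrite (_ : [set z | _] = [set z | (s < dotv theta z)%R] `|` [set z | (s < - dotv theta z)%R]); last first.
  apply/seteqP; split=> z /=; first by rewrite lter_normr => /orP[]; [left|right].
  by rewrite lter_normr => -[->|->]; rewrite ?orbT.
rewrite ge0_integral_setU//; last 3 first.
- exact: measurable_funTS.
- by move=> z _; rewrite lee_fin covariogram_ge0.
- apply/disj_setPS => z /= [h1 h2].
  by move: h2; rewrite ltNge => /negP; apply; lra.
have -> : \int[lam]_(z in [set z | (s < - dotv theta z)%R]) (covariogram K z)%:E =
    \int[lam]_(z in [set z | (s < dotv theta z)%R]) (covariogram K z)%:E.
  rewrite [LHS]integral_mkcond [RHS]integral_mkcond.
  rewrite -[RHS](@integral_rV_reflect R n 0%R)//; last 2 first.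
  - exact/measurable_restrict/measurable_funTS.
  - by move=> z; apply: erestrict_ge0 => ? _; rewrite lee_fin covariogram_ge0.
  apply: eq_integral => z _; rewrite sub0r !patchE covariogramN.
  suff -> : (z \in [set z | (s < - dotv theta z)%R]) = (- z \in [set z | (s < dotv theta z)%R])%R by [].
  by apply/idP/idP; rewrite !inE /= dotvNr.
by rewrite -[X in X + _]mul1e -[X in _ + X]mul1e -ge0_muleDl.
Qed.

End covariogram.

(** * Stochastic dominance *)

Section stochastic_dominance.
Context d1 d2 (T1 : measurableType d1) (T2 : measurableType d2) (R : realType).
Variables (mu1 : {sigma_finite_measure set T1 -> \bar R})
          (mu2 : {sigma_finite_measure set T2 -> \bar R}).
Variables (X : T1 -> R) (Y : T2 -> R) (D : T1 -> R) (E : T2 -> R) (V : R -> R).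
Hypotheses (mX : measurable_fun setT X) (mY : measurable_fun setT Y).
Hypotheses (mD : measurable_fun setT D) (mE : measurable_fun setT E).
Hypotheses (D0 : forall x, 0 <= D x) (E0 : forall y, 0 <= E y).
Hypotheses (X0 : forall x, 0 <= X x).
Hypotheses (mV : measurable_fun setT V) (V0 : forall s, 0 <= V s).
Variable s0 : R.
Hypothesis Vs0 : forall t, 0 < t ->
  exists2 e, 0 < e & forall s, `|s - s0| < e -> V s < t.

Let mlvl1 (P : R -> bool) : measurable_fun setT P ->
  measurable [set x | P (X x)].
Proof.
move=> mP; rewrite (_ : [set x | _] = (P \o X) @^-1` [set true]).
  rewrite -[X in measurable X]setTI; exact: (measurableT_comp mP mX).
by apply/seteqP; split.
Qed.

Let mlvl2 (P : R -> bool) : measurable_fun setT P ->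
  measurable [set x | P (Y x)].
Proof.
move=> mP; rewrite (_ : [set x | _] = (P \o Y) @^-1` [set true]).
  rewrite -[X in measurable X]setTI; exact: (measurableT_comp mP mY).
by apply/seteqP; split.
Qed.

Let levels : (forall t, 0 < t ->
    (\int[mu1]_(x in [set x | (t <= V (X x))%R]) (D x)%:E <=
     \int[mu2]_(y in [set y | (t <= V (Y y))%R]) (E y)%:E)%E) ->
  (\int[mu1]_x ((V (X x))%:E * (D x)%:E) <=
   \int[mu2]_y ((V (Y y))%:E * (E y)%:E))%E.
Proof.
move=> H.
have mVX : measurable_fun setT (V \o X) by exact: measurableT_comp.
have mVY : measurable_fun setT (V \o Y) by exact: measurableT_comp.
have mD' : measurable_fun setT (fun x => (D x)%:E : \bar R) by exact/measurable_EFinP.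
have mE' : measurable_fun setT (fun x => (E x)%:E : \bar R) by exact/measurable_EFinP.
have D0' x : (0 <= (D x)%:E)%E by rewrite lee_fin.
have E0' x : (0 <= (E x)%:E)%E by rewrite lee_fin.
rewrite (layer_cake mu1 true mVX mD' D0' (fun x => V0 (X x))).
rewrite (layer_cake mu2 true mVY mE' E0' (fun y => V0 (Y y))).
apply: ge0_le_integral => //.
- by move=> t _; apply: integral_ge0.
- by apply: measurable_funTS; exact: measurable_fun_level.
- by apply: measurable_funTS; exact: measurable_fun_level.
- by move=> t; rewrite /= in_itv/= andbT => /H.
Qed.

(** A level set of V is an initial interval with some right end a. It is enlarged to X <= a on one
    side and shrunk to 0 < Y < a on the other, so it does not matter whether a belongs to it or what
    V is at 0. [Vs0] keeps a strictly below s0. *)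
Lemma dominance_dec :
  (forall s, s0 <= s -> V s = 0) ->
  (forall s t, 0 < s -> s <= t -> V t <= V s) -> 0 < s0 ->
  (forall a, 0 <= a < s0 ->
    (\int[mu1]_(x in [set x | (X x <= a)%R]) (D x)%:E <=
     \int[mu2]_(y in [set y | (0 < Y y < a)%R]) (E y)%:E)%E) ->
  (\int[mu1]_x ((V (X x))%:E * (D x)%:E) <=
   \int[mu2]_y ((V (Y y))%:E * (E y)%:E))%E.
Proof.
move=> Vout Vdec s00 H; apply: levels => t t0.
(* The value of V at 0 is unconstrained, so 0 is added by hand; this also makes F nonempty. *)
pose F := [set s | s = 0 \/ 0 < s /\ t <= V s].
have [e e0 He] := Vs0 t0.
have Fub s : F s -> s <= Num.max 0 (s0 - e).
  rewrite le_max => -[->|[sp ts]]; first by rewrite lexx.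
  apply/orP; right; rewrite leNgt; apply/negP => h.
  have [hs|hs] := leP s0 s; first by move: ts; rewrite Vout// leNgt t0.
  have : V s < t by apply: He; rewrite ltr_norml; apply/andP; split; lra.
  by rewrite ltNge ts.
have hF : has_sup F.
  by split; [exists 0; left|exists (Num.max 0 (s0 - e)) => s /Fub].
pose a := sup F.
have a0 : 0 <= a by apply: sup_upper_bound => //; left.
have as0 : a < s0.
  apply: (@le_lt_trans _ _ (Num.max 0 (s0 - e))).
    by apply: ge_sup => [|s /Fub//]; exists 0; left.
  by rewrite gt_max s00 ltrBlDr ltrDl.
apply: (@le_trans _ _ (\int[mu1]_(x in [set x | (X x <= a)%R]) (D x)%:E)%E).
  apply: ge0_subset_integral => //.
  - by apply: (mlvl1 (P := fun s => t <= V s)); apply: measurable_fun_ler => //; exact: measurable_cst.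
  - by apply: (mlvl1 (P := fun s => s <= a)); apply: measurable_fun_ler => //; exact: measurable_cst.
  - by apply: measurable_funTS; exact/measurable_EFinP.
  - by move=> x _; rewrite lee_fin.
  - move=> x /= tVX; apply: sup_upper_bound => //.
    have := X0 x; rewrite le_eqVlt => /predU1P[<-|Xp]; first by left.
    by right.
apply: le_trans (H a _) _; first by rewrite a0.
apply: ge0_subset_integral => //.
- apply: (mlvl2 (P := fun s => 0 < s < a)); apply: measurable_and.
    by apply: measurable_fun_ltr => //; exact: measurable_cst.
  by apply: measurable_fun_ltr => //; exact: measurable_cst.
- by apply: (mlvl2 (P := fun s => t <= V s)); apply: measurable_fun_ler => //; exact: measurable_cst.
- by apply: measurable_funTS; exact/measurable_EFinP.
- by move=> x _; rewrite lee_fin.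
- move=> y /= /andP[y0 ya].
  have ea : 0 < a - Y y by rewrite subr_gt0.
  have [s Fs] := sup_adherent ea hF; rewrite -/a opprB addrCA subrr addr0 => ys.
  case: Fs => [s0'|[sp ts]]; first by move: ys; rewrite s0' ltNge (ltW y0).
  by apply: le_trans ts _; apply: Vdec => //; exact: ltW.
Qed.

(** The counterpart of [dominance_dec] beyond s0, where level sets are upper rays; [Vs0] keeps their
    left end b strictly above s0. *)
Lemma dominance_inc :
  (forall s, s <= s0 -> V s = 0) ->
  (forall s t, s0 < s -> s <= t -> V s <= V t) ->
  (forall b, s0 < b ->
    (\int[mu1]_(x in [set x | (b <= X x)%R]) (D x)%:E <=
     \int[mu2]_(y in [set y | (b < Y y)%R]) (E y)%:E)%E) ->
  (\int[mu1]_x ((V (X x))%:E * (D x)%:E) <=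
   \int[mu2]_y ((V (Y y))%:E * (E y)%:E))%E.
Proof.
move=> Vout Vinc H; apply: levels => t t0.
pose F := [set s | t <= V s].
(* High levels can be empty when V is bounded. *)
have [F0|/set0P F0] := eqVneq F set0.
  rewrite (_ : [set x | (t <= V (X x))] = set0).
    by rewrite integral_set0; apply: integral_ge0 => y _; rewrite lee_fin.
  by apply/seteqP; split => x //= tV; have : F (X x) by []; rewrite F0.
have [e e0 He] := Vs0 t0.
have Flb s : F s -> s0 + e <= s.
  move=> ts; rewrite leNgt; apply/negP => h.
  have [hs|hs] := leP s s0; first by move: ts; rewrite /F/= Vout// leNgt t0.
  have : V s < t by apply: He; rewrite ltr_norml; apply/andP; split; lra.
  by rewrite ltNge => /negP; apply.
have hF : has_inf F by split => //; exists (s0 + e) => s /Flb.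
pose b := inf F.
have bs0 : s0 < b.
  by apply: (@lt_le_trans _ _ (s0 + e)); [rewrite ltrDl|apply: lb_le_inf].
apply: (@le_trans _ _ (\int[mu1]_(x in [set x | (b <= X x)%R]) (D x)%:E)%E).
  apply: ge0_subset_integral => //.
  - by apply: (mlvl1 (P := fun s => t <= V s)); apply: measurable_fun_ler => //; exact: measurable_cst.
  - by apply: (mlvl1 (P := fun s => b <= s)); apply: measurable_fun_ler => //; exact: measurable_cst.
  - by apply: measurable_funTS; exact/measurable_EFinP.
  - by move=> x _; rewrite lee_fin.
  - by move=> x /= tVX; apply: inf_lbound; [case: hF|].
apply: le_trans (H b bs0) _; apply: ge0_subset_integral => //.
- by apply: (mlvl2 (P := fun s => b < s)); apply: measurable_fun_ltr => //; exact: measurable_cst.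
- by apply: (mlvl2 (P := fun s => t <= V s)); apply: measurable_fun_ler => //; exact: measurable_cst.
- by apply: measurable_funTS; exact/measurable_EFinP.
- by move=> x _; rewrite lee_fin.
- move=> y /= by_.
  have eb : 0 < Y y - b by rewrite subr_gt0.
  have [s Fs] := inf_adherent eb hF; rewrite -/b addrCA subrr addr0 => sy.
  apply: (le_trans (Fs : t <= V s)); apply: Vinc (ltW sy).
  by apply: lt_le_trans (Flb _ Fs); rewrite ltrDl.
Qed.

End stochastic_dominance.

(** * Beta and Gamma integrals *)

Section fundamental_theorem.
Context {R : realType}.
Notation mu := (@lebesgue_measure R).
Implicit Types (F f : R -> R) (a b : R).

Lemma FTC_segment F f a b : a < b ->
  (forall x, a <= x <= b -> is_derive x (1 : R) F (f x)) ->
  (forall x, a <= x <= b -> {for x, continuous f}) ->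
  (\int[mu]_(x in `[a, b]) (f x)%:E = (F b - F a)%:E)%E.
Proof.
move=> ab dF cf; rewrite EFinB; apply: continuous_FTC2 => //.
- by apply: continuous_in_subspaceT => x; rewrite inE /= in_itv/=; exact: cf.
- have cF x : a <= x <= b -> {for x, continuous F}.
    move=> /dF[dFx _]; apply: differentiable_continuous.
    exact/derivable1_diffP.
  split.
  + by move=> x; rewrite in_itv/= => /andP[/ltW ax /ltW xb]; case: (dF x); rewrite ?ax.
  + by apply: cvg_at_right_filter; apply: cF; rewrite lexx ltW.
  + by apply: cvg_at_left_filter; apply: cF; rewrite lexx ltW.
- move=> x; rewrite in_itv/= => /andP[/ltW ax /ltW xb]; rewrite derive1E.
  by apply: derive_val; apply: dF; rewrite ax.
Qed.

(** Meant for integrands that are unbounded at a, such as ln u or a negative power: segments exhaust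
    ]a, b], and since f >= 0 monotone convergence applies. *)
Lemma FTC_at_right F f a b (l : R) : a < b ->
  (forall x, a < x <= b -> is_derive x (1 : R) F (f x)) ->
  (forall x, a < x <= b -> {for x, continuous f}) ->
  (forall x, a < x <= b -> 0 <= f x) ->
  F x @[x --> a^'+] --> l ->
  (\int[mu]_(x in `]a, b]) (f x)%:E = (F b - l)%:E)%E.
Proof.
move=> ab dF cf f0 Fl.
(* Dividing by i + 2 keeps c i strictly below b already for i = 0. *)
pose c (i : nat) := a + (b - a) / i.+2%:R.
have ba : 0 < b - a by rewrite subr_gt0.
have ca i : a < c i by rewrite ltrDl divr_gt0.
have cb i : c i < b.
  by rewrite -ltrBrDl ltr_pdivrMr// ltr_pMr// ltr1n.
pose I (i : nat) : set R := `[c i, b]%classic.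
have cI : \bigcup_i I i = `]a, b]%classic.
  apply/seteqP; split=> x.
    by move=> [i _]; rewrite /I/= !in_itv/= => /andP[/(lt_le_trans (ca i)) -> ->].
  rewrite /= in_itv/= => /andP[ax xb].
  have xa0 : 0 < (x - a) / (b - a) by rewrite divr_gt0// subr_gt0.
  near \oo => k; exists k => //; rewrite /I/= in_itv/= xb andbT /c -lerBrDl.
  rewrite mulrC -ler_pdivlMr//; apply: ltW; apply: (@le_lt_trans _ _ k.+1%:R^-1).
    by rewrite lef_pV2 ?posrE// ler_nat.
  by near: k; exact: (near_infty_natSinv_lt (PosNum xa0)).
have ndI : nondecreasing_seq I.
  move=> i j ij; apply/subsetPset => x; rewrite /I/= !in_itv/= => /andP[cx ->].
  rewrite andbT; apply: le_trans cx; rewrite lerD2l ler_pM2l// lef_pV2 ?posrE//.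
  by rewrite ler_nat !ltnS.
have mf i : measurable_fun (I i) (fun x => (f x)%:E).
  have cfw : {within I i, continuous f}.
    apply: continuous_in_subspaceT => x; rewrite inE /I /= in_itv/= => /andP[cx xb].
    by apply: cf; rewrite xb (lt_le_trans (ca i)).
  apply/measurable_EFinP; apply: subspace_continuous_measurable_fun => //.
  exact: measurable_itv.
have II i : (\int[mu]_(x in I i) (f x)%:E = (F b - F (c i))%:E)%E.
  by apply: FTC_segment => // x /andP[cx xb]; [apply: dF|apply: cf];
    rewrite xb (lt_le_trans (ca i)).
have : (\int[mu]_(x in I i) (f x)%:E)%E @[i --> \oo] -->
    (\int[mu]_(x in \bigcup_i I i) (f x)%:E)%E.
  apply: ge0_nondecreasing_set_cvg_integral => //.
    by move=> i; exact: measurable_itv.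
  move=> i x; rewrite /I/= in_itv/= => /andP[cx xb].
  by rewrite lee_fin f0// xb (lt_le_trans (ca i)).
rewrite cI; under eq_fun do rewrite II.
move=> h; apply: (cvg_unique _ h) => //.
apply: cvg_EFin; first by near=> i.
apply: cvgB; first exact: cvg_cst.
have c_a : c i @[i --> \oo] --> a.
  rewrite -[X in _ --> X]addr0; apply: cvgD; first exact: cvg_cst.
  rewrite -[X in _ --> X](mulr0 (b - a)); apply: cvgM; first exact: cvg_cst.
  have := @cvg_harmonic R; rewrite -(cvg_shiftS (@harmonic R)).
  exact.
apply: (@cvg_comp _ _ _ c F _ (a^'+)) => //.
move=> A /= [e /= e0 eA].
have /cvgrPdist_lt/(_ _ e0) := c_a; apply: filterS => i ie; exact: eA.
Unshelve. all: by end_near. Qed.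

Lemma is_derive_continuous F (x df : R) :
  is_derive x (1 : R) F df -> {for x, continuous F}.
Proof.
by move=> [dFx _]; apply: differentiable_continuous; exact/derivable1_diffP.
Qed.

Lemma continuous_powR (p x : R) : 0 < x -> {for x, continuous (fun y => y `^ p)}.
Proof. by move=> x0; exact: (is_derive_continuous (is_derive1_powR p x0)). Qed.

Lemma integral_powR (p b : R) : 0 < p -> 0 < b ->
  (\int[mu]_(x in `]0%R, b]) (p * x `^ (p - 1))%:E = (b `^ p)%:E)%E.
Proof.
move=> p0 b0; rewrite -[in RHS](subr0 (b `^ p)).
apply: (@FTC_at_right (fun x => x `^ p)) => //.
- by move=> x /andP[x0 _]; exact: is_derive1_powR.
- move=> x /andP[x0 _]; apply: cvgM; first exact: cvg_cst.
  exact: continuous_powR.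
- by move=> x /andP[x0 _]; rewrite mulr_ge0 ?powR_ge0// ltW.
- exact: powR_cvg0.
Qed.

End fundamental_theorem.

Section beta.
Context {R : realType}.
Notation mu := (@lebesgue_measure R).
Implicit Types (p u : R) (k m : nat).

Lemma is_derive_onemX m u : is_derive u (1 : R) (fun x : R => (1 - x) ^+ m.+1 : R)
  (- (m.+1%:R * (1 - u) ^+ m)).
Proof.
have d1 : is_derive u (1 : R) (fun x : R => 1 - x : R) (- 1).
  by rewrite -[X in is_derive _ _ _ X]add0r; apply: is_deriveB.
rewrite (_ : (fun x => _) = (fun x : R => 1 - x) ^+ m.+1); last first.
  by apply/funext => x; rewrite exprfctE.
have := @is_deriveX _ _ (fun x : R => 1 - x) m.+1 u 1 (- 1) d1.
by move=> h; apply: (is_derive_eq h); rewrite scalerN /GRing.scale/= mulr1.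
Qed.

Lemma continuous_onemX m u : {for u, continuous (fun x : R => (1 - x) ^+ m : R)}.
Proof.
case: m => [|m]; first by rewrite (_ : (fun x => _) = cst 1)//; exact: cvg_cst.
exact: (is_derive_continuous (is_derive_onemX m u)).
Qed.

Lemma integral_onemX m (a b : R) : 0 <= a -> a <= b -> b <= 1 ->
  (\int[mu]_(u in `]a, b]) (m.+1%:R * (1 - u) ^+ m)%:E =
   ((1 - a) ^+ m.+1 - (1 - b) ^+ m.+1)%:E)%E.
Proof.
move=> a0; rewrite le_eqVlt => /predU1P[<-|ab] b1.
  by rewrite subrr set_itvoc0 integral_set0.
rewrite [X in _ = X%:E](_ : _ = - (1 - b) ^+ m.+1 - - (1 - a) ^+ m.+1); last by ring.
apply: (@FTC_at_right R (fun u : R => - (1 - u) ^+ m.+1) _ a b (- (1 - a) ^+ m.+1)) => //.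
- move=> x _; rewrite -[X in is_derive _ _ _ X]opprK; apply: is_deriveN.
  exact: is_derive_onemX.
- by move=> x _; apply: cvgM; [exact: cvg_cst|exact: continuous_onemX].
- move=> x /andP[ax xb]; rewrite mulr_ge0// exprn_ge0// subr_ge0.
  exact: le_trans b1.
- by apply: cvg_at_right_filter; apply: cvgN; exact: continuous_onemX.
Qed.

(** The rising factorial (p + 1) ... (p + k), that is Gamma(p + k + 1) / Gamma(p + 1). *)
Let ffact p k := \prod_(j < k) (p + j.+1%:R).

Let ffact_gt0 p k : -1 < p -> 0 < ffact p k.
Proof.
move=> p1; apply: prodr_gt0 => j _; rewrite -natr1.
by have := ler0n R j; lra.
Qed.

Let ffactSr p k : ffact p k.+1 = ffact p k * (p + k.+1%:R).
Proof. by rewrite /ffact big_ord_recr. Qed.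

Let ffactSl p k : ffact p k.+1 = (p + 1) * ffact (p + 1) k.
Proof.
rewrite /ffact big_ord_recl; congr (_ * _); apply: eq_bigr => j _.
by rewrite /= /bump leq0n add1n -[j.+2%:R]natr1; ring.
Qed.

(** The Beta integral B(p + 1, k + 1). The induction on k, for all p at once, rests on u^p (1-u)^k =
    u^p (1-u)^(k+1) + u^(p+1) (1-u)^k. *)
Lemma beta_integral p k : -1 < p ->
  (\int[mu]_(u in `]0%R, 1%R]) (u `^ p * (1 - u) ^+ k)%:E =
   (k`!%:R / \prod_(j < k.+1) (p + j.+1%:R))%:E)%E.
Proof.
have mpow q : measurable_fun (`]0, 1]%classic : set R) (fun u : R => (u `^ q)).
  by apply: measurable_funTS; exact: measurable_powR.
have mone i : measurable_fun (`]0, 1]%classic : set R) (fun u : R => (1 - u) ^+ i).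
  apply: measurable_funTS; apply: measurable_funX; apply: measurable_funB => //.
have mint q i : measurable_fun (`]0, 1]%classic : set R) (fun u : R => (u `^ q * (1 - u) ^+ i)%:E).
  by apply/measurable_EFinP; exact: measurable_funM.
have ge0 q i (u : R) : (`]0, 1]%classic : set R) u -> (0 <= (u `^ q * (1 - u) ^+ i)%:E)%E.
  rewrite /= in_itv/= => /andP[u0 u1].
  by rewrite lee_fin mulr_ge0 ?powR_ge0// exprn_ge0// subr_ge0.
elim: k p => [|k IHk] p p1.
  have p10 : 0 < p + 1 by rewrite -ltrBlDr sub0r.
  have := integral_powR p10 ltr01; rewrite addrK powR1.
  under eq_integral do rewrite EFinM.
  rewrite ge0_integralZl//; last 3 first.
  - by apply/measurable_EFinP; exact: mpow.
  - by move=> u _; rewrite lee_fin powR_ge0.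
  - by rewrite lee_fin ltW.
  under [in X in _ -> X]eq_integral do rewrite expr0 mulr1.
  case: (\int[mu]_(x in _) _)%E => [r| |].
  - rewrite -EFinM => -[h]; congr EFin; rewrite big_ord1 mul1r.
    by rewrite -[LHS](mulKf (lt0r_neq0 p10)) h mulr1.
  - by rewrite gt0_muley// lte_fin.
  - by rewrite gt0_muleNy// lte_fin.
have p2 : -1 < p + 1 by lra.
have : (\int[mu]_(u in `]0%R, 1%R]) (u `^ p * (1 - u) ^+ k.+1)%:E +
    \int[mu]_(u in `]0%R, 1%R]) (u `^ (p + 1) * (1 - u) ^+ k)%:E =
    \int[mu]_(u in `]0%R, 1%R]) (u `^ p * (1 - u) ^+ k)%:E)%E.
  rewrite -ge0_integralD//; [|exact: ge0|exact: mint|exact: ge0|exact: mint].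
  apply: eq_integral => u; rewrite inE /= in_itv/= => /andP[u0 u1].
  rewrite -EFinD powRD; last by rewrite (gt_eqF u0) implybT.
  rewrite powRr1 ?ltW// exprS.
  by congr EFin; ring.
rewrite (IHk _ p1) (IHk _ p2).
case: (\int[mu]_(x in _) _)%E => [r| |] //.
rewrite -EFinD => -[h]; congr EFin.
rewrite -[LHS](addrK (k`!%:R / \prod_(j < k.+1) (p + 1 + j.+1%:R))) h.
have f1 := ffact_gt0 k.+1 p1; have f2 := ffact_gt0 k.+1 p2.
have p10 : 0 < p + 1 by lra.
have pk : 0 < p + k.+2%:R by rewrite -natr1; have := ler0n R k.+1; lra.
rewrite -/(ffact p k.+1) -/(ffact (p + 1) k.+1) -/(ffact p k.+2).
have e : (p + 1) * ffact (p + 1) k.+1 = ffact p k.+1 * (p + k.+2%:R).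
  by rewrite -ffactSl ffactSr.
rewrite factS natrM (ffactSr p k.+1).
have -> : ffact (p + 1) k.+1 = ffact p k.+1 * (p + k.+2%:R) / (p + 1).
  by rewrite -e mulrC mulKf// gt_eqF.
have k2 : k.+2%:R = k.+1%:R + 1 :> R by rewrite natr1.
move: pk; rewrite k2; set c := k.+1%:R => pk; field.
apply/and3P; split; rewrite gt_eqF//.
by move: pk; rewrite /c -natr1; lra.
Qed.

(** From ln v < v at v = u^(-1/2): for 0 < u < 1, 0 <= - u ln u < 2 u^(1/2). *)
Lemma xlnx_cvg0 : u * ln u @[u --> (0 : R)^'+] --> (0 : R).
Proof.
have h2 : u `^ 2^-1 @[u --> (0 : R)^'+] --> (0 : R) by apply: powR_cvg0; lra.
apply: (@squeeze_cvgr _ _ _ _ (fun u : R => - (2 * u `^ 2^-1)) (fun=> 0)).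
- near=> u; have u0 : 0 < u by near: u; exact: nbhs_right_gt.
  have u1 : u < 1 by near: u; exact: nbhs_right_lt.
  apply/andP; split; last by apply: mulr_ge0_le0; [exact: ltW|apply: ln_le0; exact: ltW].
  have v0 : 0 < u `^ (- 2^-1) by exact: powR_gt0.
  have := ln_sublinear v0; rewrite ln_powR => h.
  have e : u * u `^ (- 2^-1) = u `^ 2^-1.
    rewrite [RHS](_ : _ = u `^ (1 - 2^-1)); last by congr (_ `^ _); lra.
    by rewrite powRD ?(gt_eqF u0) ?implybT// powRr1// ltW.
  have : u * (- 2^-1 * ln u) < u * u `^ (- 2^-1) by rewrite ltr_pM2l.
  by rewrite e; lra.
- rewrite -[X in _ --> X]oppr0; apply: cvgN; rewrite -[X in _ --> X](mulr0 2).
  by apply: cvgM => //; exact: cvg_cst.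
- exact: cvg_cst.
Unshelve. all: by end_near. Qed.

(** The source of the harmonic number in kappa(0): minus the mean of ln u under the density (m+1)
    (1-u)^m. *)
Lemma integral_ln_onemX m :
  (\int[mu]_(u in `]0%R, 1%R]) (- ln u * (m.+1%:R * (1 - u) ^+ m))%:E =
   (\sum_(j < m.+1) j.+1%:R^-1)%:E)%E.
Proof.
(* Integration by parts with (1-u)^(m+1) - 1, normalised to vanish at u = 0 so as to tame ln u
   there. What remains, ((1-u)^(m+1) - 1) / u, is minus a geometric sum and is integrated term by
   term. *)
pose F u : R := ln u * ((1 - u) ^+ m.+1 - 1) - \sum_(j < m.+1) j.+1%:R^-1 * (1 - u) ^+ j.+1.
rewrite [X in _ = X%:E](_ : _ = F 1 - - \sum_(j < m.+1) j.+1%:R^-1); last first.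
  rewrite /F ln1 mul0r opprK.
  rewrite [X in _ = 0 - X + _]big1 ?subr0 ?add0r// => j _.
  by rewrite subrr expr0n mulr0.
apply: (@FTC_at_right R F _ 0 1 (- \sum_(j < m.+1) j.+1%:R^-1)) => //.
- move=> u /andP[u0 _].
  have dS : is_derive u (1 : R) (fun x : R => \sum_(j < m.+1) j.+1%:R^-1 * (1 - x) ^+ j.+1 : R)
      (- \sum_(j < m.+1) (1 - u) ^+ j).
    rewrite (_ : (fun x => _) = \sum_(j < m.+1) (fun x : R => j.+1%:R^-1 * (1 - x) ^+ j.+1)); last first.
      by apply/funext => x; rewrite fct_sumE.
    rewrite -sumrN; apply: is_derive_sum => j.
    have := @is_deriveZ _ _ _ _ (j.+1%:R^-1) u 1 _ (is_derive_onemX j u).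
    by move=> h; apply: (is_derive_eq h); rewrite /GRing.scale/= mulrN mulKf// pnatr_eq0.
  have dL := is_derive1_ln u0.
  have dX : is_derive u (1 : R) (fun x : R => (1 - x) ^+ m.+1 - 1 : R) (- (m.+1%:R * (1 - u) ^+ m)).
    by rewrite -[X in is_derive _ _ _ X]subr0; apply: is_deriveB => //; exact: is_derive_onemX.
  have := is_deriveB (is_deriveM dL dX) dS.
  move=> h; apply: (is_derive_eq h); rewrite /GRing.scale/= subrX1 opprK.
  have -> : 1 - u - 1 = - u by ring.
  by field; rewrite gt_eqF.
- move=> u /andP[u0 _]; apply: cvgM.
    by apply: cvgN; exact: continuous_ln.
  by apply: cvgM; [exact: cvg_cst|exact: continuous_onemX].
- move=> u /andP[u0 u1]; rewrite mulr_ge0//; first by rewrite oppr_ge0 ln_le0.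
  by rewrite mulr_ge0// exprn_ge0// subr_ge0.
- rewrite -[X in _ --> X]sub0r; apply: cvgB.
    have h : (- (u * ln u) * \sum_(i < m.+1) (1 - u) ^+ i) @[u --> (0 : R)^'+] -->
        - 0 * (\sum_(i < m.+1) (1 - 0 : R) ^+ i).
      apply: cvgM; first by apply: cvgN; exact: xlnx_cvg0.
      apply: cvg_at_right_filter; apply: cvg_big => [|j _]; first exact: add_continuous.
      exact: continuous_onemX.
    rewrite oppr0 mul0r in h; apply: cvg_trans h; apply: near_eq_cvg.
    by near=> u; rewrite subrX1; ring.
  rewrite (_ : \sum_(j < m.+1) j.+1%:R^-1 = \sum_(j < m.+1) j.+1%:R^-1 * (1 - 0) ^+ j.+1); last first.
    by apply: eq_bigr => j _; rewrite subr0 expr1n mulr1.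
  apply: cvg_at_right_filter; apply: cvg_big => [|j _]; first exact: add_continuous.
  by apply: cvgM; [exact: cvg_cst|exact: continuous_onemX].
Unshelve. all: by end_near. Qed.

End beta.

Section gamma.
Context {R : realType}.
Notation mu := (@lebesgue_measure R).
Implicit Types (x s t : R).

Let itv0y : set R := `]0, +oo[%classic.

(** Extended-valued, so that the recursion can be obtained from Tonelli's theorem before finiteness
    is known. *)
Let gam x : \bar R := (\int[mu]_(t in itv0y) (t `^ (x - 1) * expR (- t))%:E)%E.

Let mitv0y : measurable (itv0y : set (measurableTypeR R)).
Proof. exact: measurable_itv. Qed.

Let mexpN : measurable_fun setT (fun t : R => expR (- t)).
Proof. by apply: measurableT_comp; [exact: measurable_expR|exact: oppr_measurable]. Qed.

Let mpow p : measurable_fun setT (fun t : R => t `^ p).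
Proof. exact: measurable_powR. Qed.

Let is_derive_expN t : is_derive t (1 : R) (fun u : R => - expR (- u) : R) (expR (- t)).
Proof.
have h := is_deriveN (@is_derive1_comp R expR -%R t _ _ (is_derive_expR _) (is_deriveNid t 1)).
by apply: (is_derive_eq h); rewrite mulrN mulr1 opprK.
Qed.

Lemma integral_expRN s : (\int[mu]_(t in `[s, +oo[) (expR (- t))%:E = (expR (- s))%:E)%E.
Proof.
rewrite (@ge0_continuous_FTC2y R (fun t => expR (- t)) (fun t => - expR (- t)) s 0).
- by rewrite -EFinB sub0r opprK.
- by move=> t _; exact: expR_ge0.
- apply: continuous_subspaceT => t; apply: (@continuous_comp _ _ _ -%R expR).
    exact: opp_continuous.
  exact: continuous_expR.
- rewrite -[X in _ --> X]oppr0; apply: cvgN.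
  exact: cvgr_expR.
- by move=> t _; case: (is_derive_expN t).
- by apply: cvg_at_right_filter; exact: (is_derive_continuous (is_derive_expN s)).
- by move=> t _; rewrite derive1E; exact: derive_val.
Qed.

(** Write t^x as the integral of x s^(x-1) over 0 < s <= t and exchange the order: the integral of
    e^(-t) over t >= s is e^(-s). *)
Let gam_rec x : 0 < x -> gam (x + 1) = (x%:E * gam x)%E.
Proof.
move=> x0; rewrite /gam addrK.
pose A := [set p : measurableTypeR R * measurableTypeR R | (0 < p.2)%R && (p.2 <= p.1)%R].
have mA : measurable A.
  rewrite (_ : A = (fun p : measurableTypeR R * measurableTypeR R =>
      (0 < p.2)%R && (p.2 <= p.1)%R) @^-1` [set true]); last by apply/seteqP; split.
  rewrite -[X in measurable X]setTI; apply: measurable_and => //.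
    by apply: measurable_fun_ltr => //; exact: measurable_cst.
  by apply: measurable_fun_ler.
pose G (p : measurableTypeR R * measurableTypeR R) : \bar R :=
  ((\1_A p)%:E * (x * p.2 `^ (x - 1))%:E * (expR (- p.1))%:E)%E.
have mG : measurable_fun setT G.
  apply: emeasurable_funM; first apply: emeasurable_funM.
  - by apply/measurable_EFinP; exact: measurable_indic.
  - apply/measurable_EFinP; apply: measurable_funM; first exact: measurable_cst.
    by apply: (measurableT_comp (mpow (x - 1))).
  - apply/measurable_EFinP.
    exact: (measurableT_comp mexpN (@measurable_fst _ _ (measurableTypeR R) (measurableTypeR R))).
have G0 p : (0 <= G p)%E.
  by rewrite !mule_ge0 ?lee_fin ?expR_ge0 ?mulr_ge0 ?powR_ge0// ltW.
transitivity (\int[mu]_t \int[mu]_s G (t, s))%E.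
  rewrite [LHS]integral_mkcond; apply: eq_integral => t _; rewrite patchE.
  rewrite /G /=; case: ifPn => [|].
    rewrite inE /itv0y /= in_itv/= andbT => t0.
    rewrite mulrC EFinM -(integral_powR x0 t0) muleC -ge0_integralZr//; last 2 first.
    - apply/measurable_EFinP; apply: measurable_funTS; apply: measurable_funM => //.
    - by move=> s _; rewrite lee_fin mulr_ge0 ?powR_ge0// ltW.
    rewrite [LHS]integral_mkcond; apply: eq_integral => s _; rewrite patchE.
    rewrite indicE; case: ifPn => [|]; rewrite ?inE ?notin_setE /= in_itv/= => h.
      by rewrite mem_set ?mul1e.
    by rewrite memNset ?mul0e.
  rewrite notin_setE /itv0y /= in_itv/= andbT => /negP; rewrite -leNgt => t0.
  rewrite integral0_eq// => s _; rewrite indicE memNset ?mul0e//.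
  by rewrite /A/= => /andP[s0 st]; have := lt_le_trans s0 (le_trans st t0); rewrite ltxx.
rewrite (fubini_tonelli (m1 := mu) (m2 := mu) G)//.
rewrite -ge0_integralZl//; last 3 first.
- apply/measurable_EFinP; apply: measurable_funTS; exact: measurable_funM.
- by move=> s _; rewrite lee_fin mulr_ge0 ?powR_ge0 ?expR_ge0.
- by rewrite lee_fin ltW.
rewrite [RHS]integral_mkcond; apply: eq_integral => s _; rewrite patchE /G /=.
case: ifPn => [|].
  rewrite inE /itv0y /= in_itv/= andbT => s0.
  rewrite -EFinM mulrA EFinM -(integral_expRN s) -ge0_integralZl//; last 2 first.
  - by apply/measurable_EFinP; exact: measurable_funTS.
  - by rewrite lee_fin mulr_ge0 ?powR_ge0// ltW.
  rewrite [RHS]integral_mkcond; apply: eq_integral => t _; rewrite patchE.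
  rewrite indicE; case: ifPn => [|]; rewrite ?inE ?notin_setE /= in_itv/= ?andbT => h.
    by rewrite mem_set ?mul1e// /A/= s0.
  by rewrite memNset ?mul0e// /A/= s0.
rewrite notin_setE /itv0y /= in_itv/= andbT => s0.
rewrite integral0_eq// => t _; rewrite indicE memNset ?mul0e//.
by rewrite /A/= => /andP[].
Qed.

Let gam1 : gam 1 = 1%E.
Proof.
rewrite /gam subrr.
transitivity (\int[mu]_(t in `]0%R, +oo[) (expR (- t))%:E)%E.
  by apply: eq_integral => t _; rewrite powRr0 mul1r.
rewrite integral_itv_obnd_cbnd; last by apply/measurable_EFinP; exact: measurable_funTS.
by rewrite integral_expRN oppr0 expR0.
Qed.

Let gam_nat k : gam k.+1%:R = (k`!%:R)%:E.
Proof.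
elim: k => [|k IHk]; first by rewrite gam1.
by rewrite -natr1 gam_rec ?ltr0n// IHk -EFinM factS natrM.
Qed.

Let gam_ge0 x : (0 <= gam x)%E.
Proof. by apply: integral_ge0 => t _; rewrite lee_fin mulr_ge0 ?powR_ge0 ?expR_ge0. Qed.

(** For t > 0, t^x <= 1 + t^k with a natural k > x, and both terms on the right have known
    integrals. *)
Let gamS_lty x : 0 < x -> (gam (x + 1) < +oo)%E.
Proof.
move=> x0; pose k := (Num.truncn x).+1.
have xk : x < k%:R by exact: truncnS_gt.
apply: (@le_lt_trans _ _ (gam 1 + gam k.+1%:R)%E); last first.
  by rewrite gam1 gam_nat ltry.
rewrite /gam -ge0_integralD//; last 4 first.
- by move=> t _; rewrite lee_fin mulr_ge0 ?powR_ge0 ?expR_ge0.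
- by apply/measurable_EFinP; apply: measurable_funTS; exact: measurable_funM.
- by move=> t _; rewrite lee_fin mulr_ge0 ?powR_ge0 ?expR_ge0.
- by apply/measurable_EFinP; apply: measurable_funTS; exact: measurable_funM.
apply: ge0_le_integral => //.
- by move=> t _; rewrite lee_fin mulr_ge0 ?powR_ge0 ?expR_ge0.
- by apply/measurable_EFinP; apply: measurable_funTS; exact: measurable_funM.
- by apply: measurable_funTS; apply: emeasurable_funD;
    apply/measurable_EFinP; exact: measurable_funM.
- move=> t; rewrite /itv0y/= in_itv/= andbT => t0.
  rewrite -EFinD lee_fin -mulrDl ler_wpM2r ?expR_ge0// addrK subrr powRr0.
  rewrite -natr1 addrK; have [t1|t1] := leP t 1.
    rewrite -[leLHS]addr0 lerD ?powR_ge0//.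
    by rewrite -(powRr0 t) ger_powR ?t0// ltW.
  by rewrite -[leLHS]add0r lerD// ler_powR ?ltW.
Qed.

Let gam_lty x : 0 < x -> (gam x < +oo)%E.
Proof.
move=> x0; have := gamS_lty x0; rewrite gam_rec//.
case: (gam x) (gam_ge0 x) => [r _ _|_|//]; first by rewrite ltry.
by rewrite gt0_muley// lte_fin.
Qed.

Let gam_gt0 x : 0 < x -> (0 < gam x)%E.
Proof.
move=> x0.
have : (0 < x%:E * gam x)%E; last first.
  by rewrite pmule_rgt0// lte_fin.
rewrite /gam -ge0_integralZl//; last 3 first.
- by apply/measurable_EFinP; apply: measurable_funTS; exact: measurable_funM.
- by move=> t _; rewrite lee_fin mulr_ge0 ?powR_ge0 ?expR_ge0.
- by rewrite lee_fin ltW.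
apply: (@lt_le_trans _ _ ((expR (- 1))%:E * (1 `^ x)%:E)%E).
  by rewrite powR1 mule1 lte_fin expR_gt0.
rewrite -(integral_powR x0 ltr01) -ge0_integralZl//; last 2 first.
- apply/measurable_EFinP; apply: measurable_funTS; exact: measurable_funM.
- by move=> s _; rewrite lee_fin mulr_ge0 ?powR_ge0// ltW.
apply: (@le_trans _ _ (\int[mu]_(t in `]0%R, 1%R]) (x%:E * (t `^ (x - 1) * expR (- t))%:E))%E).
  apply: ge0_le_integral => //.
  - by move=> s _; rewrite -EFinM lee_fin !mulr_ge0 ?expR_ge0 ?powR_ge0// ltW.
  - apply: emeasurable_funM; first exact: measurable_cst.
    apply/measurable_EFinP; apply: measurable_funTS; exact: measurable_funM.
  - apply: emeasurable_funM; first exact: measurable_cst.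
    by apply/measurable_EFinP; apply: measurable_funTS; exact: measurable_funM.
  - move=> t; rewrite /= in_itv/= => /andP[t0 t1].
    rewrite -!EFinM lee_fin mulrC -mulrA ler_pM2l// ler_wpM2l ?powR_ge0//.
    by rewrite ler_expR lerN2.
apply: ge0_subset_integral => //.
- apply: emeasurable_funM; first exact: measurable_cst.
  by apply/measurable_EFinP; apply: measurable_funTS; exact: measurable_funM.
- by move=> t _; rewrite -EFinM lee_fin !mulr_ge0 ?powR_ge0 ?expR_ge0// ltW.
- by move=> t; rewrite /itv0y /= !in_itv/= andbT => /andP[].
Qed.

Lemma Gamma_gt0 x : 0 < x -> 0 < Gamma x.
Proof. by move=> x0; apply: fine_gt0; rewrite gam_gt0//= gam_lty. Qed.

Lemma Gamma_rec x : 0 < x -> Gamma (x + 1) = x * Gamma x.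
Proof.
move=> x0; have gf : gam x \is a fin_num by rewrite ge0_fin_numE// gam_lty.
by rewrite -[LHS]/(fine (gam (x + 1))) gam_rec// fineM.
Qed.

Lemma Gamma1 : Gamma (1 : R) = 1.
Proof. by rewrite -[LHS]/(fine (gam 1)) gam1. Qed.

Lemma Gamma_prod (p : R) m : -1 < p ->
  Gamma (m%:R + p + 1) = \prod_(j < m) (p + j.+1%:R) * Gamma (p + 1).
Proof.
move=> p1; elim: m => [|m IHm]; first by rewrite add0r big_ord0 mul1r.
rewrite big_ord_recr/= mulrAC -IHm mulrC.
have -> : p + m.+1%:R = m%:R + p + 1 by rewrite -natr1; ring.
rewrite -Gamma_rec; last by have := ler0n R m; lra.
by congr Gamma; rewrite -natr1; ring.
Qed.

(** Rewrites the quotient of Gamma values as the product that comes out of the Beta integral. *)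
Lemma binom2nE n (p : R) : -1 < p ->
  binom2n n p = \prod_(j < 2 * n) (1 + p / j.+1%:R).
Proof.
move=> p1; rewrite /binom2n Gamma_prod//.
have := @Gamma_prod 0 (2 * n) (ltrN10 _); rewrite addr0 add0r Gamma1 mulr1 => ->.
have G0 : Gamma (p + 1) != 0 by rewrite gt_eqF// Gamma_gt0//; lra.
rewrite invfM mulrACA mulfV// mulr1 -prodf_div; apply: eq_bigr => j _.
by rewrite add0r mulrDl divff ?pnatr_eq0// addrC.
Qed.

Lemma harmonic_numberE m : harmonic_number m = \sum_(j < m) j.+1%:R^-1 :> R.
Proof. by rewrite /harmonic_number big_add1/= big_mkord. Qed.

End gamma.

(** * Comparison with the extremal tails *)

Section potential.
Context {R : realType}.
Implicit Types (p q s t : R).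

(** Normalised to have derivative s^(p - 1) and value 0 at 1 for every p. It is increasing whatever
    the sign of p, so inequalities keep their direction. *)
Definition pot p s : R := if p == 0 then ln s else (s `^ p - 1) / p.

Lemma pot1 p : pot p 1 = 0.
Proof. by rewrite /pot; case: ifP => _; rewrite ?ln1// powR1 subrr mul0r. Qed.

Lemma measurable_pot p : measurable_fun setT (pot p).
Proof.
have [p0|/negbTE p0] := boolP (p == 0).
  by rewrite (_ : pot p = @ln R)//; apply/funext => s; rewrite /pot p0.
rewrite (_ : pot p = (fun s => (s `^ p - 1) / p)); last first.
  by apply/funext => s; rewrite /pot p0.
by apply: measurable_funM => //; apply: measurable_funB => //; exact: measurable_powR.
Qed.

Lemma is_derive_pot p s : 0 < s -> is_derive s (1 : R) (pot p) (s `^ (p - 1)).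
Proof.
move=> s0; have [->|p0] := eqVneq p 0.
  rewrite /pot eqxx sub0r powR_inv1 ?ltW//; exact: is_derive1_ln.
rewrite (_ : pot p = (fun x => p^-1 *: (x `^ p - 1) : R)); last first.
  by apply/funext => x; rewrite /pot (negbTE p0) mulrC.
have h1 : is_derive s (1 : R) (fun x => x `^ p - 1 : R) (p * s `^ (p - 1) - 0).
  by apply: is_deriveB; exact: is_derive1_powR.
have h := @is_deriveZ _ _ _ _ (p^-1) s 1 _ h1.
by apply: (is_derive_eq h); rewrite subr0 /GRing.scale/= mulKf.
Qed.

Lemma continuous_pot p s : 0 < s -> {for s, continuous (pot p)}.
Proof. by move=> s0; exact: (is_derive_continuous (is_derive_pot p s0)). Qed.

(** The derivative x^(p-1) (x^(q-p) - c) changes sign where x^(q-p) = c; hence the factor s0^(q-p)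
    in the crossing argument. With q = p and c = 0 the formula gives the monotonicity of [pot p]. *)
Lemma pot_mvt p q c s t : 0 < s -> s < t -> exists2 x, s < x < t &
  (pot q t - c * pot p t) - (pot q s - c * pot p s) =
    x `^ (p - 1) * (x `^ (q - p) - c) * (t - s).
Proof.
move=> s0 st.
have D (x : R) : 0 < x -> is_derive x (1 : R) (fun y : R => pot q y - c * pot p y : R)
    (x `^ (q - 1) - c * x `^ (p - 1)).
  move=> x0; apply: is_deriveB; first exact: is_derive_pot.
  exact: (@is_deriveZ _ _ _ _ c x 1 _ (is_derive_pot p x0)).
have [x||x xst ->] := @MVT R (fun y => pot q y - c * pot p y)
    (fun x => x `^ (q - 1) - c * x `^ (p - 1)) s t st.
- by rewrite in_itv/= => /andP[sx _]; apply: D; exact: lt_trans sx.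
- apply: continuous_in_subspaceT => x; rewrite inE /= in_itv/= => /andP[sx _].
  exact: (is_derive_continuous (D x (lt_le_trans s0 sx))).
- exists x; first by move: xst; rewrite in_itv.
  have x0 : 0 < x by move: xst; rewrite in_itv/= => /andP[sx _]; exact: lt_trans sx.
  congr (_ * _); rewrite mulrBr -powRD ?(gt_eqF x0) ?implybT// [c * _]mulrC.
  by congr (_ `^ _ - _); ring.
Qed.

Lemma ltr_pot p s t : 0 < s -> s < t -> pot p s < pot p t.
Proof.
move=> s0 st; have [x /andP[sx _]] := pot_mvt p p 0 s0 st.
rewrite !mul0r !subr0 subrr powRr0 mulr1 => h; rewrite -subr_gt0 h.
by rewrite mulr_gt0 ?powR_gt0 ?subr_gt0// (lt_trans s0).
Qed.

Lemma ler_pot p s t : 0 < s -> s <= t -> pot p s <= pot p t.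
Proof. by move=> s0; rewrite le_eqVlt => /predU1P[->//|/(ltr_pot p s0)/ltW]. Qed.

Lemma pot_sub_nondecreasing p q c s t : p < q -> 0 < c -> c <= s -> s <= t ->
  pot q s - c `^ (q - p) * pot p s <= pot q t - c `^ (q - p) * pot p t.
Proof.
move=> pq c0 cs; rewrite le_eqVlt => /predU1P[->//|st].
have s0 := lt_le_trans c0 cs.
have [x /andP[sx _] h] := pot_mvt p q (c `^ (q - p)) s0 st.
rewrite -subr_ge0 h mulr_ge0 ?subr_ge0 ?(ltW st)// mulr_ge0 ?powR_ge0//.
rewrite subr_ge0 ge0_ler_powR ?nnegrE ?subr_ge0 ?(ltW pq) ?(ltW c0)//.
  by rewrite ltW// (lt_trans s0).
exact: le_trans cs (ltW sx).
Qed.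

Lemma pot_sub_nonincreasing p q c s t : p < q -> 0 < s -> s <= t -> t <= c ->
  pot q t - c `^ (q - p) * pot p t <= pot q s - c `^ (q - p) * pot p s.
Proof.
move=> pq s0; rewrite le_eqVlt => /predU1P[->//|st] tc.
have [x /andP[sx xt] h] := pot_mvt p q (c `^ (q - p)) s0 st.
have x0 := lt_trans s0 sx; have xc := ltW (lt_le_trans xt tc).
rewrite -subr_le0 h mulr_le0_ge0 ?subr_ge0 ?(ltW st)// mulr_ge0_le0 ?powR_ge0//.
rewrite subr_le0 ge0_ler_powR ?nnegrE ?subr_ge0 ?(ltW pq) ?(ltW x0)//.
exact: le_trans (ltW x0) xc.
Qed.

End potential.

Section potential_parts.
Context {R : realType}.
Implicit Types (p s t : R).

(** The cut at s <= 0 removes the values of [pot] that are mere conventions. *)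
Definition pot_pos p s : R := if 0 < s then Num.max (pot p s) 0 else 0.
Definition pot_neg p s : R := if 0 < s then Num.max (- pot p s) 0 else 0.

Lemma measurable_if_pos (f : R -> R) (P : R -> bool) :
  measurable_fun setT f -> measurable_fun setT P ->
  measurable_fun setT (fun s => if P s then f s else 0).
Proof.
move=> mf mP; apply: measurable_fun_ifT => //; exact: measurable_cst.
Qed.

Lemma measurable_gt (a : R) : measurable_fun setT (fun s : R => a < s).
Proof. by apply: measurable_fun_ltr => //; exact: measurable_cst. Qed.

Lemma measurable_lt (a : R) : measurable_fun setT (fun s : R => s < a).
Proof. by apply: measurable_fun_ltr => //; exact: measurable_cst. Qed.

Lemma measurable_pot_pos p : measurable_fun setT (pot_pos p).
Proof.
apply: measurable_if_pos; last exact: measurable_gt.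
by apply: measurable_maxr => //; exact: measurable_pot.
Qed.

Lemma measurable_pot_neg p : measurable_fun setT (pot_neg p).
Proof.
apply: measurable_if_pos; last exact: measurable_gt.
apply: measurable_maxr => //; apply: measurable_funN; exact: measurable_pot.
Qed.

Lemma pot_pos_ge0 p s : 0 <= pot_pos p s.
Proof. by rewrite /pot_pos; case: ifP => // _; rewrite le_max lexx orbT. Qed.

Lemma pot_neg_ge0 p s : 0 <= pot_neg p s.
Proof. by rewrite /pot_neg; case: ifP => // _; rewrite le_max lexx orbT. Qed.

Lemma pot_split p s : 0 < s -> pot p s = pot_pos p s - pot_neg p s.
Proof. by move=> s0; rewrite /pot_pos /pot_neg s0 !maxEle; do 2 case: ifP; lra. Qed.

Lemma pot_norm p s : 0 < s -> `|pot p s| = pot_pos p s + pot_neg p s.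
Proof.
move=> s0; rewrite /pot_pos /pot_neg s0 !maxEle.
by have [h|h] := leP 0 (pot p s); rewrite ?(ger0_norm h) ?(ltr0_norm h);
  do 2 case: ifP; lra.
Qed.

Lemma continuous_pot1 p t : 0 < t ->
  exists2 e, 0 < e & forall s, `|s - 1| < e -> 0 < s /\ `|pot p s| < t.
Proof.
move=> t0; have /cvgrPdist_lt/(_ _ t0) := @continuous_pot R p 1 ltr01.
move=> /nbhs_ballP[e /= e0 he]; exists (Num.min e 1); first by rewrite lt_min e0 ltr01.
move=> s; rewrite lt_min => /andP[se s1]; split.
  by move: s1; rewrite ltr_norml; lra.
by have := he s; rewrite /ball/= distrC pot1 sub0r normrN; apply.
Qed.

Lemma pot_pos_near p t : 0 < t ->
  exists2 e, 0 < e & forall s, `|s - 1| < e -> pot_pos p s < t.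
Proof.
move=> t0; have [e e0 he] := continuous_pot1 p t0; exists e => // s /he[s0].
by apply: le_lt_trans; rewrite pot_norm// lerDl pot_neg_ge0.
Qed.

Lemma pot_neg_near p t : 0 < t ->
  exists2 e, 0 < e & forall s, `|s - 1| < e -> pot_neg p s < t.
Proof.
move=> t0; have [e e0 he] := continuous_pot1 p t0; exists e => // s /he[s0].
by apply: le_lt_trans; rewrite pot_norm// lerDr pot_pos_ge0.
Qed.

Lemma pot_ge0 p s : 1 <= s -> 0 <= pot p s.
Proof. by move=> s1; rewrite -(pot1 p) ler_pot. Qed.

Lemma pot_le0 p s : 0 < s -> s <= 1 -> pot p s <= 0.
Proof. by move=> s0 s1; rewrite -(pot1 p) ler_pot. Qed.

End potential_parts.

(** * Integrals of functions of X against a weight D *)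

Section weighted.
Context d (T : measurableType d) (R : realType).
Variables (mu : {sigma_finite_measure set T -> \bar R}) (X D : T -> R).
Hypotheses (mX : measurable_fun setT X) (mD : measurable_fun setT D).
Hypotheses (D0 : forall x, 0 <= D x) (X0 : forall x, 0 <= X x).
Hypothesis DX0 : forall x, X x = 0 -> D x = 0.

Definition wintegrable (f : R -> R) := mu.-integrable setT (EFin \o (fun x => f (X x) * D x)).

Lemma measurable_weighted (f : R -> R) : measurable_fun setT f ->
  measurable_fun setT (fun x => f (X x) * D x).
Proof. by move=> mf; apply: measurable_funM => //; exact: measurableT_comp. Qed.

Lemma wintegrable_ge0 (f : R -> R) : measurable_fun setT f -> (forall s, 0 <= f s) ->
  (\int[mu]_x ((f (X x))%:E * (D x)%:E) < +oo)%E -> wintegrable f.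
Proof.
move=> mf f0 h; apply/integrableP; split.
  by apply/measurable_EFinP; exact: measurable_weighted.
apply: le_lt_trans h; rewrite le_eqVlt; apply/orP; left; apply/eqP.
by apply: eq_integral => x _; rewrite /= ger0_norm ?EFinM// mulr_ge0.
Qed.

(** A comparison at s > 0 suffices because the weight vanishes where X = 0. *)
Lemma wintegrable_le (f g : R -> R) : measurable_fun setT f ->
  (forall s, 0 < s -> `|f s| <= `|g s|) -> wintegrable g -> wintegrable f.
Proof.
move=> mf fg; apply: le_integrable => //.
  by apply/measurable_EFinP; exact: measurable_weighted.
move=> x _ /=; rewrite lee_fin !normrM.
have := X0 x; rewrite le_eqVlt => /predU1P[/esym/DX0 ->|x0].
  by rewrite normr0 !mulr0.
by rewrite ler_wpM2r// fg.
Qed.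

Lemma wintegral_ge0E (f : R -> R) : wintegrable f ->
  (\int[mu]_x ((f (X x))%:E * (D x)%:E))%E = (\int[mu]_x (f (X x) * D x))%:E.
Proof.
move=> h; rewrite /Rintegral fineK//; last exact: integrable_fin_num.
Qed.

Lemma wintegral_eq (f g : R -> R) : (forall s, 0 < s -> f s = g s) ->
  \int[mu]_x (f (X x) * D x) = \int[mu]_x (g (X x) * D x).
Proof.
move=> fg; apply: eq_Rintegral => x _.
have := X0 x; rewrite le_eqVlt => /predU1P[/esym/DX0 ->|x0]; first by rewrite !mulr0.
by rewrite fg.
Qed.

Lemma wintegralB (f g : R -> R) : wintegrable f -> wintegrable g ->
  \int[mu]_x ((f (X x) - g (X x)) * D x) =
  \int[mu]_x (f (X x) * D x) - \int[mu]_x (g (X x) * D x).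
Proof.
move=> hf hg; rewrite -RintegralB//; apply: eq_Rintegral => x _.
by rewrite mulrBl.
Qed.

Lemma wintegralD (f g : R -> R) : wintegrable f -> wintegrable g ->
  \int[mu]_x ((f (X x) + g (X x)) * D x) =
  \int[mu]_x (f (X x) * D x) + \int[mu]_x (g (X x) * D x).
Proof.
move=> hf hg; rewrite -RintegralD//; apply: eq_Rintegral => x _.
by rewrite mulrDl.
Qed.

Lemma wintegralZ c (f : R -> R) : wintegrable f ->
  \int[mu]_x (c * f (X x) * D x) = c * \int[mu]_x (f (X x) * D x).
Proof.
move=> hf; rewrite -RintegralZl//; apply: eq_Rintegral => x _.
by rewrite mulrA.
Qed.

Lemma wintegral_lincomb (f g : R -> R) r w : wintegrable f -> wintegrable g ->
  wintegrable (cst 1) -> let h s := g s - r * f s - w in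
  wintegrable h /\ \int[mu]_x (h (X x) * D x) =
    \int[mu]_x (g (X x) * D x) - r * \int[mu]_x (f (X x) * D x) - w * \int[mu]_x D x.
Proof.
move=> hf hg h1 h.
have hrf : wintegrable (fun s => r * f s).
  rewrite /wintegrable (_ : _ \o _ = (fun x => r%:E * (f (X x) * D x)%:E)%E).
    exact: integrableZl.
  by apply/funext => x /=; rewrite -mulrA EFinM.
have hw : wintegrable (cst w).
  rewrite /wintegrable (_ : _ \o _ = (fun x => w%:E * (cst 1 (X x) * D x)%:E)%E).
    exact: integrableZl.
  by apply/funext => x /=; rewrite mul1r EFinM.
have hB (u v : R -> R) : wintegrable u -> wintegrable v -> wintegrable (fun s => u s - v s).
  move=> hu hv; rewrite /wintegrable (_ : _ \o _ =
      ((EFin \o (fun x => u (X x) * D x)%R) \- (EFin \o (fun x => v (X x) * D x)%R))%E).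
    exact: integrableB.
  by apply/funext => x /=; rewrite mulrBl EFinB.
have hgf := hB _ _ hg hrf.
split; first exact: (hB _ _ hgf hw).
rewrite (wintegralB hgf hw) (wintegralB hg hrf) wintegralZ//; congr (_ - _).
transitivity (\int[mu]_x (w * cst 1 (X x) * D x)).
  by apply: eq_Rintegral => x _; rewrite /= mulr1.
by rewrite wintegralZ//; congr (_ * _); apply: eq_Rintegral => x _; rewrite /= mul1r.
Qed.

Lemma wintegrable_pot_parts p : wintegrable (pot p) ->
  wintegrable (pot_pos p) /\ wintegrable (pot_neg p).
Proof.
move=> h; split; apply: wintegrable_le h => [|s s0].
- exact: measurable_pot_pos.
- by rewrite pot_norm// ger0_norm ?pot_pos_ge0// lerDl pot_neg_ge0.
- exact: measurable_pot_neg.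
- by rewrite pot_norm// ger0_norm ?pot_neg_ge0// lerDr pot_pos_ge0.
Qed.

Lemma wintegrable_pot p : wintegrable (pot_pos p) -> wintegrable (pot_neg p) ->
  wintegrable (pot p).
Proof.
move=> h1 h2.
have : wintegrable (fun s => pot_pos p s + pot_neg p s).
  rewrite /wintegrable (_ : _ \o _ = ((EFin \o (fun x => pot_pos p (X x) * D x)%R) \+
      (EFin \o (fun x => pot_neg p (X x) * D x)%R))%E).
    exact: integrableD.
  by apply/funext => x /=; rewrite mulrDl.
apply: wintegrable_le => [|s s0]; first exact: measurable_pot.
by rewrite [X in _ <= X]ger0_norm ?addr_ge0 ?pot_pos_ge0 ?pot_neg_ge0// pot_norm.
Qed.

Lemma wintegral_pot_split p : wintegrable (pot p) ->
  \int[mu]_x (pot p (X x) * D x) =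
  \int[mu]_x (pot_pos p (X x) * D x) - \int[mu]_x (pot_neg p (X x) * D x).
Proof.
move=> /wintegrable_pot_parts[h1 h2].
rewrite -wintegralB//; apply: (@wintegral_eq _ (fun s => pot_pos p s - pot_neg p s)).
by move=> s; exact: pot_split.
Qed.

End weighted.

Section comparison.
Context d1 d2 (T1 : measurableType d1) (T2 : measurableType d2) (R : realType).
Variables (mu1 : {sigma_finite_measure set T1 -> \bar R})
          (mu2 : {sigma_finite_measure set T2 -> \bar R}).
Variables (X : T1 -> R) (Y : T2 -> R) (D : T1 -> R) (E : T2 -> R).
Hypotheses (mX : measurable_fun setT X) (mY : measurable_fun setT Y).
Hypotheses (mD : measurable_fun setT D) (mE : measurable_fun setT E).
Hypotheses (D0 : forall x, 0 <= D x) (E0 : forall y, 0 <= E y).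
Hypotheses (X0 : forall x, 0 <= X x) (Y0 : forall y, 0 <= Y y).
Hypotheses (DX0 : forall x, X x = 0 -> D x = 0) (EY0 : forall y, Y y = 0 -> E y = 0).

Lemma pot_neg_le p :
  (forall a, 0 <= a < 1 ->
    (\int[mu1]_(x in [set x | (X x <= a)%R]) (D x)%:E <=
     \int[mu2]_(y in [set y | (0 < Y y < a)%R]) (E y)%:E)%E) ->
  (\int[mu1]_x ((pot_neg p (X x))%:E * (D x)%:E) <=
   \int[mu2]_y ((pot_neg p (Y y))%:E * (E y)%:E))%E.
Proof.
move=> H; apply: (@dominance_dec _ _ _ _ _ mu1 mu2 X Y D E (pot_neg p) _ _ _ _ _ _ _ _ _ 1) => //.
- exact: measurable_pot_neg.
- exact: pot_neg_ge0.
- exact: pot_neg_near.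
- by move=> s s1; rewrite /pot_neg (lt_le_trans ltr01 s1) max_r// oppr_le0 pot_ge0.
- move=> s t s0 st; rewrite /pot_neg s0 (lt_le_trans s0 st).
  by rewrite ge_max le_max lerN2 ler_pot//= le_max lexx orbT.
Qed.

Lemma pot_pos_le p :
  (forall b, 1 < b ->
    (\int[mu1]_(x in [set x | (b <= X x)%R]) (D x)%:E <=
     \int[mu2]_(y in [set y | (b < Y y)%R]) (E y)%:E)%E) ->
  (\int[mu1]_x ((pot_pos p (X x))%:E * (D x)%:E) <=
   \int[mu2]_y ((pot_pos p (Y y))%:E * (E y)%:E))%E.
Proof.
move=> H; apply: (@dominance_inc _ _ _ _ _ mu1 mu2 X Y D E (pot_pos p) _ _ _ _ _ _ _ _ 1) => //.
- exact: measurable_pot_pos.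
- exact: pot_pos_ge0.
- exact: pot_pos_near.
- by move=> s s1; rewrite /pot_pos; case: ifP => // s0; rewrite max_r// pot_le0.
- move=> s t s1 st; have s0 := lt_trans ltr01 s1.
  rewrite /pot_pos s0 (lt_le_trans s0 st).
  by rewrite ge_max le_max ler_pot//= le_max lexx orbT.
Qed.

(** W = pot q - r pot p - w decreases up to s0 and increases afterwards, and w makes its minimum 0.
    Its two branches W1 and W2 are nonnegative and are compared separately. The terms r pot p and w
    then cancel, since both laws have the same mean of [pot p] and the same total mass. *)
Lemma pot_crossing p q s0 : p < q -> 0 < s0 ->
  wintegrable mu1 X D (pot p) -> wintegrable mu1 X D (pot q) ->
  wintegrable mu2 Y E (pot p) -> wintegrable mu2 Y E (pot q) ->
  wintegrable mu1 X D (cst 1) -> wintegrable mu2 Y E (cst 1) ->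
  \int[mu1]_x D x = \int[mu2]_y E y ->
  (forall a, 0 <= a < s0 ->
    (\int[mu1]_(x in [set x | (X x <= a)%R]) (D x)%:E <=
     \int[mu2]_(y in [set y | (0 < Y y < a)%R]) (E y)%:E)%E) ->
  (forall b, s0 < b ->
    (\int[mu1]_(x in [set x | (b <= X x)%R]) (D x)%:E <=
     \int[mu2]_(y in [set y | (b < Y y)%R]) (E y)%:E)%E) ->
  \int[mu1]_x (pot p (X x) * D x) = \int[mu2]_y (pot p (Y y) * E y) ->
  \int[mu1]_x (pot q (X x) * D x) <= \int[mu2]_y (pot q (Y y) * E y).
Proof.
move=> pq s00 iXp iXq iYp iYq iX1 iY1 DE Hdec Hinc eqp.
pose r := s0 `^ (q - p).
pose w := pot q s0 - r * pot p s0.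
pose W s := pot q s - r * pot p s - w.
have mW : measurable_fun setT W.
  apply: measurable_funB => //; apply: measurable_funB; first exact: measurable_pot.
  by apply: measurable_funM => //; exact: measurable_pot.
pose W1 s := if 0 < s < s0 then W s else 0.
pose W2 s := if s0 < s then W s else 0.
have mW1 : measurable_fun setT W1.
  apply: (measurable_if_pos (P := fun s => 0 < s < s0)) => //.
  by apply: measurable_and; [exact: measurable_gt|exact: measurable_lt].
have mW2 : measurable_fun setT W2.
  by apply: measurable_if_pos => //; exact: measurable_gt.
have W10 s : 0 <= W1 s.
  rewrite /W1; case: ifP => // /andP[sp ss0]; rewrite subr_ge0.
  exact: pot_sub_nonincreasing (ltW ss0) _.
have W20 s : 0 <= W2 s.
  rewrite /W2; case: ifP => // ss0; rewrite subr_ge0.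
  exact: pot_sub_nondecreasing (ltW ss0).
have W12 s : 0 < s -> W s = W1 s + W2 s.
  move=> sp; rewrite /W1 /W2 sp /=; have [h|h|->] := ltgtP s s0; rewrite ?addr0 ?add0r//.
  by rewrite /W /w subrr.
have Wnear t : 0 < t -> exists2 e, 0 < e & forall s, `|s - s0| < e -> `|W s| < t.
  move=> t0; have cW : {for s0, continuous W}.
    apply: cvgB; last exact: cvg_cst.
    apply: cvgB; first exact: continuous_pot.
    by apply: cvgM; [exact: cvg_cst|exact: continuous_pot].
  have /cvgrPdist_lt/(_ _ t0) := cW.
  move=> /nbhs_ballP[e /= e0 he]; exists e => // s se.
  have := he s; rewrite /ball/= distrC {1}/W /w subrr sub0r normrN; exact.
have nearW (V : R -> R) : (forall s, V s <= `|W s|) ->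
    forall t, 0 < t -> exists2 e, 0 < e & forall s, `|s - s0| < e -> V s < t.
  move=> VW t t0; have [e e0 he] := Wnear t t0; exists e => // s /he.
  exact: le_lt_trans (VW s).
have W1W s : W1 s <= `|W s| by rewrite /W1; case: ifP; rewrite ?normr_ge0 ?ler_norm.
have W2W s : W2 s <= `|W s| by rewrite /W2; case: ifP; rewrite ?normr_ge0 ?ler_norm.
have h1 := @dominance_dec _ _ _ _ _ mu1 mu2 X Y D E W1 mX mY mD mE D0 E0 X0 mW1 W10 s0
  (nearW W1 W1W).
have {}h1 : (\int[mu1]_x ((W1 (X x))%:E * (D x)%:E) <=
   \int[mu2]_y ((W1 (Y y))%:E * (E y)%:E))%E.
  apply: h1 => // [s hs|s t sp st].
    by rewrite /W1 [s < s0]ltNge hs andbF.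
  rewrite /W1 (lt_le_trans sp st) sp /=; have [ts0|ts0] := ltP t s0.
    rewrite (le_lt_trans st ts0) lerD2r; exact: pot_sub_nonincreasing (ltW ts0).
  by case: ifP => // ss0; have := W10 s; rewrite /W1 sp ss0.
have h2 := @dominance_inc _ _ _ _ _ mu1 mu2 X Y D E W2 mX mY mD mE D0 E0 mW2 W20 s0
  (nearW W2 W2W).
have {}h2 : (\int[mu1]_x ((W2 (X x))%:E * (D x)%:E) <=
   \int[mu2]_y ((W2 (Y y))%:E * (E y)%:E))%E.
  apply: h2 => // [s hs|s t sp st].
    by rewrite /W2 ltNge hs.
  rewrite /W2 sp (lt_le_trans sp st) lerD2r; exact: pot_sub_nondecreasing (ltW sp) st.
have [iXW eXW] := wintegral_lincomb r w iXp iXq iX1.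
have [iYW eYW] := wintegral_lincomb r w iYp iYq iY1.
have nW1 s : 0 < s -> `|W1 s| <= `|W s| by rewrite ger0_norm.
have nW2 s : 0 < s -> `|W2 s| <= `|W s| by rewrite ger0_norm.
have iX1W := wintegrable_le mX mD X0 DX0 mW1 nW1 iXW.
have iX2W := wintegrable_le mX mD X0 DX0 mW2 nW2 iXW.
have iY1W := wintegrable_le mY mE Y0 EY0 mW1 nW1 iYW.
have iY2W := wintegrable_le mY mE Y0 EY0 mW2 nW2 iYW.
have : \int[mu1]_x (W (X x) * D x) <= \int[mu2]_y (W (Y y) * E y).
  rewrite (wintegral_eq mu1 X0 DX0 W12) (wintegral_eq mu2 Y0 EY0 W12).
  rewrite (wintegralD iX1W iX2W) (wintegralD iY1W iY2W).
  move: h1 h2; rewrite (wintegral_ge0E iX1W) (wintegral_ge0E iY1W).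
  rewrite (wintegral_ge0E iX2W) (wintegral_ge0E iY2W) !lee_fin.
  exact: lerD.
by rewrite eXW eYW eqp DE !lerD2r.
Qed.

(** Negative parts are compared by [pot_neg_le]. The comparison of positive parts goes in the other
    direction, with the two laws exchanged, and therefore enters as a hypothesis on integrals. *)
Lemma pot_dominance p :
  wintegrable mu1 X D (pot p) -> wintegrable mu2 Y E (pot p) ->
  (forall a, 0 <= a < 1 ->
    (\int[mu1]_(x in [set x | (X x <= a)%R]) (D x)%:E <=
     \int[mu2]_(y in [set y | (0 < Y y < a)%R]) (E y)%:E)%E) ->
  (\int[mu2]_y ((pot_pos p (Y y))%:E * (E y)%:E) <=
   \int[mu1]_x ((pot_pos p (X x))%:E * (D x)%:E))%E ->
  \int[mu2]_y (pot p (Y y) * E y) <= \int[mu1]_x (pot p (X x) * D x).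
Proof.
move=> iX iY Hdec hpos.
have hneg := pot_neg_le p Hdec.
have [iXp iXn] := wintegrable_pot_parts mX mD X0 DX0 iX.
have [iYp iYn] := wintegrable_pot_parts mY mE Y0 EY0 iY.
rewrite (wintegral_pot_split mX mD X0 DX0 iX) (wintegral_pot_split mY mE Y0 EY0 iY).
move: hneg hpos; rewrite (wintegral_ge0E iXp) (wintegral_ge0E iYp).
rewrite (wintegral_ge0E iXn) (wintegral_ge0E iYn) !lee_fin => hneg hpos.
by apply: lerB.
Qed.

End comparison.

(** * The extremal law and its moments *)

Section beta_law.
Context {R : realType}.
Variables (k : nat) (c H : R).
Hypotheses (c0 : 0 < c) (H0 : 0 < H).
Notation mu := (@lebesgue_measure R).

Let w (u : R) : R := k.+1%:R * (1 - u) ^+ k.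

(** The extremal law is that of H u, where u has density (k+1) (1-u)^k on ]0, 1], rescaled to total
    mass c; its tail is c (1 - s / H)_+ ^ (k+1). The absolute value makes the variable nonnegative
    on the whole line. *)
Definition beta_var (u : R) : R := `|H * u|.
Definition beta_weight (u : R) : R := if 0 < u <= 1 then c * w u else 0.
Definition beta_tail (b : R) : R := Num.max 0 (1 - b / H) ^+ k.+1.

Let mw : measurable_fun setT w.
Proof.
apply: measurable_funM => //; apply: measurable_funX; exact: measurable_funB.
Qed.

Lemma measurable_beta_var : measurable_fun setT (beta_var : measurableTypeR R -> R).
Proof.
apply: measurableT_comp; first exact: normr_measurable.
exact: measurable_funM.
Qed.

Let m01 : measurable_fun setT (fun u : R => 0 < u <= 1).
Proof.
apply: measurable_and; first exact: measurable_gt.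
by apply: measurable_fun_ler => //; exact: measurable_cst.
Qed.

Lemma measurable_beta_weight : measurable_fun setT (beta_weight : measurableTypeR R -> R).
Proof.
apply: (measurable_if_pos (P := fun u : R => 0 < u <= 1)) => //.
exact: measurable_funM.
Qed.

Let w_ge0 u : u <= 1 -> 0 <= w u.
Proof. by move=> u1; rewrite mulr_ge0// exprn_ge0// subr_ge0. Qed.

Lemma beta_weight_ge0 u : 0 <= beta_weight u.
Proof.
by rewrite /beta_weight; case: ifP => // /andP[_ u1]; rewrite mulr_ge0 ?w_ge0// ltW.
Qed.

Lemma beta_var_ge0 u : 0 <= beta_var u. Proof. exact: normr_ge0. Qed.

Lemma beta_weight0 u : beta_var u = 0 -> beta_weight u = 0.
Proof.
move=> /eqP; rewrite normr_eq0 mulf_eq0 (gt_eqF H0) /= => /eqP ->.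
by rewrite /beta_weight ltxx.
Qed.

Lemma beta_tail_ge0 b : 0 <= beta_tail b.
Proof. by rewrite exprn_ge0// le_max lexx. Qed.

Lemma beta_tailE b : b <= H -> beta_tail b = (1 - b / H) ^+ k.+1.
Proof. by move=> bH; rewrite /beta_tail max_r// subr_ge0 ler_pdivrMr// mul1r. Qed.

Lemma beta_tail_out b : H <= b -> beta_tail b = 0.
Proof.
by move=> bH; rewrite /beta_tail max_l ?expr0n// subr_le0 ler_pdivlMr// mul1r.
Qed.

Let on_interval (S : set R) (a b : R) (x y : bool) : 0 <= a -> a <= b -> b <= 1 ->
  (forall u, (S u /\ 0 < u <= 1) <-> [set` Interval (BSide x a) (BSide y b)] u) ->
  (\int[mu]_(u in S) (beta_weight u)%:E =
   (c * ((1 - a) ^+ k.+1 - (1 - b) ^+ k.+1))%:E)%E.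
Proof.
move=> a0 ab b1 HS.
transitivity (\int[mu]_(u in [set` Interval (BSide x a) (BSide y b)]) (c * w u)%:E)%E.
  rewrite [LHS]integral_mkcond [RHS]integral_mkcond.
  apply: eq_integral => u _; rewrite !patchE /beta_weight.
  have -> : (u \in [set` Interval (BSide x a) (BSide y b)]) = (u \in S) && (0 < u <= 1).
    by apply/idP/andP => [/set_mem/HS[/mem_set]//|[/set_mem ? ?]]; apply/mem_set/HS.
  by case: (u \in S) => //=; case: ifP.
have mcw : measurable_fun (`]a, b[%classic : set R) (fun u => (c * w u)%:E).
  by apply/measurable_EFinP; apply: measurable_funTS; exact: measurable_funM.
rewrite integral_itv_bndoo// -(@integral_itv_bndoo _ _ _ _ false false)//.
under eq_integral do rewrite EFinM.
rewrite ge0_integralZl//; last 3 first.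
- by apply/measurable_EFinP; exact: measurable_funTS.
- by move=> u; rewrite /= in_itv/= => /andP[_ ub]; rewrite lee_fin w_ge0// (le_trans ub).
- by rewrite lee_fin ltW.
by rewrite integral_onemX// EFinM.
Qed.

Let var_pos u : 0 < u -> beta_var u = H * u.
Proof. by move=> u0; rewrite /beta_var ger0_norm// mulr_ge0// ltW. Qed.

Let div01 b : 0 <= b -> b <= H -> 0 <= b / H <= 1.
Proof. by move=> b0 bH; rewrite divr_ge0 ?(ltW H0)//= ler_pdivrMr// mul1r. Qed.

Let out_set (S : set R) : (forall u, S u -> 0 < u <= 1 -> False) ->
  (\int[mu]_(u in S) (beta_weight u)%:E = 0)%E.
Proof.
move=> HS; apply: integral0_eq => u Su; rewrite /beta_weight.
by case: ifP => // /(HS u Su).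
Qed.

Lemma beta_gt b : 0 <= b ->
  (\int[mu]_(u in [set u | (b < beta_var u)%R]) (beta_weight u)%:E = (c * beta_tail b)%:E)%E.
Proof.
move=> b0; have [bH|/ltW bH] := leP b H; last first.
  rewrite beta_tail_out// mulr0; apply: out_set => u /= + /andP[u0 u1].
  rewrite var_pos// ltNge => /negP; apply; apply: le_trans bH.
  by rewrite ler_piMr// ltW.
have /andP[d0 d1] := div01 b0 bH.
rewrite (@on_interval _ (b / H) 1 false false)//.
  by rewrite subrr expr0n/= subr0 beta_tailE.
move=> u /=; rewrite in_itv/= ltr_pdivrMr// [u * H]mulrC; split.
  by move=> [+ /andP[u0 ->]]; rewrite var_pos// => ->.
move=> /andP[bu ->]; have u0 : 0 < u by rewrite -(pmulr_rgt0 _ H0) (le_lt_trans b0).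
by rewrite u0 var_pos.
Qed.

Lemma beta_ge b : 0 < b ->
  (\int[mu]_(u in [set u | (b <= beta_var u)%R]) (beta_weight u)%:E = (c * beta_tail b)%:E)%E.
Proof.
move=> b0; have [bH|bH] := leP b H; last first.
  rewrite beta_tail_out ?(ltW bH)// mulr0; apply: out_set => u /= + /andP[u0 u1].
  rewrite var_pos// leNgt => /negP; apply; apply: le_lt_trans bH.
  by rewrite ler_piMr// ltW.
have /andP[d0 d1] := div01 (ltW b0) bH.
rewrite (@on_interval _ (b / H) 1 true false)//.
  by rewrite subrr expr0n/= subr0 beta_tailE.
move=> u /=; rewrite in_itv/= ler_pdivrMr// [u * H]mulrC; split.
  by move=> [+ /andP[u0 ->]]; rewrite var_pos// => ->.
move=> /andP[bu ->]; have u0 : 0 < u by rewrite -(pmulr_rgt0 _ H0) (lt_le_trans b0).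
by rewrite u0 var_pos.
Qed.

Lemma beta_lt a : 0 <= a ->
  (\int[mu]_(u in [set u | (0 < beta_var u < a)%R]) (beta_weight u)%:E =
   (c * (1 - beta_tail a))%:E)%E.
Proof.
move=> a0; have [aH|Ha] := leP a H; last first.
  rewrite (@on_interval _ 0 1 false false)//.
    by rewrite subrr expr0n/= !subr0 expr1n beta_tail_out ?subr0// ltW.
  move=> u /=; rewrite in_itv/=; split=> [[]//|/andP[u0 u1]].
  rewrite u0 u1 var_pos// mulr_gt0//=; split=> //; apply: le_lt_trans Ha.
  by rewrite ler_piMr// ltW.
have /andP[d0 d1] := div01 a0 aH.
rewrite (@on_interval _ 0 (a / H) false true)//.
  by rewrite subr0 expr1n beta_tailE.
move=> u /=; rewrite in_itv/= ltr_pdivlMr// [u * H]mulrC; split.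
  by move=> [+ /andP[u0 _]]; rewrite var_pos// u0 => /andP[_ ->].
move=> /andP[u0 ua]; rewrite u0 var_pos// mulr_gt0//= ua; split=> //.
by rewrite -(ler_pM2l H0) mulr1 (le_trans (ltW ua)).
Qed.

Lemma beta_le a : 0 <= a ->
  (\int[mu]_(u in [set u | (beta_var u <= a)%R]) (beta_weight u)%:E =
   (c * (1 - beta_tail a))%:E)%E.
Proof.
move=> a0; have [aH|Ha] := leP a H; last first.
  rewrite (@on_interval _ 0 1 false false)//.
    by rewrite subrr expr0n/= !subr0 expr1n beta_tail_out ?subr0// ltW.
  move=> u /=; rewrite in_itv/=; split=> [[]//|/andP[u0 u1]].
  rewrite u0 u1 var_pos//; split=> //; apply: ltW; apply: le_lt_trans Ha.
  by rewrite ler_piMr// ltW.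
have /andP[d0 d1] := div01 a0 aH.
rewrite (@on_interval _ 0 (a / H) false false)//.
  by rewrite subr0 expr1n beta_tailE.
move=> u /=; rewrite in_itv/= ler_pdivlMr// [u * H]mulrC; split.
  by move=> [+ /andP[u0 _]]; rewrite var_pos// u0 => ->.
move=> /andP[u0 ua]; rewrite u0 var_pos//= ua; split=> //.
by rewrite -(ler_pM2l H0) mulr1 (le_trans ua).
Qed.

Lemma beta_total : (\int[mu]_u (beta_weight u)%:E = c%:E)%E.
Proof.
rewrite (@on_interval _ 0 1 false false)//.
  by rewrite subrr expr0n/= !subr0 expr1n mulr1.
by move=> u /=; rewrite in_itv/=; split=> [[]|].
Qed.

(** The mean of [pot p] under the extremal law, by [beta_potE]. For k + 1 = 2n the product is
    binom(2n + p, p) and the sum is the harmonic number of order 2n, the ingredients of kappa. *)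
Definition beta_pot (p : R) : R :=
  if p == 0 then ln H - \sum_(j < k.+1) j.+1%:R^-1
  else (H `^ p / \prod_(j < k.+1) (1 + p / j.+1%:R) - 1) / p.

Lemma beta_integrable1 : wintegrable mu beta_var beta_weight (cst 1).
Proof.
apply: wintegrable_ge0.
- exact: measurable_beta_var.
- exact: measurable_beta_weight.
- exact: beta_weight_ge0.
- exact: measurable_cst.
- by move=> s; exact: ler01.
- under eq_integral do rewrite mul1e.
  by rewrite beta_total ltry.
Qed.

Let restrict_weight (f : R -> R) : 
  (\int[mu]_u (f (beta_var u) * beta_weight u)%:E =
   \int[mu]_(u in `]0%R, 1%R]) (c * (f (H * u) * w u))%:E)%E.
Proof.
rewrite [RHS]integral_mkcond; apply: eq_integral => u _; rewrite patchE /beta_weight.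
case: ifPn => [/andP[u0 u1]|h].
  by rewrite mem_set/= ?in_itv/= ?u0// var_pos//; congr EFin; ring.
by rewrite memNset ?mulr0//= in_itv/=; exact/negP.
Qed.

Lemma beta_powR (p : R) : -1 < p ->
  (\int[mu]_u (beta_var u `^ p * beta_weight u)%:E =
   (c * (H `^ p / \prod_(j < k.+1) (1 + p / j.+1%:R)))%:E)%E.
Proof.
move=> p1; rewrite (restrict_weight (fun s => s `^ p)).
transitivity (\int[mu]_(u in `]0%R, 1%R])
    ((c * H `^ p * k.+1%:R)%:E * (u `^ p * (1 - u) ^+ k)%:E))%E.
  apply: eq_integral => u; rewrite inE /= in_itv/= => /andP[u0 u1].
  rewrite -EFinM powRM ?(ltW H0) ?(ltW u0)// /w; congr EFin; ring.
rewrite ge0_integralZl//; last 3 first.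
- apply/measurable_EFinP; apply: measurable_funTS; apply: measurable_funM.
    exact: measurable_powR.
  by apply: measurable_funX; exact: measurable_funB.
- move=> u; rewrite /= in_itv/= => /andP[u0 u1].
  by rewrite lee_fin mulr_ge0 ?powR_ge0// exprn_ge0// subr_ge0.
- by rewrite lee_fin !mulr_ge0 ?powR_ge0// ltW.
rewrite beta_integral// -EFinM; congr EFin.
have -> : \prod_(j < k.+1) (1 + p / j.+1%:R) =
    \prod_(j < k.+1) (p + j.+1%:R) / k.+1`!%:R :> R.
  rewrite fact_prod big_add1/= big_mkord natr_prod -prodf_div.
  by apply: eq_bigr => j _; rewrite mulrDl divff ?pnatr_eq0// addrC.
have P0 : \prod_(j < k.+1) (p + j.+1%:R) != 0 :> R.
  apply/prodf_neq0 => j _; rewrite gt_eqF// -natr1; have := ler0n R j; lra.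
rewrite factS natrM; field.
by rewrite P0 nat1r !pnatr_eq0/= -lt0n fact_gt0.
Qed.

Lemma beta_ln :
  (\int[mu]_u (- (ln (beta_var u / H)) * beta_weight u)%:E =
   (c * \sum_(j < k.+1) j.+1%:R^-1)%:E)%E.
Proof.
rewrite (restrict_weight (fun s => - ln (s / H))).
under eq_integral do rewrite mulrAC mulfV ?(gt_eqF H0)// mul1r EFinM.
rewrite ge0_integralZl//; last 3 first.
- apply/measurable_EFinP; apply: measurable_funTS; apply: measurable_funM => //.
  by apply: measurable_funN; exact: measurable_ln.
- move=> u; rewrite /= in_itv/= => /andP[u0 u1].
  by rewrite lee_fin mulr_ge0 ?w_ge0// oppr_ge0 ln_le0.
- by rewrite lee_fin ltW.
by rewrite integral_ln_onemX EFinM.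
Qed.

Lemma beta_potE (p : R) : -1 < p ->
  wintegrable mu beta_var beta_weight (pot p) /\
  \int[mu]_u (pot p (beta_var u) * beta_weight u) = c * beta_pot p.
Proof.
move=> p1; have tot : \int[mu]_u (beta_weight u) = c by rewrite /Rintegral beta_total.
have i1 := beta_integrable1.
have [p0|pn0] := boolP (p == 0).
  (* The logarithm of H u need not have a constant sign, but - ln (s / H) is nonnegative for 0 < s
     <= H. Its integral is given by [beta_ln], and [pot 0] is an affine function of it. *)
  have mln : measurable_fun setT (fun s : R => - ln (s / H)).
    apply: measurable_funN; apply: (measurableT_comp (@measurable_ln R)).
    exact: measurable_funM.
  have iln : wintegrable mu beta_var beta_weight (fun s => - ln (s / H)).
    apply/integrableP; split.
      apply/measurable_EFinP.
      exact: (measurable_weighted measurable_beta_var measurable_beta_weight mln).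
    rewrite (_ : (\int[mu]_u _)%E = (c * \sum_(j < k.+1) j.+1%:R^-1)%:E) ?ltry//.
    rewrite -beta_ln; apply: eq_integral => u _ /=; congr EFin.
    rewrite /beta_weight; case: ifPn => [/andP[u0 u1]|_]; last by rewrite mulr0 normr0.
    rewrite ger0_norm// !mulr_ge0 ?exprn_ge0 ?subr_ge0 ?(ltW c0)//.
    by rewrite oppr_ge0 ln_le0// var_pos// mulrAC mulfV ?(gt_eqF H0)// mul1r.
  (* The function g is taken to be the constant 1, which the constant w compensates. *)
  have [h1 h2] := wintegral_lincomb 1 (1 - ln H) iln i1 i1.
  have e s : 0 < s -> pot p s = cst 1 s - 1 * - ln (s / H) - (1 - ln H).
    by move=> s0; rewrite /pot p0 /= ln_div ?posrE//; ring.
  split.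
    have le_pot s : 0 < s -> `|pot p s| <= `|cst 1 s - 1 * - ln (s / H) - (1 - ln H)|.
      by move=> s0; rewrite e.
    exact: (wintegrable_le measurable_beta_var measurable_beta_weight beta_var_ge0
      beta_weight0 (@measurable_pot R p) le_pot h1).
  rewrite (wintegral_eq mu beta_var_ge0 beta_weight0 e) h2 /beta_pot p0.
  have -> : \int[mu]_u (cst 1 (beta_var u) * beta_weight u) = c.
    by rewrite -[RHS]tot; apply: eq_Rintegral => u _; rewrite mul1r.
  rewrite tot.
  have -> : \int[mu]_u (- ln (beta_var u / H) * beta_weight u) =
      c * \sum_(j < k.+1) j.+1%:R^-1 by rewrite /Rintegral beta_ln.
  by ring.
have ip : wintegrable mu beta_var beta_weight (fun s => s `^ p).
  apply: wintegrable_ge0.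
  - exact: measurable_beta_var.
  - exact: measurable_beta_weight.
  - exact: beta_weight_ge0.
  - exact: measurable_powR.
  - by move=> s; exact: powR_ge0.
  - by under eq_integral do rewrite -EFinM; rewrite beta_powR// ltry.
have [h1 h2] := wintegral_lincomb (- p^-1) (1 + p^-1) ip i1 i1.
have e s : 0 < s -> pot p s = cst 1 s - - p^-1 * s `^ p - (1 + p^-1).
  by move=> s0; rewrite /pot (negbTE pn0) /=; ring.
split.
  have le_pot s : 0 < s -> `|pot p s| <= `|cst 1 s - - p^-1 * s `^ p - (1 + p^-1)|.
    by move=> s0; rewrite e.
  exact: (wintegrable_le measurable_beta_var measurable_beta_weight beta_var_ge0
    beta_weight0 (@measurable_pot R p) le_pot h1).
rewrite (wintegral_eq mu beta_var_ge0 beta_weight0 e) h2 /beta_pot (negbTE pn0).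
have -> : \int[mu]_u (cst 1 (beta_var u) * beta_weight u) = c.
  by rewrite -[RHS]tot; apply: eq_Rintegral => u _; rewrite mul1r.
rewrite tot /Rintegral beta_powR//=.
by ring.
Qed.

End beta_law.

(** * Laws whose tail has a concave root *)

Section tail_comparison.
Context d (T : measurableType d) (R : realType).
Variables (mu : {sigma_finite_measure set T -> \bar R}) (X D : T -> R).
Variables (k : nat) (c h : R).
Hypotheses (mX : measurable_fun setT X) (mD : measurable_fun setT D).
Hypotheses (D0 : forall x, 0 <= D x) (X0 : forall x, 0 <= X x).
Hypothesis DX0 : forall x, X x = 0 -> D x = 0.
Hypotheses (c0 : 0 < c) (h0 : 0 < h).
Hypothesis Dtot : (\int[mu]_x (D x)%:E = c%:E)%E.
Hypothesis Dh : forall x, h < X x -> D x = 0.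
Hypothesis atomless : forall b, 0 < b ->
  (\int[mu]_(x in [set x | X x = b]) (D x)%:E = 0)%E.

Let tail (s : R) : \bar R := (\int[mu]_(x in [set x | (s < X x)%R]) (D x)%:E)%E.

Hypothesis tail_concave : forall s t l a b, 0 <= s < h -> 0 <= t < h ->
  0 < l < 1 -> 0 <= a -> 0 <= b ->
  ((c * a ^+ k.+1)%:E <= tail s)%E -> ((c * b ^+ k.+1)%:E <= tail t)%E ->
  ((c * ((1 - l) * a + l * b) ^+ k.+1)%:E <= tail ((1 - l) * s + l * t))%E.

Let mlvl (P : R -> bool) : measurable_fun setT P -> measurable [set x | P (X x)].
Proof.
move=> mP; rewrite (_ : [set x | _] = (P \o X) @^-1` [set true]).
  rewrite -[X in measurable X]setTI; exact: (measurableT_comp mP mX).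
by apply/seteqP; split.
Qed.

Let mgt b : measurable [set x | b < X x].
Proof. by apply: (mlvl (P := fun s => b < s)); exact: measurable_gt. Qed.

Let mle b : measurable [set x | X x <= b].
Proof.
by apply: (mlvl (P := fun s => s <= b)); apply: measurable_fun_ler => //; exact: measurable_cst.
Qed.

Let mlt b : measurable [set x | 0 < X x < b].
Proof.
by apply: (mlvl (P := fun s => 0 < s < b)); apply: measurable_and;
  [exact: measurable_gt|exact: measurable_lt].
Qed.

Let meq b : measurable [set x | X x = b].
Proof.
rewrite -[X in measurable X]setTI; exact: (mX measurableT (measurable_set1 b)).
Qed.

Let mDS S : measurable_fun S (fun x => (D x)%:E).
Proof. by apply: measurable_funTS; exact/measurable_EFinP. Qed.

Let D0S (S : set T) x : S x -> (0 <= (D x)%:E)%E.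
Proof. by rewrite lee_fin. Qed.

Let tl s := fine (tail s).

Let tail_ge0 s : (0 <= tail s)%E.
Proof. by apply: integral_ge0 => x _; rewrite lee_fin. Qed.

Let tailE s : tail s = (tl s)%:E.
Proof.
rewrite /tl fineK// ge0_fin_numE//; apply: le_lt_trans (ltry c).
rewrite -Dtot; apply: ge0_subset_integral => //; exact: D0S.
Qed.

Let tl_ge0 s : 0 <= tl s. Proof. by rewrite fine_ge0. Qed.

Let tail_le a : (\int[mu]_(x in [set x | (X x <= a)%R]) (D x)%:E = (c - tl a)%:E)%E.
Proof.
have : (\int[mu]_(x in [set x | (X x <= a)%R]) (D x)%:E + tail a = c%:E)%E.
  rewrite -Dtot -(_ : [set x | X x <= a] `|` [set x | a < X x] = setT).
    rewrite ge0_integral_setU//; first exact: D0S.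
    by apply/disj_setPS => x /= [h1]; rewrite ltNge h1.
  by apply/seteqP; split => x //= _; case: leP; [left|right].
rewrite tailE; case: (\int[mu]_(x in _) _)%E => [r| |]//.
by rewrite -EFinD => -[<-]; rewrite addrK.
Qed.

Let tail_ge b : 0 < b -> (\int[mu]_(x in [set x | (b <= X x)%R]) (D x)%:E = (tl b)%:E)%E.
Proof.
move=> b0; rewrite (_ : [set x | (b <= X x)] = [set x | X x = b] `|` [set x | b < X x]).
  rewrite ge0_integral_setU//; first by rewrite atomless// add0e -tailE.
    exact: D0S.
  by apply/disj_setPS => x /= [->]; rewrite ltxx.
apply/seteqP; split=> x /=; first by rewrite le_eqVlt => /predU1P[<-|]; [left|right].
by case=> [->//|/ltW].
Qed.

Let tail_lt a : 0 < a ->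
  (\int[mu]_(x in [set x | (0 < X x < a)%R]) (D x)%:E = (c - tl a)%:E)%E.
Proof.
move=> a0; rewrite -tail_le.
rewrite (_ : [set x | X x <= a] =
    [set x | 0 < X x < a] `|` ([set x | X x = a] `|` [set x | X x = 0])); last first.
  apply/seteqP; split=> x /=.
    rewrite le_eqVlt => /predU1P[->|xa]; first by right; left.
    have := X0 x; rewrite le_eqVlt => /predU1P[<-|xp]; first by right; right.
    by left; rewrite xp.
  by move=> [/andP[_ /ltW]//|[->//|->]]; exact: ltW.
have d1 : [disjoint [set x | X x = a] & [set x | X x = 0]].
  by apply/disj_setPS => x /= [-> /eqP]; rewrite gt_eqF.
have d2 : [disjoint [set x | 0 < X x < a] & [set x | X x = a] `|` [set x | X x = 0]].
  by apply/disj_setPS => x /= [/andP[x0 xa] [xE|xE]]; move: x0 xa; rewrite xE ltxx.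
rewrite [RHS]ge0_integral_setU//; [|exact: measurableU|exact: D0S].
rewrite ge0_integral_setU//; last exact: D0S.
rewrite atomless// add0e.
rewrite [X in (_ + X)%E]integral0_eq ?adde0// => x /= /DX0 ->.
by [].
Qed.

Let tl0 : tl 0 = c.
Proof.
apply: EFin_inj; rewrite -tailE -Dtot /tail [LHS]integral_mkcond.
apply: eq_integral => x _; rewrite patchE; case: ifPn => //.
rewrite notin_setE /= => /negP; rewrite -leNgt => Xx.
by rewrite DX0//; apply/eqP; rewrite eq_le Xx X0.
Qed.

Let tl_out s : h <= s -> tl s = 0.
Proof.
move=> hs; apply: EFin_inj; rewrite -tailE; apply: integral0_eq => x /= sX.
by rewrite Dh// (le_lt_trans hs).
Qed.

Let tl_concave0 t l b : 0 <= t < h -> 0 < l < 1 -> 0 <= b -> c * b ^+ k.+1 <= tl t ->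
  c * ((1 - l) + l * b) ^+ k.+1 <= tl (l * t).
Proof.
move=> th l01 b0 hb.
have := @tail_concave 0 t l 1 b _ th l01 ler01 b0.
rewrite lexx h0 !tailE tl0 expr1n !lee_fin !mulr1 mulr0 add0r; exact.
Qed.

(** The root of the normalised tail is 1 at 0 and nonnegative at t, so by concavity it is at least 1
    - s / t for s < t < h. The points allowed in [tail_concave] stay below h, so the bound is
    reached by letting t tend to h. *)
Let tl_lower s : 0 <= s -> c * beta_tail k h s <= tl s.
Proof.
move=> s0; have [hs|sh] := leP h s; first by rewrite beta_tail_out// mulr0.
move: s0; rewrite le_eqVlt => /predU1P[<-|s0].
  by rewrite beta_tailE ?(ltW h0)// mul0r subr0 expr1n mulr1 tl0.
have key t : s < t -> t < h -> c * (1 - s / t) ^+ k.+1 <= tl s.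
  move=> st th; have t0 := lt_trans s0 st.
  have l01 : 0 < s / t < 1 by rewrite divr_gt0//= ltr_pdivrMr// mul1r.
  have := @tl_concave0 t (s / t) 0 _ l01 (lexx _).
  rewrite expr0n/= !mulr0 addr0 divfK ?gt_eqF//; apply => //.
  by rewrite (ltW t0).
rewrite (beta_tailE _ h0 (ltW sh)).
have cv : c * (1 - s / t) ^+ k.+1 @[t --> h^'-] --> c * (1 - s / h) ^+ k.+1.
  apply: cvg_at_left_filter; apply: cvgM; first exact: cvg_cst.
  apply: (@continuous_comp _ _ _ (fun t : R => s / t) (fun y : R => (1 - y) ^+ k.+1)).
    by apply: cvgM; [exact: cvg_cst|apply: cvgV => //; rewrite gt_eqF].
  exact: continuous_onemX.
apply: (cvgr_to_le cv); near=> t; apply: key; near: t.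
  exact: nbhs_left_gt.
exact: nbhs_left_lt.
Unshelve. all: by end_near. Qed.

Let i1 : wintegrable mu X D (cst 1).
Proof.
apply: wintegrable_ge0 => //.
by under eq_integral do rewrite mul1e; rewrite Dtot ltry.
Qed.

(** The positive part is at most its value at h, beyond which the weight vanishes. The negative part
    can be singular at 0; by [tl_lower] its integral is at most that for the extremal law with H =
    h, finite for p > -1. *)
Lemma wintegrable_pot_tail p : -1 < p -> wintegrable mu X D (pot p).
Proof.
move=> p1; have [iY _] := beta_potE k c0 h0 p1.
have [iYp iYn] := wintegrable_pot_parts (measurable_beta_var h) (measurable_beta_weight k c)
  (beta_var_ge0 h) (beta_weight0 k c h0) iY.
apply: wintegrable_pot => //; apply: wintegrable_ge0 => //.
- exact: measurable_pot_pos.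
- by move=> s; exact: pot_pos_ge0.
- apply: (@le_lt_trans _ _ (\int[mu]_x ((pot_pos p h)%:E * (D x)%:E))%E).
    apply: ge0_le_integral => //.
    + by move=> x _; rewrite mule_ge0// lee_fin ?pot_pos_ge0.
    + apply: emeasurable_funM; last exact/measurable_EFinP.
      apply/measurable_EFinP; apply: measurableT_comp => //.
      exact: measurable_pot_pos.
    + by apply: emeasurable_funM; [exact: measurable_cst|exact/measurable_EFinP].
    + move=> x _; have [Xh|/Dh ->] := leP (X x) h; last by rewrite !mule0.
      rewrite lee_wpmul2r// ?lee_fin// /pot_pos h0; case: ifP => [x0|_].
        by rewrite ge_max !le_max lexx orbT andbT ler_pot.
      by rewrite le_max lexx orbT.
  rewrite ge0_integralZl//; last 2 first.
  - by move=> x _; rewrite lee_fin.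
  - by rewrite lee_fin pot_pos_ge0.
  by rewrite Dtot -EFinM ltry.
- exact: measurable_pot_neg.
- by move=> s; exact: pot_neg_ge0.
- apply: (@le_lt_trans _ _ (\int[lebesgue_measure]_y
      ((pot_neg p (beta_var h y))%:E * (beta_weight k c y)%:E))%E).
    apply: pot_neg_le => //.
    + exact: measurable_beta_var.
    + exact: measurable_beta_weight.
    + by move=> y; exact: beta_weight_ge0.
    + move=> a /andP[a0 _]; rewrite tail_le (beta_lt k c0 h0 a0) lee_fin.
      by rewrite mulrBr mulr1 lerD2l lerN2 tl_lower.
  by rewrite (wintegral_ge0E iYn) ltry.
Qed.

Lemma beta_pot_le p : -1 < p ->
  c * beta_pot k h p <= \int[mu]_x (pot p (X x) * D x).
Proof.
move=> p1; have [iY <-] := beta_potE k c0 h0 p1.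
apply: (@pot_dominance _ _ _ _ _ mu lebesgue_measure X (beta_var h) D (beta_weight k c)) => //.
- exact: measurable_beta_var.
- exact: measurable_beta_weight.
- by move=> y; exact: beta_weight_ge0.
- by move=> y; exact: beta_var_ge0.
- by move=> y; exact: beta_weight0.
- exact: wintegrable_pot_tail.
- move=> a /andP[a0 _]; rewrite tail_le (beta_lt k c0 h0 a0) lee_fin.
  by rewrite mulrBr mulr1 lerD2l lerN2 tl_lower.
- apply: pot_pos_le => //.
  + exact: measurable_beta_var.
  + exact: measurable_beta_weight.
  + by move=> y; exact: beta_weight_ge0.
  + move=> b b1; have b0 := lt_trans ltr01 b1.
    by rewrite (beta_ge k c0 h0 b0) -/(tail b) tailE lee_fin tl_lower// ltW.
Qed.

(** The crossing point s0 is the supremum of the t < H where the tail of X is still at least the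
    extremal one. Beyond s0 the tail of X is smaller by definition. Before s0, concavity between 0,
    where both tails equal c, and some such t > s keeps it above, because the root of the extremal
    tail is affine on [0, H]. *)
Lemma pot_le_beta p q H : -1 < p -> p < q -> h <= H ->
  \int[mu]_x (pot p (X x) * D x) = c * beta_pot k H p ->
  \int[mu]_x (pot q (X x) * D x) <= c * beta_pot k H q.
Proof.
move=> p1 pq hH; have H0 := lt_le_trans h0 hH; have q1 := lt_trans p1 pq.
have [iYp <-] := beta_potE k c0 H0 p1; have [iYq <-] := beta_potE k c0 H0 q1 => eqp.
pose S := [set t | [/\ 0 <= t, t < H & c * beta_tail k H t <= tl t]].
have bt0 : beta_tail k H 0 = 1 by rewrite beta_tailE ?(ltW H0)// mul0r subr0 expr1n.
have S0 : S 0 by split => //; rewrite bt0 mulr1 tl0.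
have hS : has_sup S by split; [exists 0|exists H => t [_ /ltW]].
pose s0 := sup S.
have below s : 0 <= s -> s < s0 -> c * beta_tail k H s <= tl s.
  move=> s_ge0 ss0; have e0 : 0 < s0 - s by rewrite subr_gt0.
  have [t [t0 tH ht]] := sup_adherent e0 hS; rewrite -/s0 opprB addrCA subrr addr0 => st.
  move: s_ge0; rewrite le_eqVlt => /predU1P[<-|sp]; first by rewrite bt0 mulr1 tl0.
  have tp := lt_trans sp st.
  have bt : 0 < 1 - t / H by rewrite subr_gt0 ltr_pdivrMr// mul1r.
  (* From h on the tail of X is zero, while the extremal tail is positive before H. *)
  have th : t < h.
    rewrite ltNge; apply/negP => /tl_out tz; move: ht.
    by rewrite tz (beta_tailE _ H0 (ltW tH)) leNgt mulr_gt0// exprn_gt0.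
  have l01 : 0 < s / t < 1 by rewrite divr_gt0//= ltr_pdivrMr// mul1r.
  move: ht; rewrite (beta_tailE _ H0 (ltW tH)) => ht.
  have := @tl_concave0 t (s / t) _ _ l01 (ltW bt) ht.
  rewrite divfK ?gt_eqF// t0 => /(_ th); apply: le_trans.
  rewrite (beta_tailE _ H0 (ltW (lt_trans st tH))).
  rewrite le_eqVlt; apply/orP; left; apply/eqP; congr (_ * _ ^+ _).
  by field; rewrite !gt_eqF.
have above s : s0 < s -> tl s <= c * beta_tail k H s.
  move=> s0s; have s00 : 0 <= s0 by apply: sup_upper_bound.
  have [Hs|sH] := leP H s; first by rewrite tl_out ?mulr_ge0 ?beta_tail_ge0 ?(ltW c0)// (le_trans hH).
  rewrite leNgt; apply/negP => hs.
  have : S s by split=> //; [exact: ltW (le_lt_trans s00 s0s)|exact: ltW].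
  by move=> /(sup_upper_bound hS); rewrite leNgt s0s.
have : 0 <= s0 by apply: sup_upper_bound.
(* If s0 = 0, the extremal tail dominates at every positive level and monotonicity of [pot q]
   concludes; otherwise the tails cross at s0 > 0. *)
rewrite le_eqVlt => /predU1P[s00|s00].
- apply: (@pot_dominance _ _ _ _ _ lebesgue_measure mu (beta_var H) X (beta_weight k c) D) => //.
  + exact: measurable_beta_var.
  + exact: measurable_beta_weight.
  + by move=> y; exact: beta_weight_ge0.
  + by move=> y; exact: beta_var_ge0.
  + by move=> y; exact: beta_weight0.
  + exact: wintegrable_pot_tail.
  + move=> a /andP[]; rewrite le_eqVlt => /predU1P[<- _|a0 _].
      rewrite (beta_le k c0 H0 (lexx _)) bt0 subrr mulr0.
      by apply: integral_ge0 => x _; rewrite lee_fin.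
    rewrite (beta_le k c0 H0 (ltW a0)) tail_lt// lee_fin.
    by rewrite mulrBr mulr1 lerD2l lerN2 above// -s00.
  + apply: pot_pos_le => //.
    * exact: measurable_beta_var.
    * exact: measurable_beta_weight.
    * by move=> y; exact: beta_weight_ge0.
    * move=> b b1; have b0 := lt_trans ltr01 b1.
      by rewrite (beta_gt k c0 H0 (ltW b0)) tail_ge// lee_fin above// -s00.
- apply: (@pot_crossing _ _ _ _ _ mu lebesgue_measure X (beta_var H) D (beta_weight k c)
    _ _ _ _ _ _ _ _ _ _ p q s0) => //.
  + exact: measurable_beta_var.
  + exact: measurable_beta_weight.
  + by move=> y; exact: beta_weight_ge0.
  + by move=> y; exact: beta_var_ge0.
  + by move=> y; exact: beta_weight0.
  + exact: wintegrable_pot_tail.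
  + exact: wintegrable_pot_tail.
  + exact: beta_integrable1.
  + by rewrite /Rintegral Dtot beta_total.
  + move=> a /andP[a0 as0]; rewrite tail_le (beta_lt k c0 H0 a0) lee_fin.
    by rewrite mulrBr mulr1 lerD2l lerN2 below.
  + move=> b s0b; have b0 := lt_trans s00 s0b.
    by rewrite tail_ge// (beta_gt k c0 H0 (ltW b0)) lee_fin above.
Qed.

End tail_comparison.

(** * The inclusions *)

Section beta_pot_theory.
Context {R : realType}.
Variables (k : nat) (p : R).
Hypothesis p1 : -1 < p.

Lemma beta_prod_gt0 : 0 < \prod_(j < k.+1) (1 + p / j.+1%:R).
Proof.
apply: prodr_gt0 => j _; rewrite -[X in X + _](@divff _ j.+1%:R) ?pnatr_eq0//.
rewrite -mulrDl divr_gt0//; have : 1 <= j.+1%:R :> R by rewrite ler1n.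
by move: p1; lra.
Qed.

(** In H, [beta_pot k H p] is an increasing affine function of [pot p H]. Inequalities between means
    thus become inequalities between the lengths H. *)
Lemma beta_pot_ltr (H H' : R) : 0 < H -> H < H' -> beta_pot k H p < beta_pot k H' p.
Proof.
move=> H0 HH'; have := ltr_pot p H0 HH'; rewrite /beta_pot /pot.
case: ifPn => [_|pn0]; first by rewrite ltrD2r.
have b0 := beta_prod_gt0; set b := \prod_(_ < _) _ in b0 *.
move=> h; have e x : (x / b - 1) / p = ((x - 1) / p) / b + (b^-1 - 1) / p.
  by field; rewrite pn0 gt_eqF.
by rewrite !e ltrD2r ltr_pM2r// invr_gt0.
Qed.

Lemma beta_pot_le_inv (H H' : R) : 0 < H -> 0 < H' ->
  beta_pot k H p <= beta_pot k H' p -> H <= H'.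
Proof.
move=> H0 H'0; apply: contraTT; rewrite -!ltNge; exact: beta_pot_ltr.
Qed.

End beta_pot_theory.

Section direction.
Context {R : realType} {n : nat}.
Variables (K : set 'rV[R]_n) (theta : 'rV[R]_n).
Hypotheses (n0 : (0 < n)%N) (cbK : convex_body K) (th : unit_sphere theta).
Notation lam := (@lebesgue_rV R n).

Let theta0 : theta != 0.
Proof.
apply/eqP => t0; move: th; rewrite /unit_sphere /= t0 /dotv big1.
  by move=> /eqP; rewrite eq_sym oner_eq0.
by move=> i _; rewrite mxE mul0r.
Qed.

Let mK : measurable K.
Proof. by case: cbK => + _ _; exact: compact_measurable_rV. Qed.

(** The exponent 2n appears as a successor k + 1; [kS] splits it as n + n to match the two n-fold
    marginals. *)
Let k := (2 * n).-1.
Let kS : k.+1 = (n + n)%N.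
Proof. by rewrite /k prednK ?muln_gt0// mul2n addnn. Qed.

Let c : R := volume K ^+ 2.
Let c0 : 0 < c. Proof. by rewrite exprn_gt0// volume_gt0. Qed.

Let X (z : 'rV[R]_n) : R := `|dotv theta z|.
(** The covariogram, cut to 0 on the hyperplane X = 0 so that the weight vanishes there, as the
    comparison of laws requires. *)
Let D (z : 'rV[R]_n) : R := if 0 < X z then covariogram K z else 0.

Let mX : measurable_fun setT X.
Proof.
by apply: measurableT_comp; [exact: normr_measurable|exact: measurable_dotv].
Qed.

Let mg := measurable_covariogram cbK.

Let mD : measurable_fun setT D.
Proof.
apply: measurable_fun_ifT => //.
by apply: measurable_fun_ltr => //; exact: measurable_cst.
Qed.

Let D0 z : 0 <= D z.
Proof. by rewrite /D; case: ifP => // _; exact: covariogram_ge0. Qed.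

Let X0 z : 0 <= X z. Proof. exact: normr_ge0. Qed.

Let DX0 z : X z = 0 -> D z = 0.
Proof. by rewrite /D => ->; rewrite ltxx. Qed.

Let DK := difference_body K.

Lemma difference_bodyP z : difference_body K z <-> exists2 w, K w & K (w - z).
Proof.
split=> [[w [Kw [y Ky yw]]]|[w Kw Kwz]].
  by exists w => //; rewrite -yw addrK.
by exists w; split=> //; exists (w - z); rewrite ?subrK.
Qed.

Lemma difference_bodyN z : difference_body K z -> difference_body K (- z).
Proof.
move=> /difference_bodyP[w Kw Kwz]; apply/difference_bodyP.
by exists (w - z) => //; rewrite opprK subrK.
Qed.

Lemma difference_body0 : difference_body K 0.
Proof.
case: cbK => _ _ [x /interior_subset Kx].
by apply/difference_bodyP; exists x => //; rewrite subr0.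
Qed.

Let diff_bounded : exists r : R, forall z, DK z -> forall i, `|z ord0 i| <= r.
Proof.
case: cbK => /compact_coord_bounded[r r0 Kr] _ _; exists (r + r) => z.
move=> /difference_bodyP[w Kw Kwz] i; have h1 := Kr _ Kw i; have h2 := Kr _ Kwz i.
have -> : z ord0 i = w ord0 i - (w - z) ord0 i by rewrite !mxE; ring.
by apply: le_trans (ler_normB _ _) _; exact: lerD.
Qed.

Let hset : set R := [set dotv theta z | z in DK].

Let hsup : has_sup hset.
Proof.
split; first by exists (dotv theta 0), 0 => //; exact: difference_body0.
have [r hr] := diff_bounded; exists (\sum_i `|theta ord0 i| * r) => _ [z Dz <-].
apply: le_trans (ler_norm _) _; apply: le_trans (ler_norm_sum _ _ _) _.
by apply: ler_sum => i _; rewrite normrM ler_wpM2l// hr.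
Qed.

Let h := sup hset.

Lemma difference_body_width z : difference_body K z -> `|dotv theta z| <= h.
Proof.
move=> Dz; rewrite ler_norml; apply/andP; split; last first.
  by apply: sup_upper_bound => //; exists z.
rewrite lerNl -dotvNr; apply: sup_upper_bound => //; exists (- z) => //.
exact: difference_bodyN.
Qed.

Let Dh z : h < X z -> D z = 0.
Proof.
move=> hz; rewrite /D; case: ifP => // _; apply: covariogram_out => /difference_body_width.
by rewrite leNgt hz.
Qed.

Let null b : lebesgue_rV [set z | X z = b] = 0%E.
Proof.
have hp := measurable_hyperplane theta.
apply/eqP; rewrite eq_le measure_ge0 andbT.
apply: (@le_trans _ _ (lam ([set z | dotv theta z = b] `|` [set z | dotv theta z = - b]))).
  apply: le_measure; rewrite ?inE; last 2 first.
  - exact: measurableU.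
  - move=> z /=; rewrite /X; case: (ler0P (dotv theta z)) => _ <-; rewrite ?opprK;
    by [left|right].
  - rewrite -[Y in measurable Y]setTI; exact: (mX measurableT (measurable_set1 b)).
have := measureU2 lam (hp b) (hp (- b)).
by rewrite /= !hyperplane_null// adde0.
Qed.

Let meq b : measurable [set z | X z = b].
Proof. rewrite -[Y in measurable Y]setTI; exact: (mX measurableT (measurable_set1 b)). Qed.

Let atomless b : 0 < b -> (\int[lam]_(z in [set z | X z = b]) (D z)%:E = 0)%E.
Proof.
move=> _; transitivity (\int[lam]_(z in [set z | X z = b]) `|(D z)%:E|)%E.
  by apply: eq_integral => z _ /=; rewrite ger0_norm.
apply: integral_abs_eq0; [exact: meq| |exact: null].
by apply: measurable_funTS; exact/measurable_EFinP.
Qed.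

(* [D] and the covariogram agree off the null hyperplane orthogonal to [theta]. *)
Let ae_D (f : 'rV[R]_n -> R) : measurable_fun setT f ->
  (\int[lam]_z (f z * covariogram K z)%:E = \int[lam]_z (f z * D z)%:E)%E.
Proof.
move=> mf; apply: ae_eq_integral => //.
- by apply/measurable_EFinP; exact: measurable_funM.
- by apply/measurable_EFinP; exact: measurable_funM.
exists [set z | X z = 0]; split; [exact: meq|exact: null|].
move=> z /= hz; apply: contrapT => /eqP Xz; apply: hz => _.
by rewrite /D lt_neqAle eq_sym Xz X0.
Qed.

Let Dtot : (\int[lam]_z (D z)%:E = c%:E)%E.
Proof.
rewrite /c -(integral_covariogram cbK).
have := @ae_D (cst 1) (measurable_cst _).
by under eq_integral do rewrite mul1r; under [in X in _ = X -> _]eq_integral do rewrite mul1r.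
Qed.

Let tailE s : 0 <= s ->
  (\int[lam]_(z in [set z | (s < X z)%R]) (D z)%:E =
   2%:E * \int[lam]_(z in [set z | (s < dotv theta z)%R]) (covariogram K z)%:E)%E.
Proof.
move=> s0; rewrite -(integral_covariogram_half cbK)//.
apply: eq_integral => z; rewrite inE /= => sX.
by rewrite /D (le_lt_trans s0 sX).
Qed.

Let h0 : 0 < h.
Proof.
rewrite ltNge; apply/negP => hle.
have : (\int[lam]_z (D z)%:E = 0)%E.
  apply: integral0_eq => z _; rewrite /D; case: ifP => // Xz.
  rewrite covariogram_out// => /difference_body_width.
  by rewrite leNgt (le_lt_trans hle Xz).
by rewrite Dtot => -[cE]; move: c0; rewrite cE ltxx.
Qed.

(** Convex, because K is convex and [s < dotv theta z] is linear in (s, z). The nesting of the pairs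
    lets w be integrated out before z. *)
Let A : set ((R^o * 'rV[R]_n) * 'rV[R]_n) :=
  [set p | [/\ p.1.1 < dotv theta p.1.2, K p.2 & K (p.2 - p.1.2)]].

Let cvxK x y l : K x -> K y -> 0 < l < 1 -> K ((1 - l) *: x + l *: y).
Proof.
case: cbK => _ cK _ Kx Ky /andP[l0 l1].
have l0' : 0 <= 1 - l by rewrite subr_ge0 ltW.
have l1' : 1 - l <= 1 by rewrite lerBlDr lerDl ltW.
have : K ((1 - l) *: x + (1 - (1 - l)) *: y).
  exact: set_mem (cK x y (Itv01 l0' l1') (mem_set Kx) (mem_set Ky)).
by rewrite subKr.
Qed.

Let rcA : root_concave 0 A (EFin \o \1_A).
Proof.
have cvxA x y l : A x -> A y -> 0 < l < 1 -> A ((1 - l) *: x + l *: y).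
  move=> [x1 x2 x3] [y1 y2 y3] l01; have /andP[l0 l1] := l01; split => /=.
  - rewrite dotvDr !dotvZr /GRing.scale/=.
    have l1' : 0 < 1 - l by rewrite subr_gt0.
    by rewrite ltrD// ltr_pM2l.
  - exact: cvxK.
  - have -> : (1 - l) *: x.2 + l *: y.2 - ((1 - l) *: x.1.2 + l *: y.1.2) =
        (1 - l) *: (x.2 - x.1.2) + l *: (y.2 - y.1.2).
      by rewrite !scalerBr opprD addrACA.
    exact: cvxK.
split.
- exact: cvxA.
- by move=> x; rewrite lee_fin.
- by move=> x nA; rewrite /= indicE memNset.
- by exists 1 => x; rewrite lee_fin indicE; case: (_ \in _).
- by move=> _ x Ax; rewrite /= indicE mem_set.
- move=> x y l a b Ax Ay l01 _ _ _ _; rewrite expr0 /= indicE mem_set//.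
  exact: cvxA.
Qed.

Let mA u : measurable [set w | A (u, w)].
Proof.
have mlin := measurable_rV_lin (R := R) (n := n) (- 1).
have [h1|h1] := pselect (u.1 < dotv theta u.2); last first.
  rewrite (_ : [set w | _] = set0)//.
  by apply/seteqP; split=> w // [].
rewrite (_ : [set w | _] = K `&` ((fun w => w - u.2) @^-1` K)).
  apply: measurableI => //; rewrite -[Y in measurable Y]setTI.
  have m1 : measurable_fun setT (fun w : 'rV[R]_n => w - u.2).
    rewrite (_ : (fun w => _) = (fun p : 'rV[R]_n * 'rV[R]_n => p.2 + -1 *: p.1) \o (pair u.2)).
      by apply: (measurableT_comp mlin); exact: pair1_measurable.
    by apply/funext => w /=; rewrite scaleN1r.
  exact: m1.
by apply/seteqP; split=> w /= [] //.
Qed.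

Let inner s z : (\int[lam]_w (EFin \o \1_A) ((s, z), w) =
  (if s < dotv theta z then covariogram K z else 0)%:E)%E.
Proof.
case: ifPn => hs; last first.
  apply: integral0_eq => w _ /=; rewrite indicE memNset// => -[/= h1].
  by move: hs; rewrite h1.
rewrite (covariogramE cbK); apply: eq_integral => w _ /=; rewrite !indicE.
suff -> : (((s, z), w) \in A) = ((z, w) \in [set p | K p.2 /\ K (p.2 - p.1)]) by [].
by apply/idP/idP => /set_mem/= h1; apply/mem_set; case: h1.
Qed.

Let half (s : R) : \bar R :=
  (\int[lam]_(z in [set z | (s < dotv theta z)%R]) (covariogram K z)%:E)%E.

(** Integrating w out of the indicator of [A] leaves the covariogram restricted to the half-space,
    and integrating z out leaves [half]; the exponent goes from 0 to n and then to 2n. *)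
Let rc_half : root_concave k.+1 [set s : R^o | exists z, DK z /\ s < dotv theta z] half.
Proof.
have [r Kr] : exists r : R, forall x, K x -> forall i, `|x ord0 i| <= r.
  by case: cbK => /compact_coord_bounded[r _ Kr] _ _; exists r.
have [r2 DKr] := diff_bounded.
have A_DK p : A p -> DK p.1.2.
  by move=> [_ h1 h2]; apply/difference_bodyP; exists p.2.
have rc1 : root_concave (0 + n) [set u | exists w, A (u, w)]
    (fun u => \int[lam]_w (EFin \o \1_A) (u, w))%E.
  apply: root_concave_marginal_rV rcA _ _.
    by move=> u; apply/measurable_EFinP; exact: (measurable_indic (mA u)).
  by exists r => u w [_ /Kr].
have innerE s : (fun z => \int[lam]_w (EFin \o \1_A) ((s, z), w))%E =
    (fun z => (if s < dotv theta z then covariogram K z else 0)%:E).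
  by apply/funext => z; exact: inner.
have rc2 : root_concave (0 + n + n) [set s : R^o | exists z, [set u | exists w, A (u, w)] (s, z)]
    (fun s => \int[lam]_z (fun u => \int[lam]_w (EFin \o \1_A) (u, w)) (s, z))%E.
  apply: root_concave_marginal_rV rc1 _ _.
    move=> s; rewrite innerE; apply/measurable_EFinP.
    apply: measurable_fun_ifT => //.
    by apply: measurable_fun_ltr => //; exact: measurable_dotv.
  by exists r2 => s z [w /A_DK]; exact: DKr.
rewrite kS -[n in (n + _)%N]add0n.
rewrite (_ : [set s | _] = [set s : R^o | exists z, [set u | exists w, A (u, w)] (s, z)]); last first.
  apply/seteqP; split=> s /=.
    by move=> [z [/difference_bodyP[w Kw Kwz] hs]]; exists z, w.
  by move=> [z [w Aw]]; exists z; split; [exact: (A_DK _ Aw)|case: Aw].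
rewrite (_ : half = (fun s => \int[lam]_z (fun u => \int[lam]_w (EFin \o \1_A) (u, w)) (s, z))%E)//.
apply/funext => s; rewrite innerE /half integral_mkcond; apply: eq_integral => z _.
rewrite patchE (_ : (z \in _) = (s < dotv theta z)); first by case: ifP.
by apply/idP/idP; rewrite inE.
Qed.

Let tail_concave s t l a b : 0 <= s < h -> 0 <= t < h ->
  0 < l < 1 -> 0 <= a -> 0 <= b ->
  ((c * a ^+ k.+1)%:E <= \int[lam]_(z in [set z | (s < X z)%R]) (D z)%:E)%E ->
  ((c * b ^+ k.+1)%:E <= \int[lam]_(z in [set z | (t < X z)%R]) (D z)%:E)%E ->
  ((c * ((1 - l) * a + l * b) ^+ k.+1)%:E <=
    \int[lam]_(z in [set z | (((1 - l) * s + l * t)%R < X z)%R]) (D z)%:E)%E.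
Proof.
move=> /andP[s_ge0 sh] /andP[t_ge0 th'] l01 a0 b0.
have /andP[l0 l1] := l01.
have st0 : 0 <= (1 - l) * s + l * t by rewrite addr_ge0 ?mulr_ge0 ?subr_ge0 ?(ltW l0) ?(ltW l1).
(* Since e^(k+1) = c / 2, the test numbers e a and e b absorb both the total mass c and the factor 2
   between the two-sided and the one-sided tail. *)
pose e := (c / 2) `^ (k.+1%:R^-1).
have e0 : 0 <= e by exact: powR_ge0.
have eE : e ^+ k.+1 = c / 2.
  by rewrite -powR_mulrn// -powRrM mulVf ?pnatr_eq0// powRr1// divr_ge0// ltW.
have cE x : c * x ^+ k.+1 = 2 * (e * x) ^+ k.+1.
  by rewrite exprMn eE; field.
have mem s1 : s1 < h -> [set s : R^o | exists z, DK z /\ s < dotv theta z] s1.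
  move=> s1h; have e1 : 0 < h - s1 by rewrite subr_gt0.
  have [_ [z Dz <-]] := sup_adherent e1 hsup.
  by rewrite -/h opprB addrCA subrr addr0 => hz; exists z.
rewrite !tailE// !cE !EFinM !lee_pmul2l// => ha hb.
have := rc_root rc_half (mem _ sh) (mem _ th') l01 (mulr_ge0 e0 a0) (mulr_ge0 e0 b0) ha hb.
by rewrite (_ : (1 - l) * (e * a) + l * (e * b) = e * ((1 - l) * a + l * b)); last by ring.
Qed.

Let EX p : R := \int[lam]_z (pot p (X z) * D z).

Let EXp_moment p : -1 < p -> p != 0 ->
  \int[lam]_z (X z `^ p * covariogram K z) = p * EX p + c.
Proof.
move=> p1 pn0.
have ip : wintegrable lam X D (pot p).
  exact: (wintegrable_pot_tail mX mD D0 X0 DX0 c0 h0 Dtot Dh tail_concave p1).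
have i1 : wintegrable lam X D (cst 1).
  apply: (wintegrable_ge0 mX mD D0) => //.
  by under eq_integral do rewrite mul1e; rewrite Dtot ltry.
have [h1 h2] := wintegral_lincomb (- p) 0 ip i1 i1.
have e s : 0 < s -> s `^ p = cst 1 s - - p * pot p s - 0.
  by move=> s0; rewrite /pot (negbTE pn0) /=; field.
transitivity (\int[lam]_z (X z `^ p * D z)).
  have mXp : measurable_fun setT (fun z => X z `^ p).
    exact: (measurableT_comp (@measurable_powR R p) mX).
  by rewrite /Rintegral ae_D.
rewrite (wintegral_eq lam X0 DX0 e) h2 mul0r subr0 mulNr opprK addrC; congr (_ + _).
have Dc : \int[lam]_z D z = c by rewrite /Rintegral Dtot.
by rewrite -[RHS]Dc; apply: eq_Rintegral => z _; rewrite mul1r.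

Qed.

Let EX_le p : -1 < p -> EX p <= c * pot p h.
Proof.
move=> p1.
have ip : wintegrable lam X D (pot p).
  exact: (wintegrable_pot_tail mX mD D0 X0 DX0 c0 h0 Dtot Dh tail_concave p1).
have iD : lam.-integrable setT (EFin \o D).
  apply/integrableP; split; first exact/measurable_EFinP.
  under eq_integral do rewrite /= ger0_norm//.
  by rewrite Dtot ltry.
have <- : \int[lam]_z (pot p h * D z) = c * pot p h.
  by rewrite RintegralZl// /Rintegral Dtot mulrC.
apply: le_Rintegral => //.
  rewrite (_ : _ \o _ = (fun z => (pot p h)%:E * (D z)%:E)%E); last first.
    by apply/funext => z /=; rewrite EFinM.
  exact: integrableZl.
move=> z _; have := X0 z; rewrite le_eqVlt => /predU1P[/esym/DX0 ->|Xz].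
  by rewrite !mulr0.
have [Xh|/Dh ->] := leP (X z) h; last by rewrite !mulr0.
by rewrite ler_wpM2r// ler_pot.
Qed.

Let EX_ge p : -1 < p -> c * beta_pot k h p <= EX p.
Proof.
move=> p1.
exact: (beta_pot_le mX mD D0 X0 DX0 c0 h0 Dtot Dh tail_concave p1).
Qed.

Let scale p : R := kappa n p * mean_zonoid_radial p K theta.

(** Solves [EX p = c * beta_pot k H p] for H. With I the p-th moment and b the binomial coefficient,
    the solution is H^p = b I / c for p != 0; for p = 0, ln H is the harmonic number plus EX 0 / c.
    Either way H is the inverse of [scale p]. *)
Let scaleP p : -1 < p -> 0 < scale p /\ EX p = c * beta_pot k (scale p)^-1 p.
Proof.
move=> p1; have [p0|pn0] := boolP (p == 0).
  rewrite /scale /kappa /mean_zonoid_radial p0 -/c.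
  have -> : \int[lam]_z (ln `|dotv theta z| * covariogram K z) = EX p.
    have mlnX : measurable_fun setT (fun z => ln (X z)).
      exact: (measurableT_comp (@measurable_ln R) mX).
    rewrite /EX /pot p0; rewrite /Rintegral -(ae_D mlnX)//.
  rewrite -expRD; split; first exact: expR_gt0.
  rewrite /beta_pot p0 -expRN expRK harmonic_numberE.
  rewrite (_ : (2 * n)%N = k.+1); last by rewrite kS mul2n addnn.
  by field; rewrite gt_eqF.
have b0 := beta_prod_gt0 k p1; set b := \prod_(_ < _) _ in b0.
set I := \int[lam]_z (X z `^ p * covariogram K z).
have IE : I = p * EX p + c by exact: EXp_moment.
(* Positivity lets the powers p and - 1 / p cancel. Multiplication by p reverses inequalities for p
   < 0, hence the upper bound [EX_le] in that case and the lower bound [EX_ge] for p > 0. *)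
have I0 : 0 < I.
  have hp : 0 < h `^ p by exact: powR_gt0.
  rewrite IE; have [pl|pg] := ltP p 0.
    have := EX_le p1; rewrite /pot (negbTE pn0) -(ler_nM2l pl).
    have -> : p * (c * ((h `^ p - 1) / p)) = c * h `^ p - c by field.
    by have := mulr_gt0 c0 hp; lra.
  have {}pg : 0 < p by rewrite lt_neqAle eq_sym pn0.
  have := EX_ge p1; rewrite /beta_pot (negbTE pn0) -/b -(ler_pM2l pg).
  have -> : p * (c * ((h `^ p / b - 1) / p)) = c * (h `^ p / b) - c by field; rewrite pn0 gt_eqF.
  by have := mulr_gt0 c0 (divr_gt0 hp b0); lra.
have binomE : binom2n n p = b.
  rewrite binom2nE// /b; by rewrite (_ : (2 * n)%N = k.+1)//; rewrite kS mul2n addnn.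
have M0 : 0 < c^-1 * I by rewrite mulr_gt0 ?invr_gt0.
rewrite /scale /kappa /mean_zonoid_radial (negbTE pn0) -/c -/I binomE.
rewrite -powRM ?ltW//; split; first by rewrite powR_gt0// mulr_gt0.
rewrite /beta_pot (negbTE pn0) -/b -powRN opprK -powRrM mulVf// powRr1; last first.
  by rewrite mulr_ge0 ?ltW.
by rewrite IE; field; rewrite pn0 !gt_eqF.
Qed.

Let scaleE p : -1 < p -> exists H, [/\ 0 < H,
  kappa n p * mean_zonoid_radial p K theta = H^-1,
  EX p = c * beta_pot k H p & h <= H].
Proof.
move=> p1; have [s0 sE] := scaleP p1; exists (scale p)^-1.
have H0 : 0 < (scale p)^-1 by rewrite invr_gt0.
rewrite invrK; split=> //; apply: (beta_pot_le_inv (k := k) p1 h0 H0).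
by rewrite -(ler_pM2l c0) -sE EX_ge.
Qed.

Lemma radial_width p : -1 < p ->
  kappa n p * mean_zonoid_radial p K theta * h <= 1.
Proof.
move=> p1; have [H [H0 -> _ hH]] := scaleE p1.
by rewrite mulrC ler_pdivrMr// mul1r.
Qed.

(** The mean of [pot q] is at most that of the extremal law of length H_p and equals that of the law
    of length H_q, so H_q <= H_p; the radial functions scaled by kappa are the inverses. *)
Lemma radial_le p q : -1 < p -> p < q ->
  kappa n p * mean_zonoid_radial p K theta <= kappa n q * mean_zonoid_radial q K theta.
Proof.
move=> p1 pq; have q1 := lt_trans p1 pq.
have [Hp [Hp0 ep Ep hHp]] := scaleE p1; have [Hq [Hq0 eq Eq _]] := scaleE q1.
(* A plain [rewrite ep] would compare [kappa n p] with [kappa n q] by unfolding. *)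
have le_eq2 (a b a' b' : R) : a = a' -> b = b' -> a' <= b' -> a <= b by move=> -> ->.
apply: (le_eq2 _ _ _ _ ep eq); rewrite lef_pV2 ?posrE//; apply: (beta_pot_le_inv (k := k) q1 Hq0 Hp0).
rewrite -(ler_pM2l c0) -Eq.
exact: (pot_le_beta mX mD D0 X0 DX0 c0 h0 Dtot Dh atomless tail_concave p1 pq hHp Ep).
Qed.

Lemma radial_gt0 p : -1 < p -> 0 < kappa n p * mean_zonoid_radial p K theta.
Proof. by move=> /scaleP[]. Qed.

Lemma radial_dotv p z : -1 < p -> difference_body K z ->
  kappa n p * mean_zonoid_radial p K theta * dotv theta z <= 1.
Proof.
move=> p1 Dz; apply: le_trans (radial_width p1).
rewrite ler_pM2l ?radial_gt0//; apply: le_trans (ler_norm _) _.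
exact: difference_body_width.
Qed.

End direction.

Lemma kappa_gt0 (R : realType) n (p : R) : -1 < p -> 0 < kappa n p.
Proof.
move=> p1; rewrite /kappa; case: ifP => _; first exact: expR_gt0.
apply: powR_gt0; rewrite binom2nE//; case: n => [|n]; first by rewrite muln0 big_ord0.
by rewrite mulnS addSn; exact: beta_prod_gt0.
Qed.

Section dilate_star_body.
Context {R : realType} {n : nat}.
Implicit Types (rho : 'rV[R]_n -> R) (M : set 'rV[R]_n).

Lemma dilate_star_body_of_sub (a b : R) rho rho' : 0 < a -> 0 < b ->
  (forall theta, unit_sphere theta -> a * rho theta <= b * rho' theta) ->
  dilate a (star_body_of rho) `<=` dilate b (star_body_of rho').
Proof.
move=> a0 b0 ab _ [_ [theta [t [th /andP[t0 tr] ->]]] <-].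
exists ((a * t / b) *: theta); last by rewrite !scalerA mulrC divfK// gt_eqF.
exists theta, (a * t / b); split=> //.
rewrite divr_ge0 ?mulr_ge0 ?(ltW a0) ?(ltW b0)//= ler_pdivrMr// [leRHS]mulrC.
by apply: le_trans (ab _ th); rewrite ler_pM2l.
Qed.

Lemma dilate_star_body_of_polar (a : R) rho M : 0 < a ->
  (forall theta z, unit_sphere theta -> M z -> a * rho theta * dotv theta z <= 1) ->
  dilate a (star_body_of rho) `<=` polar M.
Proof.
move=> a0 H _ [_ [theta [t [th /andP[t0 tr] ->]]] <-] z Mz.
rewrite dotvC scalerA -[z]scale1r dotvZ mulr1.
(* The bound at the boundary value t = rho theta passes to smaller t when the inner product is
   positive; otherwise the left side is at most 0. *)
have [z0|z0] := leP (dotv theta z) 0.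
  by apply: le_trans ler01; rewrite mulr_ge0_le0// mulr_ge0// ltW.
apply: le_trans (H _ _ th Mz).
by rewrite ler_pM2r// ler_pM2l.
Qed.

End dilate_star_body.

Theorem theorem12 (R : realType) (n : nat) (K : set 'rV[R]_n) (p q : R) :
  (0 < n)%N -> convex_body K -> -1 < p -> p < q ->
  dilate (kappa n p) (polar_mean_zonoid p K)
    `<=` dilate (kappa n q) (polar_mean_zonoid q K) /\
  dilate (kappa n q) (polar_mean_zonoid q K) `<=` polar (difference_body K).
Proof.
move=> n0 cbK p1 pq; have q1 := lt_trans p1 pq; split.
  apply: (dilate_star_body_of_sub (kappa_gt0 n p1) (kappa_gt0 n q1)) => theta th.
  exact: (radial_le n0 cbK th p1 pq).
apply: (dilate_star_body_of_polar (kappa_gt0 n q1)) => theta z th Kz.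
exact: (radial_dotv n0 cbK th q1 Kz).
Qed.
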